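(* Let $\mathbf{B}^4$ be the open unit ball of $\mathbf{R}^4$. For every $x\in\mathbf{B}^4$, with $r=|x|$, and every bounded real-valued harmonic function $u$ on $\mathbf{B}^4$, $$|\nabla u(x)|\le \frac{r\sqrt{4-r^2}\,(2+r^2)+4(1-r^2)\tan^{-1}\left[\frac{r\sqrt{4-r^2}}{r^2-2}\right]}{\pi(1-r^2)r^3}\,|u|_\infty ,$$ and this inequality is sharp: for every $x\in\mathbf{B}^4$ the factor multiplying $|u|_\infty$ on the right-hand side is the smallest constant for which the inequality holds for all bounded real-valued harmonic functions $u$ on $\mathbf{B}^4$. For $x=0$ the factor is understood as its limit as $r\to0^+$.
   Context: $|u|_\infty=\sup_{y\in\mathbf{B}^4}|u(y)|$; $|\nabla u(x)|$ is the Euclidean norm of the gradient; $\tan^{-1}$ is the principal branch of arctangent with values in $(-\pi/2,\pi/2)$. *)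

(* Defs.v *)
From HB Require Import structures.
From mathcomp Require Import all_boot all_order all_algebra.
From mathcomp Require Import all_classical all_reals all_analysis.

Set Implicit Arguments.
Unset Strict Implicit.
Unset Printing Implicit Defensive.

Import Order.TTheory GRing.Theory Num.Theory.
Import numFieldNormedType.Exports.

Local Open Scope classical_set_scope.
Local Open Scope ring_scope.

(* The library norm on 'rV[R]_n is the max-norm; it induces the usual topology,
   but lengths and the unit ball must be taken with the Euclidean norm. *)
Definition enorm (R : realType) (n : nat) (x : 'rV[R]_n) : R :=
  Num.sqrt (\sum_(i < n) x 0 i ^+ 2).

Definition unit_ball (R : realType) (n : nat) : set 'rV[R]_n :=
  [set x | enorm x < 1].
Arguments unit_ball : clear implicits.

Definition partial (R : realType) (n : nat) (i : 'I_n) (u : 'rV[R]_n -> R) :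
    'rV[R]_n -> R :=
  fun x => 'D_(delta_mx 0 i) u x.

Definition gradient (R : realType) (n : nat) (u : 'rV[R]_n -> R)
    (x : 'rV[R]_n) : 'rV[R]_n :=
  \row_(i < n) partial i u x.

Definition laplacian (R : realType) (n : nat) (u : 'rV[R]_n -> R)
    (x : 'rV[R]_n) : R :=
  \sum_(i < n) partial i (partial i u) x.

(* Meant for open A, where {for x, continuous _} and derivability at x only
   involve the values on A of the function at hand. *)
Definition C2_on (R : realType) (n : nat) (A : set 'rV[R]_n)
    (u : 'rV[R]_n -> R) : Prop :=
  forall x, A x ->
    {for x, continuous u} /\
    (forall i, derivable u x (delta_mx 0 i) /\
               {for x, continuous (partial i u)}) /\
    (forall i j, derivable (partial i u) x (delta_mx 0 j) /\
                 {for x, continuous (partial j (partial i u))}).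

Definition harmonic_on (R : realType) (n : nat) (A : set 'rV[R]_n)
    (u : 'rV[R]_n -> R) : Prop :=
  C2_on A u /\ forall x, A x -> laplacian u x = 0.

(* Genuine supremum only when u is bounded on A (and A is nonempty). *)
Definition sup_norm (R : realType) (n : nat) (A : set 'rV[R]_n)
    (u : 'rV[R]_n -> R) : R :=
  sup [set `|u y| | y in A].

Definition bounded_harmonic (R : realType) (n : nat) (u : 'rV[R]_n -> R) :
    Prop :=
  harmonic_on (unit_ball R n) u /\ [bounded u y | y in unit_ball R n].

Definition khavinson4_formula (R : realType) (r : R) : R :=
  (r * Num.sqrt (4 - r ^+ 2) * (2 + r ^+ 2)
   + 4 * (1 - r ^+ 2) * atan (r * Num.sqrt (4 - r ^+ 2) / (r ^+ 2 - 2)))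
  / (pi * (1 - r ^+ 2) * r ^+ 3).

Definition khavinson4 (R : realType) (r : R) : R :=
  if r == 0 then lim (khavinson4_formula s @[s --> 0^'+])
  else khavinson4_formula r.

(* Main.v *)
Require Import Defs.
From HB Require Import structures.
From mathcomp Require Import all_boot all_order all_algebra.
From mathcomp Require Import all_classical all_reals all_analysis.
From mathcomp Require Import measurable_realfun ring lra.

Set Implicit Arguments.
Unset Strict Implicit.
Unset Printing Implicit Defensive.

Import Order.TTheory GRing.Theory Num.Theory.
Import numFieldNormedType.Exports.

Local Open Scope classical_set_scope.
Local Open Scope ring_scope.

(* By the Poisson representation, the derivative of u at x in a unit direction l
   is the integral of the boundary values of u against the derivative of the
   Poisson kernel, so the best constant is the supremum over l of the L^1 norm of
   that derivative, attained for boundary values equal to its sign. By rotation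
   x = r e_0 and l = c e_0 + s e_1. For l radial the norm is computed explicitly.
   For the other directions, the mean over the second spherical angle of the
   absolute value is written as an integral over an auxiliary angle b; exchanging
   the integrals, the norm becomes the integral over ]0, pi/2[ of
   max(|c| cos b, |s| sin b) G(b) for a decreasing function G independent of l,
   and since the first factor has integral 1 for every l, the radial direction
   is the worst one. The value at r = 0 follows by continuity. *)

(** * Dot product and directional derivatives *)

(** Two obstacles shape the proof. A bounded harmonic function on the open ball has no given
    boundary values, so the Poisson formula is applied to the dilates y |-> u (c y) with 0 < c < 1,
    and c tends to 1. Moreover the integrands over the first spherical angle cannot be compared
    pointwise: where the radial derivative of the kernel vanishes, every non-radial direction has
    the larger integrand. This is what the auxiliary angle cures. For a fixed first angle the mean
    over the second one is, up to a factor, the integral of |c + s v| over an interval [-k, k]; with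
    v = tan b it becomes an integral of |c cos b + s sin b| / (cos b)^3, where (c, s) meets the
    first angle only through the range of b. Integrating the first angle before b then leaves two
    weights on ]0, pi/2[ to compare. The radial weight cos b dominates up to some angle and is
    dominated after it, and a decreasing [G] favours the former part. The mass of the Poisson kernel
    is not integrated directly: it comes from rotation invariance and the maximum principle. In
    dimension 4 the kernel is a rational function, which keeps all primitives elementary. *)

Definition dotv (R : realType) n (x y : 'rV[R]_n) : R :=
  \sum_(i < n) x 0 i * y 0 i.

Section DotProduct.
Context {R : realType} {n : nat}.
Implicit Types x y z v : 'rV[R]_n.

Lemma dotvC x y : dotv x y = dotv y x.
Proof. by apply: eq_bigr => i _; rewrite mulrC. Qed.

Lemma dotvDl x y z : dotv (x + y) z = dotv x z + dotv y z.
Proof. by rewrite -big_split; apply: eq_bigr => i _; rewrite mxE mulrDl. Qed.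

Lemma dotvZl c x y : dotv (c *: x) y = c * dotv x y.
Proof. by rewrite mulr_sumr; apply: eq_bigr => i _; rewrite mxE mulrA. Qed.

Lemma dotvDr x y z : dotv x (y + z) = dotv x y + dotv x z.
Proof. by rewrite dotvC dotvDl !(dotvC x). Qed.

Lemma dotvZr c x y : dotv x (c *: y) = c * dotv x y.
Proof. by rewrite dotvC dotvZl dotvC. Qed.

Lemma dotvNl x y : dotv (- x) y = - dotv x y.
Proof. by rewrite -scaleN1r dotvZl mulN1r. Qed.

Lemma dotvNr x y : dotv x (- y) = - dotv x y.
Proof. by rewrite dotvC dotvNl dotvC. Qed.

Lemma dotvv_ge0 x : 0 <= dotv x x.
Proof. by apply: sumr_ge0 => i _; rewrite -expr2 sqr_ge0. Qed.

Lemma dotvv0 x : dotv x x = 0 -> x = 0.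
Proof.
move=> h; apply/rowP => i; rewrite mxE; apply/eqP.
have := @psumr_eq0P _ _ xpredT (fun i => x 0 i * x 0 i).
move=> /(_ (fun i _ => sqr_ge0 _) h i isT) /eqP.
by rewrite mulf_eq0 orbb.
Qed.

Lemma enorm_ge0 x : 0 <= enorm x.
Proof. exact: sqrtr_ge0. Qed.

Lemma enormE x : enorm x = Num.sqrt (dotv x x).
Proof. by congr Num.sqrt; apply: eq_bigr => i _; rewrite expr2. Qed.

Lemma enorm_sqr x : enorm x ^+ 2 = dotv x x.
Proof. by rewrite enormE sqr_sqrtr// dotvv_ge0. Qed.

Lemma enorm_le x (t : R) : 0 <= t -> (enorm x <= t) = (dotv x x <= t ^+ 2).
Proof. by move=> t0; rewrite -enorm_sqr ler_pXn2r// nnegrE enorm_ge0. Qed.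

Lemma enorm_lt x (t : R) : 0 <= t -> (enorm x < t) = (dotv x x < t ^+ 2).
Proof. by move=> t0; rewrite -enorm_sqr ltr_pXn2r// nnegrE enorm_ge0. Qed.

Lemma unit_ballE x : unit_ball R n x <-> dotv x x < 1.
Proof. by rewrite /unit_ball/= enorm_lt// expr1n. Qed.

Lemma enormZ c x : enorm (c *: x) = `|c| * enorm x.
Proof.
by rewrite !enormE dotvZl dotvZr mulrA -expr2 sqrtrM ?sqr_ge0// sqrtr_sqr.
Qed.

Lemma dotv_sqr_le x y : dotv x y ^+ 2 <= dotv x x * dotv y y.
Proof.
have [y0|yn0] := eqVneq (dotv y y) 0.
  rewrite (dotvv0 y0); have -> : (0 : 'rV[R]_n) = 0 *: 0 by rewrite scaler0.
  by rewrite !dotvZr !mul0r mulr0 expr0n.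
have yp : 0 < dotv y y by rewrite lt_neqAle eq_sym yn0 dotvv_ge0.
have := dotvv_ge0 (dotv y y *: x - dotv x y *: y).
have -> : dotv (dotv y y *: x - dotv x y *: y) (dotv y y *: x - dotv x y *: y)
    = dotv y y * (dotv x x * dotv y y - dotv x y ^+ 2).
  rewrite !(dotvDl, dotvDr, dotvNl, dotvNr, dotvZl, dotvZr) (dotvC y x); ring.
by rewrite pmulr_rge0// subr_ge0.
Qed.

Lemma dotv_le x y : dotv x y <= enorm x * enorm y.
Proof.
rewrite (le_trans (ler_norm _))// -sqrtr_sqr !enormE -sqrtrM ?dotvv_ge0//.
by rewrite ler_wsqrtr// dotv_sqr_le.
Qed.

Lemma coord_le_enorm x i : `|x 0 i| <= enorm x.
Proof.
rewrite -sqrtr_sqr enormE ler_wsqrtr// /dotv (bigD1 i)//= -expr2 lerDl.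
by apply: sumr_ge0 => j _; rewrite -expr2 sqr_ge0.
Qed.

Lemma dotv_delta x i : dotv x (delta_mx 0 i) = x 0 i.
Proof.
rewrite /dotv (bigD1 i)//= big1 ?addr0 ?mxE ?eqxx ?mulr1// => j /negPf ji.
by rewrite mxE ji andbF mulr0.
Qed.

Lemma continuous_sum_fun (T : topologicalType) m (F : 'I_m -> T -> R) (a : T) :
  (forall i, {for a, continuous (F i)}) ->
  {for a, continuous (fun t => \sum_(i < m) F i t)}.
Proof.
elim: m F => [F _|m IH F h].
  rewrite (_ : (fun t => _) = cst 0); first exact: cst_continuous.
  by apply/funext => t; rewrite big_ord0.
rewrite (_ : (fun t => _) =
  (fun t => F ord0 t + \sum_(i < m) F (lift ord0 i) t)); last first.
  by apply/funext => t; rewrite big_ord_recl.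
by apply: cvgD; [exact: h|apply: IH => i; exact: h].
Qed.

Lemma continuous_dotv z : continuous (fun x : 'rV[R]_n => dotv x z).
Proof.
by move=> x; apply: continuous_sum_fun => i; apply: continuousM;
  [exact: coord_continuous|exact: cst_continuous].
Qed.

Lemma continuous_dotvv : continuous (fun x : 'rV[R]_n => dotv x x).
Proof.
by move=> x; apply: continuous_sum_fun => i; apply: continuousM;
  exact: coord_continuous.
Qed.

Lemma closed_ball_compact (t : R) : 0 <= t ->
  compact [set x : 'rV[R]_n | enorm x <= t].
Proof.
move=> t0; apply: bounded_closed_compact.
  exists t; split; first exact: num_real.
  move=> s ts x /= xt; rewrite /Num.norm/= mx_normrE.
  apply/bigmax_leP; split; first by rewrite (le_trans t0)// ltW.
  by move=> [i j] _ /=; rewrite ord1 (le_trans (coord_le_enorm _ _))//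
    (le_trans xt)// ltW.
have -> : [set x : 'rV[R]_n | enorm x <= t] =
   (fun x => dotv x x) @^-1` [set s | s <= t ^+ 2].
  by apply/seteqP; split => x /=; rewrite enorm_le.
by apply: preimage_closed; [move=> x _; exact: continuous_dotvv|exact: closed_le].
Qed.

End DotProduct.

Section DirectionalDerivative.
Context {R : realType}.

(** A directional derivative sees only the restriction to a line; this passes between vector
    arguments and one real variable, in both directions. *)
Lemma is_derive_line_eq (V V' W : normedModType R) (f : V -> W) (g : V' -> W)
    a v a' v' d :
  (forall h : R, g (h *: v' + a') = f (h *: v + a)) ->
  is_derive a v f d -> is_derive a' v' g d.
Proof.
move=> gf [fd fE].
have E : (fun h : R => h^-1 *: ((g \o shift a') (h *: v') - g a')) =
         (fun h : R => h^-1 *: ((f \o shift a) (h *: v) - f a)).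
  apply/funext => h /=; rewrite gf.
  by have := gf 0; rewrite !scale0r !add0r => ->.
by apply: DeriveDef; [rewrite /derivable E|rewrite /derive E].
Qed.

Lemma is_derive_quadratic (V : normedModType R) (f : V -> R) a v (c d : R) :
  (forall h : R, f (h *: v + a) = f a + h * c + h ^+ 2 * d) ->
  is_derive a v f c.
Proof.
move=> fE.
have L : (fun h : R => h^-1 *: ((f \o shift a) (h *: v) - f a)) @ 0^' --> c.
  apply: (@cvg_trans _ ((fun h : R => c + h * d) @ 0^')).
    apply: near_eq_cvg; near=> h.
    have h0 : h != 0 by near: h; exact: nbhs_dnbhs_neq.
    by rewrite /= fE /GRing.scale/=; field.
  have : (c + h * d) @[h --> (0 : R)] --> c + 0 * d.
    apply: cvgD; first exact: cvg_cst.
    by apply: cvgM; [exact: cvg_id|exact: cvg_cst].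
  by rewrite mul0r addr0; exact: cvg_within_filter.
apply: DeriveDef; first by apply/cvg_ex; exists c.
exact: cvg_lim L.
Unshelve. all: by end_near. Qed.

Lemma is_derive_dotv n (z x v : 'rV[R]_n) :
  is_derive x v (fun y => dotv y z) (dotv v z).
Proof.
apply: (@is_derive_quadratic _ _ _ _ _ 0) => h.
by rewrite dotvDl dotvZl mulr0 addr0 addrC.
Qed.

Lemma is_derive_dotvv n (x v : 'rV[R]_n) :
  is_derive x v (fun y => dotv y y) (2 * dotv x v).
Proof.
apply: (@is_derive_quadratic _ _ _ _ _ (dotv v v)) => h.
rewrite !(dotvDl, dotvDr, dotvZl, dotvZr) (dotvC v x); ring.
Qed.

Lemma is_derive_along (V : normedModType R) (f : V -> R) x v (s d : R) :
  is_derive (x + s *: v) v f d -> is_derive s 1 (fun t => f (x + t *: v)) d.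
Proof.
apply: is_derive_line_eq => h.
by rewrite scalerDl /GRing.scale/= mulr1 addrCA.
Qed.

End DirectionalDerivative.

(** * Maximum principle *)

Section MaximumPrinciple.
Context {R : realType}.

(** At an interior maximum [df 0 = 0]. A positive derivative of [df] at 0 makes [df] positive just
    to the right of 0, and the mean value theorem then produces a value above [f 0]. *)
Lemma max_second_derivative_le0 (f df : R -> R) (e d2 : R) : 0 < e ->
  (forall s, s \in `]-e, e[ -> is_derive s 1 f (df s)) ->
  is_derive (0 : R) 1 df d2 -> 0 < d2 ->
  (forall s, s \in `]-e, e[ -> f s <= f 0) -> False.
Proof.
move=> e0 fd ddf d2_gt0 fmax.
have z_in : 0 \in `]-e, e[ by rewrite in_itv/= oppr_lt0 e0.
have df0 : df 0 = 0.
  have h : is_derive (0 : R) 1 f 0.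
    apply: (@derive1_at_max _ _ (- e) e) => //; first by rewrite ge0_cp// ltW.
    by move=> t /fd[].
  by have [_ <-] := fd _ z_in; have [_ ->] := h.
have : (fun h : R => h^-1 *: ((df \o shift 0) (h *: (1 : R)) - df 0)) @ (0 : R)^' --> d2.
  by case: ddf => + <-.
move=> /cvgrPdist_lt /(_ _ d2_gt0).
rewrite near_withinE => /nbhs_ballP[a /= a0 ha].
have [b [b0 be ba]] : exists b, [/\ 0 < b, b < e & b < a].
  exists (Num.min (a / 2) (e / 2)).
  rewrite lt_min !divr_gt0//; split=> //; rewrite gt_min; apply/orP.
    by right; lra.
  by left; lra.
have df_gt0 c : c \in `]0, b[ -> 0 < df c.
  rewrite in_itv/= => /andP[c0 cb].
  have := ha c; rewrite /ball/= sub0r normrN gtr0_norm// (lt_trans cb)//.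
  move=> /(_ isT); rewrite gt_eqF// => /(_ isT).
  rewrite addr0 df0 subr0 /GRing.scale/= mulr1 => h.
  have : 0 < c^-1 * df c.
    by move: h; rewrite ltr_norml => /andP[_]; rewrite ltrBlDr -ltrBlDl subrr.
  by rewrite pmulr_rgt0// invr_gt0.
have sub c : c \in `[0, b] -> c \in `]-e, e[.
  rewrite !in_itv/= => /andP[c0 cb].
  by rewrite (lt_le_trans _ c0) ?oppr_lt0//= (le_lt_trans cb).
have fd' c : c \in `]0, b[ -> is_derive c 1 f (df c).
  by move=> cb; apply: fd; apply: sub; apply: subset_itv_oo_cc.
have fc : {within `[0, b], continuous f}.
  by apply: derivable_within_continuous => c /sub /fd[].
have [c cb E] := MVT b0 fd' fc.
have := fmax b; rewrite -subr_le0 E subr0 pmulr_lle0// leNgt df_gt0//.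
by move=> /(_ _)/notF; apply; apply: sub; rewrite in_itv/= lexx ltW.
Qed.

Variable n : nat.
Hypothesis n0 : (0 < n)%N.

(** Adding k |y|^2 gives a function of Laplacian 2 n k > 0, so at an interior maximum some pure
    second derivative would be positive, against [max_second_derivative_le0]. The maximum is
    therefore on the sphere, and k can be as small as desired. *)
Theorem maximum_principle (A : set 'rV[R]_n) (f : 'rV[R]_n -> R) (t m : R) :
  harmonic_on A f -> (forall y, enorm y <= t -> A y) ->
  (forall y, enorm y = t -> f y <= m) -> forall y, enorm y <= t -> f y <= m.
Proof.
move=> [fC2 flap] tA fm y yt.
have t0 : 0 <= t := le_trans (enorm_ge0 _) yt.
apply/ler_addgt0Pr => e e0.
(* On the sphere of radius [t] the perturbation is k t^2, at most [e]. *)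
pose k := e / (t ^+ 2 + 1).
have t21 : 0 < t ^+ 2 + 1 by rewrite ltr_wpDl// sqr_ge0.
have k0 : 0 < k by rewrite divr_gt0.
pose g z := f z + k * dotv z z.
have [||c ct gmax] :=
    @EVT_max_rV R n g [set z : 'rV[R]_n | enorm z <= t] _ (closed_ball_compact t0).
- by exists y.
- apply: continuous_in_subspaceT => z; rewrite inE/= => zt.
  apply: (@continuousD _ _ _ f (fun z => k * dotv z z)).
    by have [] := fC2 _ (tA _ zt).
  by apply: continuousM; [exact: cst_continuous|exact: continuous_dotvv].
move: ct; rewrite inE/= => ct.
have gy : g y <= g c by apply: gmax; rewrite inE.
have fg : f y <= g y by rewrite lerDl mulr_ge0 ?dotvv_ge0// ltW.
have [ct1|ct1] := eqVneq (enorm c) t.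
  rewrite (le_trans fg)// (le_trans gy)// lerD ?fm//.
  rewrite -enorm_sqr ct1 /k mulrAC ler_pdivrMr// ler_wpM2l ?lerDl// ltW//.
exfalso.
have {ct1}ct : dotv c c < t ^+ 2 by rewrite -enorm_lt// lt_neqAle ct1.
have [i hi] : exists i, 0 < partial i (partial i f) c + k * 2.
  apply/not_existsP => h.
  have : \sum_(i < n) (partial i (partial i f) c + k * 2) <= 0.
    by apply: sumr_le0 => i _; rewrite leNgt; apply/negP/h.
  rewrite big_split/= -[X in X + _]/(laplacian f c) flap ?add0r; last first.
    by apply: tA; rewrite enorm_le// ltW.
  rewrite sumr_const card_ord leNgt => /negP; apply.
  by rewrite -[_ *+ n]mulr_natr; apply: mulr_gt0; [exact: mulr_gt0|rewrite ltr0n].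
pose v : 'rV[R]_n := delta_mx 0 i.
pose h s := c + s *: v.
have hE s : dotv (h s) (h s) = dotv c c + s * (2 * c 0 i) + s ^+ 2.
  rewrite /h !(dotvDl, dotvDr, dotvZl, dotvZr) (dotvC v c) /v.
  rewrite !dotv_delta mxE !eqxx/=; ring.
have [e1 e10 he] : exists2 e1, 0 < e1 &
    forall s, s \in `]-e1, e1[ -> enorm (h s) <= t.
  have : (fun s => dotv (h s) (h s)) @ (0 : R) --> dotv c c.
    have -> : dotv c c = dotv c c + 0 * (2 * c 0 i) + 0 * 0 :> R by ring.
    rewrite (_ : (fun s => _) =
      (fun s => dotv c c + s * (2 * c 0 i) + s * s)); last first.
      by apply/funext => s; rewrite hE expr2.
    apply: cvgD; last by apply: cvgM; exact: cvg_id.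
    by apply: cvgD; [exact: cvg_cst|apply: cvgM; [exact: cvg_id|exact: cvg_cst]].
  move=> /cvgr_lt/(_ _ ct)/nbhs_ballP[e1 /= e10 he]; exists e1 => // s.
  rewrite in_itv/= -ltr_norml => se; rewrite enorm_le// ltW//.
  by apply: he; rewrite /ball/= sub0r normrN.
apply: (@max_second_derivative_le0 (g \o h)
    (fun s => partial i f (h s) + k * (2 * dotv (h s) v)) e1
    (partial i (partial i f) c + k * 2)) => //.
- move=> s /he hs; rewrite /comp; apply: is_derive_along; rewrite -/(h s).
  have [_ [/(_ i)[fd _] _]] := fC2 _ (tA _ hs).
  apply: is_deriveD; first exact: DeriveDef.
  have := @is_deriveM _ _ (cst k) (fun z => dotv z z) (h s) v 0 (2 * dotv (h s) v).
  move=> /(_ (is_derive_cst _ _ _) (is_derive_dotvv _ _)).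
  by rewrite scaler0 addr0.
- have ct2 : enorm c <= t by rewrite enorm_le// ltW.
  have [_ [_ /(_ i i)[fd _]]] := fC2 _ (tA _ ct2).
  apply: (@is_derive_along R _ (fun z => partial i f z + k * (2 * dotv z v)) c v).
  rewrite scale0r addr0; apply: is_deriveD; first exact: DeriveDef.
  apply: (@is_derive_quadratic _ _ _ _ _ _ 0) => s.
  by rewrite dotvDl dotvZl [dotv v v]dotv_delta mxE !eqxx/=; ring.
- by move=> s /he hs; rewrite /= [h 0]/h scale0r addr0; apply: gmax; rewrite inE.
Qed.

End MaximumPrinciple.

(** * Bounded kernels and integrals depending on a parameter *)

Section BoundedMeasurable.
Context d {T : measurableType d} {R : realType}.
Implicit Types f g : T -> R.

(** The single integrability condition of the development: it implies integrability for any
    probability measure, and it is stable under algebraic operations, sections and partial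
    integration. *)
Definition bounded_measurable f :=
  measurable_fun setT f /\ exists M, forall x, `|f x| <= M.

Lemma bounded_measurable_cst c : bounded_measurable (fun _ => c).
Proof. by split; [exact: measurable_cst|exists `|c|]. Qed.

Lemma bounded_measurableD f g : bounded_measurable f -> bounded_measurable g ->
  bounded_measurable (fun x => f x + g x).
Proof.
move=> [mf [M fM]] [mg [N gN]]; split; first exact: measurable_funD.
by exists (M + N) => x; rewrite (le_trans (ler_normD _ _))// lerD.
Qed.

Lemma bounded_measurableM f g : bounded_measurable f -> bounded_measurable g ->
  bounded_measurable (fun x => f x * g x).
Proof.
move=> [mf [M fM]] [mg [N gN]]; split; first exact: measurable_funM.
by exists (M * N) => x; rewrite normrM ler_pM.
Qed.

Lemma bounded_measurableZ c f : bounded_measurable f ->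
  bounded_measurable (fun x => c * f x).
Proof. by apply: bounded_measurableM; exact: bounded_measurable_cst. Qed.

Lemma bounded_measurableN f : bounded_measurable f ->
  bounded_measurable (fun x => - f x).
Proof.
move=> [mf [M fM]]; split; first exact: measurableT_comp.
by exists M => x; rewrite normrN.
Qed.

Lemma bounded_measurableB f g : bounded_measurable f -> bounded_measurable g ->
  bounded_measurable (fun x => f x - g x).
Proof.
by move=> bf bg; apply: bounded_measurableD => //; exact: bounded_measurableN.
Qed.

Lemma bounded_measurable_norm f : bounded_measurable f ->
  bounded_measurable (fun x => `|f x|).
Proof.
move=> [mf [M fM]]; split; first exact: measurableT_comp.
by exists M => x; rewrite normr_id.
Qed.

Lemma bounded_measurable_sum n (F : 'I_n -> T -> R) :
  (forall i, bounded_measurable (F i)) ->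
  bounded_measurable (fun x => \sum_(i < n) F i x).
Proof.
elim: n F => [F _|n IH F bF].
  rewrite (_ : (fun x => _) = fun=> 0); first exact: bounded_measurable_cst.
  by apply/funext => t; rewrite big_ord0.
rewrite (_ : (fun x => _) =
  (fun x => F ord0 x + \sum_(i < n) F (lift ord0 i) x)).
  by apply: bounded_measurableD => //; exact: IH.
by apply/funext => t; rewrite big_ord_recl.
Qed.

Variable mu : probability T R.

Lemma bounded_measurable_integrable f : bounded_measurable f ->
  mu.-integrable setT (EFin \o f).
Proof.
move=> [mf [M fM]]; apply: measurable_bounded_integrable => //.
  by apply: (@le_lt_trans _ _ 1%E); [exact: probability_le1|rewrite ltry].
exists M; split; first exact: num_real.
by move=> x Mx y _; rewrite /= (le_trans (fM y))// ltW.
Qed.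

Lemma Rintegral_probability_cst c : \int[mu]_x c = c.
Proof. by rewrite Rintegral_cst// [X in fine X](_ : _ = 1%E) ?mulr1//; exact: probability_setT. Qed.

Lemma bounded_measurable_le_Rintegral f g :
  bounded_measurable f -> bounded_measurable g -> (forall x, f x <= g x) ->
  \int[mu]_x f x <= \int[mu]_x g x.
Proof.
by move=> bf bg fg; apply: le_Rintegral => //;
  exact: bounded_measurable_integrable.
Qed.

Lemma bounded_measurable_norm_Rintegral f : bounded_measurable f ->
  `|\int[mu]_x f x| <= \int[mu]_x `|f x|.
Proof.
by move=> bf; apply: le_normr_Rintegral => //;
  exact: bounded_measurable_integrable.
Qed.

Lemma Rintegral_norm_le f M : bounded_measurable f ->
  (forall x, `|f x| <= M) -> `|\int[mu]_x f x| <= M.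
Proof.
move=> bf fM; rewrite (le_trans (bounded_measurable_norm_Rintegral bf))//.
rewrite -[leRHS]Rintegral_probability_cst; apply: bounded_measurable_le_Rintegral => //.
  exact: bounded_measurable_norm.
exact: bounded_measurable_cst.
Qed.

Lemma bounded_measurable_RintegralD f g :
  bounded_measurable f -> bounded_measurable g ->
  \int[mu]_x (f x + g x) = \int[mu]_x f x + \int[mu]_x g x.
Proof.
by move=> bf bg; apply: RintegralD => //; exact: bounded_measurable_integrable.
Qed.

Lemma bounded_measurable_RintegralB f g :
  bounded_measurable f -> bounded_measurable g ->
  \int[mu]_x (f x - g x) = \int[mu]_x f x - \int[mu]_x g x.
Proof.
by move=> bf bg; apply: RintegralB => //; exact: bounded_measurable_integrable.
Qed.

Lemma bounded_measurable_RintegralZ c f : bounded_measurable f ->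
  \int[mu]_x (c * f x) = c * \int[mu]_x f x.
Proof.
by move=> bf; apply: RintegralZl => //; exact: bounded_measurable_integrable.
Qed.

Lemma bounded_measurable_Rintegral_sum n (F : 'I_n -> T -> R) :
  (forall i, bounded_measurable (F i)) ->
  \int[mu]_x (\sum_(i < n) F i x) = \sum_(i < n) \int[mu]_x F i x.
Proof.
elim: n F => [F _|n IH F bF].
  rewrite big_ord0; under eq_Rintegral do rewrite big_ord0.
  by rewrite Rintegral_probability_cst.
rewrite big_ord_recl -IH// -bounded_measurable_RintegralD//.
  by apply: eq_Rintegral => x _; rewrite big_ord_recl.
exact: bounded_measurable_sum.
Qed.

End BoundedMeasurable.

(** * Kernels continuous uniformly in the integration variable *)

Section UniformlyContinuousKernel.
Context {R : realType} {T : Type} {V : topologicalType}.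
Implicit Types K L : V -> T -> R.

(** Continuity at [x] uniform in [w], together with a bound at [x], which products require. It plays
    the part of dominated convergence: an integral against a probability measure inherits the
    modulus of continuity. *)
Definition unif_cont_at (x : V) K :=
  (exists M, forall w, `|K x w| <= M) /\
  forall e, 0 < e -> \forall y \near x, forall w, `|K y w - K x w| <= e.

Lemma unif_cont_at_cst x (f : T -> R) :
  (exists M, forall w, `|f w| <= M) -> unif_cont_at x (fun=> f).
Proof.
by move=> fM; split => // e e0; near=> y => w; rewrite subrr normr0 ltW.
Unshelve. all: by end_near. Qed.

Lemma unif_cont_at_fun x (f : V -> R) :
  {for x, continuous f} -> unif_cont_at x (fun y _ => f y).
Proof.
move=> fx; split; first by exists `|f x|.
move=> e e0; have /cvgrPdist_le/(_ _ e0) := fx.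
by apply: filterS => y h w; rewrite distrC.
Qed.

Lemma unif_cont_atD x K L : unif_cont_at x K -> unif_cont_at x L ->
  unif_cont_at x (fun y w => K y w + L y w).
Proof.
move=> [[M KM] cK] [[N LN] cL]; split.
  by exists (M + N) => w; rewrite (le_trans (ler_normD _ _))// lerD.
move=> e e0; have e20 : 0 < e / 2 by rewrite divr_gt0.
near=> y => w; rewrite opprD addrACA (splitr e) (le_trans (ler_normD _ _))//.
by rewrite lerD//; move: w; near: y; [exact: cK|exact: cL].
Unshelve. all: by end_near. Qed.

Lemma unif_cont_atM x K L : unif_cont_at x K -> unif_cont_at x L ->
  unif_cont_at x (fun y w => K y w * L y w).
Proof.
move=> [[M KM] cK] [[N LN] cL]; split.
  by exists (M * N) => w; rewrite normrM ler_pM.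
move=> e e0.
(* [A] bounds |L x w| and, once |K y w - K x w| <= 1, also |K y w|; the tolerance e / (2 A) then
   leaves e / 2 for each half of the telescoped product. *)
pose A := `|M| + `|N| + 1.
have A0 : 0 < A by rewrite ltr_wpDl// addr_ge0.
have eA0 : 0 < Num.min 1 (e / (2 * A)) by rewrite lt_min ltr01 divr_gt0// mulr_gt0.
near=> y.
have hK w : `|K y w - K x w| <= Num.min 1 (e / (2 * A)).
  by move: w; near: y; exact: cK.
have hL w : `|L y w - L x w| <= Num.min 1 (e / (2 * A)).
  by move: w; near: y; exact: cL.
move=> w.
have E : K y w * L y w - K x w * L x w =
  (K y w - K x w) * L x w + (K x w + (K y w - K x w)) * (L y w - L x w) by ring.
rewrite E (le_trans (ler_normD _ _))// !normrM.
move: (hK w) (hL w); rewrite !le_min => /andP[K1 Ke] /andP[L1 Le].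
have a1 : `|L x w| <= A.
  rewrite (le_trans (LN w))// (le_trans (ler_norm _))// /A -addrA addrCA lerDl addr_ge0//.
have a2 : `|K x w + (K y w - K x w)| <= A.
  rewrite (le_trans (ler_normD _ _))// /A -addrA lerD//.
    by rewrite (le_trans (KM w))// ler_norm.
  by rewrite (le_trans K1)// lerDr.
have -> : e = e / (2 * A) * A + A * (e / (2 * A)) by field; rewrite gt_eqF.
by rewrite lerD// ler_pM.
Unshelve. all: by end_near. Qed.

Lemma unif_cont_atZ x c K : unif_cont_at x K ->
  unif_cont_at x (fun y w => c * K y w).
Proof.
by apply: unif_cont_atM; apply: unif_cont_at_cst; exists `|c|.
Qed.

Lemma unif_cont_atN x K : unif_cont_at x K -> unif_cont_at x (fun y w => - K y w).
Proof.
move=> /(unif_cont_atZ (- 1)); congr unif_cont_at.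
by apply/funext => y; apply/funext => w; rewrite mulN1r.
Qed.

Lemma unif_cont_atV x K (c : R) : 0 < c -> (forall w, c <= K x w) ->
  unif_cont_at x K -> unif_cont_at x (fun y w => (K y w)^-1).
Proof.
move=> c0 cK [_ KC].
have Kp w : 0 < K x w by rewrite (lt_le_trans c0).
split; first by exists c^-1 => w; rewrite normfV gtr0_norm// lef_pV2 ?posrE.
move=> e e0.
(* Being within c / 2 keeps [K y w] above c / 2; the second bound then absorbs the denominator
   [K y w * K x w], which is at least c^2 / 2. *)
have d0 : 0 < Num.min (c / 2) (e * (c * c / 2)).
  by rewrite lt_min divr_gt0// mulr_gt0// divr_gt0// mulr_gt0.
near=> y => w.
have : `|K y w - K x w| <= Num.min (c / 2) (e * (c * c / 2)).
  by move: w; near: y; exact: KC.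
rewrite le_min => /andP[h1 h2].
have Ky : c / 2 <= K y w.
  by move: h1 (cK w); rewrite ler_norml => /andP[+ _]; lra.
have Ky0 : 0 < K y w by rewrite (lt_le_trans _ Ky)// divr_gt0.
have -> : (K y w)^-1 - (K x w)^-1 = - (K y w - K x w) / (K y w * K x w).
  by field; rewrite !gt_eqF.
rewrite normrM normrN normfV (gtr0_norm (mulr_gt0 _ _))// ler_pdivrMr ?mulr_gt0//.
rewrite (le_trans h2)// ler_wpM2l ?(ltW e0)//.
have -> : c * c / 2 = c / 2 * c by ring.
by rewrite ler_pM// ltW// divr_gt0.
Unshelve. all: by end_near. Qed.

Lemma unif_cont_at_sum x n (F : 'I_n -> V -> T -> R) :
  (forall i, unif_cont_at x (F i)) ->
  unif_cont_at x (fun y w => \sum_(i < n) F i y w).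
Proof.
elim: n F => [F _|n IH F bF].
  rewrite (_ : (fun x => _) = fun=> (fun=> 0)).
    by apply: unif_cont_at_cst; exists 0 => w; rewrite normr0.
  by apply/funext => t; apply/funext => w; rewrite big_ord0.
rewrite (_ : (fun x => _) =
  (fun y w => F ord0 y w + \sum_(i < n) F (lift ord0 i) y w)).
  by apply: unif_cont_atD => //; exact: IH.
by apply/funext => t; apply/funext => w; rewrite big_ord_recl.
Qed.

End UniformlyContinuousKernel.

(** * Continuity and differentiation under the integral sign *)

Section ParametricIntegral.
Context d {T : measurableType d} {R : realType} (mu : probability T R).

Lemma continuous_Rintegral_param (V : topologicalType) (K : V -> T -> R) x :
  unif_cont_at x K -> (\forall y \near x, bounded_measurable (K y)) ->
  {for x, continuous (fun y => \int[mu]_w K y w)}.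
Proof.
move=> [_ KC] Kb; apply/cvgrPdist_le => e e0; near=> y.
have bx : bounded_measurable (K x) by exact: nbhs_singleton Kb.
have by_ : bounded_measurable (K y) by near: y.
rewrite -bounded_measurable_RintegralB//; apply: Rintegral_norm_le.
  exact: bounded_measurableB.
by move=> w; rewrite distrC; move: w; near: y; exact: KC.
Unshelve. all: by end_near. Qed.

Lemma mvt_around0 (f df : R -> R) (h : R) :
  (forall s : R, `|s| <= `|h| -> is_derive s 1 f (df s)) ->
  exists2 s : R, `|s| <= `|h| & f h - f 0 = df s * h.
Proof.
move=> fd; have [h0|h0] := leP 0 h.
  have [||s sh E] := @MVT_segment R f df 0 h h0.
  - move=> s; rewrite in_itv/= => /andP[s0 sh].
    by apply: fd; rewrite !ger0_norm// ltW.
  - apply: derivable_within_continuous => s; rewrite in_itv/= => /andP[s0 sh].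
    by have [] : is_derive s 1 f (df s) by apply: fd; rewrite !ger0_norm.
  - exists s; last by rewrite E subr0.
    by move: sh; rewrite in_itv/= => /andP[s0 sh]; rewrite !ger0_norm.
have [||s sh E] := @MVT_segment R f df h 0 (ltW h0).
- move=> s; rewrite in_itv/= => /andP[s0 sh].
  by apply: fd; rewrite !ltr0_norm// lerN2 ltW.
- apply: derivable_within_continuous => s; rewrite in_itv/= => /andP[s0 sh].
  by have [] : is_derive s 1 f (df s)
    by apply: fd; rewrite (ler0_norm sh) ltr0_norm// lerN2.
- exists s; last by rewrite -opprB E sub0r mulrN opprK.
  by move: sh; rewrite in_itv/= => /andP[s0 sh]; rewrite (ler0_norm sh) ltr0_norm// lerN2.
Qed.

Lemma near_line (V : normedModType R) (x v : V) (P : set V) :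
  (\forall y \near x, P y) -> \forall s \near (0 : R), P (x + s *: v).
Proof.
move=> Px.
have : (fun s : R => x + s *: v) @ (0 : R) --> x + (0 : R) *: v.
  by apply: cvgD; [exact: cvg_cst|apply: cvgZ; [exact: cvg_id|exact: cvg_cst]].
by rewrite scale0r addr0; exact.
Qed.

Lemma is_derive_lim (V : normedModType R) (f : V -> R) (x v : V) (c : R) :
  (fun h : R => h^-1 * (f (x + h *: v) - f x)) @ 0^' --> c -> is_derive x v f c.
Proof.
move=> L.
have E : (fun h : R => h^-1 *: ((f \o shift x) (h *: v) - f x)) =
    (fun h : R => h^-1 * (f (x + h *: v) - f x)).
  by apply/funext => h /=; rewrite [h *: v + x]addrC.
by apply: DeriveDef; [apply/cvg_ex; exists c|apply: cvg_lim => //]; rewrite E.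
Qed.

(** For each [w] the mean value theorem turns the difference quotient of [K] into a value of [K1] at
    a point of the segment. That value is close to [K1 x w] uniformly in [w], although the
    intermediate point depends on [w]. *)
Lemma is_derive_Rintegral_param (V : normedModType R) (K K1 : V -> T -> R) x v :
  (\forall y \near x, forall w, is_derive y v (K^~ w) (K1 y w)) ->
  unif_cont_at x K1 ->
  (\forall y \near x, bounded_measurable (K y)) -> bounded_measurable (K1 x) ->
  is_derive x v (fun y => \int[mu]_w K y w) (\int[mu]_w K1 x w).
Proof.
move=> Kd [_ KC] Kb K1b; apply: is_derive_lim; apply/cvgrPdist_le => e e0.
have bx : bounded_measurable (K x) by exact: nbhs_singleton Kb.
have /(near_line v) := Kd; have /(near_line v) := Kb; have /(near_line v) := KC _ e0.
move=> /nbhs_ballP[r1 /= r10 h1] /nbhs_ballP[r2 /= r20 h2] /nbhs_ballP[r3 /= r30 h3].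
rewrite near_withinE; apply/nbhs_ballP; exists (Num.min r1 (Num.min r2 r3)).
  by rewrite /= !lt_min r10 r20.
move=> h; rewrite /ball/= sub0r normrN !lt_min => /and3P[hr1 hr2 hr3] hn0.
have bh : bounded_measurable (K (x + h *: v)).
  by apply: h2; rewrite /ball/= sub0r normrN.
rewrite -bounded_measurable_RintegralB// -bounded_measurable_RintegralZ; last first.
  exact: bounded_measurableB.
rewrite -bounded_measurable_RintegralB//; last first.
  by apply: bounded_measurableZ; exact: bounded_measurableB.
apply: Rintegral_norm_le.
  by apply: bounded_measurableB => //; apply: bounded_measurableZ; exact: bounded_measurableB.
move=> w.
have [|s sh] := @mvt_around0 (fun s => K (x + s *: v) w) (fun s => K1 (x + s *: v) w) h.
  move=> s sh; apply: (@is_derive_along R V (K^~ w)); apply: h3.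
  by rewrite /ball/= sub0r normrN (le_lt_trans sh).
rewrite scale0r addr0 => ->; rewrite mulrC mulfK// distrC.
by apply: h1; rewrite /ball/= sub0r normrN (le_lt_trans sh).
Qed.

End ParametricIntegral.

(** * The Poisson kernel and its integrals *)

Section DerivativeRules.
Context {R : realType} {V : normedModType R}.
Implicit Types (f g : V -> R) (x v : V).

Lemma is_derive_of_line f x v d :
  is_derive (0 : R) 1 (fun t => f (x + t *: v)) d -> is_derive x v f d.
Proof.
apply: is_derive_line_eq => h.
by rewrite addr0 /GRing.scale/= mulr1 addrC.
Qed.

Lemma is_derive_inv f x v d : f x != 0 -> is_derive x v f d ->
  is_derive x v (fun y => (f y)^-1) (- d * (f x)^-1 ^+ 2).
Proof.
move=> fx0 fd; apply: is_derive_of_line.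
have h : is_derive (0 : R) 1 (fun t => f (x + t *: v)) d.
  by apply: is_derive_along; rewrite scale0r addr0.
have h0 : f (x + (0 : R) *: v) != 0 by rewrite scale0r addr0.
apply: (is_derive_eq (@is_deriveV _ (fun t => f (x + t *: v)) _ _ _ h0 h)).
by rewrite scale0r addr0 /GRing.scale/= -exprVn mulNr mulrC mulNr.
Qed.

Lemma is_derive_mul f g x v df dg : is_derive x v f df -> is_derive x v g dg ->
  is_derive x v (fun y => f y * g y) (f x * dg + df * g x).
Proof.
move=> fd gd; apply: (is_derive_eq (is_deriveM fd gd)).
by rewrite /GRing.scale/= [g x * _]mulrC.
Qed.

Lemma is_derive_add f g x v df dg : is_derive x v f df -> is_derive x v g dg ->
  is_derive x v (fun y => f y + g y) (df + dg).
Proof. exact: is_deriveD. Qed.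

Lemma is_derive_sub f g x v df dg : is_derive x v f df -> is_derive x v g dg ->
  is_derive x v (fun y => f y - g y) (df - dg).
Proof. exact: is_deriveB. Qed.

Lemma is_derive_const (c : R) x v : is_derive x v (fun=> c) 0.
Proof. exact: is_derive_cst. Qed.

Lemma is_derive_cmul c f x v df : is_derive x v f df ->
  is_derive x v (fun y => c * f y) (c * df).
Proof.
move=> fd; apply: (is_derive_eq (is_derive_mul (is_derive_const c x v) fd)).
by rewrite mul0r addr0.
Qed.

Lemma is_derive_pow n f x v df : is_derive x v f df ->
  is_derive x v (fun y => f y ^+ n.+1) (n.+1%:R * f x ^+ n * df).
Proof.
move=> fd; elim: n => [|n IH].
  by rewrite expr0 !mul1r.
under eq_fun do rewrite exprS.
apply: (is_derive_eq (is_derive_mul fd IH)).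
by rewrite -[n.+2%:R]natr1 !exprS; ring.
Qed.

End DerivativeRules.

(** The squared distance |y - z|^2 for z on the unit sphere, with |z|^2 already replaced by 1, so
    that it is affine in z. *)
Definition sqdist (R : realType) n (y z : 'rV[R]_n) : R :=
  1 + dotv y y - 2 * dotv y z.

(** The exponent 2 is half the dimension: this is the Poisson kernel of the unit ball when n = 4. *)
Definition poisson (R : realType) n (y z : 'rV[R]_n) : R :=
  (1 - dotv y y) * (sqdist y z)^-1 ^+ 2.

(** The derivative of [poisson] in [y] along [v]; [poisson2] is the derivative of this along [w].
    From these closed forms boundedness, measurability and uniform continuity follow by structure
    alone. *)
Definition poisson1 (R : realType) n (v y z : 'rV[R]_n) : R :=
  - 2 * dotv y v * (sqdist y z)^-1 ^+ 2
  - 4 * (1 - dotv y y) * (dotv y v - dotv v z) * (sqdist y z)^-1 ^+ 3.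

Definition poisson2 (R : realType) n (v w y z : 'rV[R]_n) : R :=
  - 2 * dotv v w * (sqdist y z)^-1 ^+ 2
  + 8 * dotv y v * (dotv y w - dotv w z) * (sqdist y z)^-1 ^+ 3
  + 8 * dotv y w * (dotv y v - dotv v z) * (sqdist y z)^-1 ^+ 3
  - 4 * (1 - dotv y y) * dotv v w * (sqdist y z)^-1 ^+ 3
  + 24 * (1 - dotv y y) * (dotv y v - dotv v z) * (dotv y w - dotv w z)
    * (sqdist y z)^-1 ^+ 4.

Section PoissonKernel.
Context {R : realType} {n : nat}.
Implicit Types y z v w : 'rV[R]_n.

Lemma sqdist_ge y z : dotv z z = 1 -> (1 - enorm y) ^+ 2 <= sqdist y z.
Proof.
move=> z1; have := dotv_le y z.
rewrite [enorm z]enormE z1 sqrtr1 mulr1 /sqdist -enorm_sqr; nra.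
Qed.

Lemma sqdist_gt0 y z : dotv z z = 1 -> unit_ball R n y -> 0 < sqdist y z.
Proof.
move=> z1 y1; apply: lt_le_trans (sqdist_ge y z1).
by rewrite exprn_gt0// subr_gt0.
Qed.

Lemma sqdistE y z : dotv z z = 1 -> sqdist y z = dotv (y - z) (y - z).
Proof.
by move=> z1; rewrite !(dotvDl, dotvDr, dotvNl, dotvNr) (dotvC z y) z1 /sqdist; ring.
Qed.

Lemma poisson_gt0 y z : dotv z z = 1 -> unit_ball R n y -> 0 < poisson y z.
Proof.
move=> z1 y1; rewrite mulr_gt0 ?subr_gt0//; first exact/unit_ballE.
by rewrite exprn_gt0// invr_gt0 sqdist_gt0.
Qed.

Lemma is_derive_sqdist_inv y z v : sqdist y z != 0 ->
  is_derive y v (fun y => (sqdist y z)^-1)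
    (- (2 * (dotv y v - dotv v z)) * (sqdist y z)^-1 ^+ 2).
Proof.
move=> D0; apply: is_derive_inv => //.
have h := is_derive_sub (is_derive_add (is_derive_const 1 y v)
  (is_derive_dotvv y v)) (is_derive_cmul 2 (is_derive_dotv z y v)).
by apply: (is_derive_eq h); ring.
Qed.

Lemma is_derive_poisson y z v : sqdist y z != 0 ->
  is_derive y v (fun y => poisson y z) (poisson1 v y z).
Proof.
move=> D0; have hI := is_derive_sqdist_inv v D0.
have hN := is_derive_sub (is_derive_const 1 y v) (is_derive_dotvv y v).
apply: (is_derive_eq (is_derive_mul hN (is_derive_pow 1 hI))).
by rewrite /poisson1; ring.
Qed.

Lemma is_derive_poisson1 y z v w : sqdist y z != 0 ->
  is_derive y w (fun y => poisson1 v y z) (poisson2 v w y z).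
Proof.
move=> D0; have hI := is_derive_sqdist_inv w D0.
have hN := is_derive_sub (is_derive_const 1 y w) (is_derive_dotvv y w).
have hv := is_derive_dotv v y w.
have hvz := is_derive_sub hv (is_derive_const (dotv v z) y w).
have h1 := is_derive_mul (is_derive_cmul (- 2) hv) (is_derive_pow 1 hI).
have h2 := is_derive_mul (is_derive_mul (is_derive_cmul 4 hN) hvz) (is_derive_pow 2 hI).
apply: (is_derive_eq (is_derive_sub h1 h2)).
by rewrite /poisson2 (dotvC w v); ring.
Qed.

End PoissonKernel.

Lemma laplacian_poisson (R : realType) (y z : 'rV[R]_4) : dotv z z = 1 ->
  unit_ball R 4 y ->
  \sum_(i < 4) poisson2 (delta_mx 0 i) (delta_mx 0 i) y z = 0.
Proof.
move=> z1 y1; have D0 : sqdist y z != 0 by rewrite gt_eqF// sqdist_gt0.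
have dd i : dotv (delta_mx 0 i) (delta_mx 0 i) = 1 :> R.
  by rewrite dotv_delta mxE !eqxx.
rewrite /poisson2.
set I := (sqdist y z)^-1; set N := dotv y y.
have S (a b c e : R) : \sum_(i < 4)
    (a + b * (y 0 i * y 0 i) + c * (y 0 i * z 0 i) + e * (z 0 i * z 0 i))
    = 4 * a + b * N + c * dotv y z + e.
  rewrite !big_split/= -!mulr_sumr -/(dotv y y) -/(dotv y z) -/(dotv z z) z1.
  by rewrite sumr_const card_ord mulr1 mulr_natl.
rewrite (eq_bigr (fun i : 'I_4 => (- 2 * I ^+ 2 - 4 * (1 - N) * I ^+ 3)
  + (16 * I ^+ 3 + 24 * (1 - N) * I ^+ 4) * (y 0 i * y 0 i)
  + (- 16 * I ^+ 3 - 48 * (1 - N) * I ^+ 4) * (y 0 i * z 0 i)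
  + (24 * (1 - N) * I ^+ 4) * (z 0 i * z 0 i))); last first.
  by move=> i _; rewrite dd !dotv_delta (dotvC _ z) !dotv_delta; ring.
rewrite S; have : I * (1 + N - 2 * dotv y z) = 1 by rewrite mulVf.
set t := dotv y z => ID.
(* Every term carries the factor I |y - z|^2 - 1 = 0. The dimension enters through the sum of four
   equal diagonal terms. *)
transitivity (8 * I ^+ 2 * (I * (1 + N - 2 * t) - 1)
  + 24 * (1 - N) * I ^+ 3 * (I * (1 + N - 2 * t) - 1)); first by ring.
by rewrite ID subrr !mulr0 addr0.
Qed.

Lemma near_unit_ball (R : realType) n (x : 'rV[R]_n) : unit_ball R n x ->
  \forall y \near x, unit_ball R n y.
Proof.
move=> /unit_ballE x1; have := @continuous_dotvv R n x.
by move=> /cvgr_lt/(_ _ x1); apply: filterS => y y1; apply/unit_ballE.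
Qed.

Lemma continuous_near_eq (R : realType) (T : topologicalType) (f h : T -> R) x :
  (\forall y \near x, f y = h y) -> {for x, continuous f} -> {for x, continuous h}.
Proof.
move=> fh fx; rewrite /prop_for/= /continuous_at -(nbhs_singleton fh).
exact: (cvg_trans (near_eq_cvg fh) fx).
Qed.

Lemma unif_cont_atX (R : realType) (T : Type) (V : topologicalType) (x : V)
    (K : V -> T -> R) n :
  unif_cont_at x K -> unif_cont_at x (fun y w => K y w ^+ n).
Proof.
move=> h; elim: n => [|n IH].
  by apply: unif_cont_at_cst; exists 1 => w; rewrite expr0 normr1.
rewrite (_ : (fun y => _) = fun y w => K y w * K y w ^+ n).
  exact: unif_cont_atM.
by apply/funext => y; apply/funext => w; rewrite exprS.
Qed.

Lemma bounded_measurableX d (T : measurableType d) (R : realType) (f : T -> R) n :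
  bounded_measurable f -> bounded_measurable (fun x => f x ^+ n).
Proof.
move=> h; elim: n => [|n IH].
  by under eq_fun do rewrite expr0; exact: bounded_measurable_cst.
by under eq_fun do rewrite exprS; exact: bounded_measurableM.
Qed.

Section PoissonIntegral.
Context d {T : measurableType d} {R : realType} (mu : probability T R).
Variable zeta : T -> 'rV[R]_4.
Hypothesis zeta1 : forall w, dotv (zeta w) (zeta w) = 1.
Hypothesis mzeta : forall i, measurable_fun setT (fun w => zeta w 0 i).

Lemma bounded_measurable_coord i : bounded_measurable (fun w => zeta w 0 i).
Proof.
split; first exact: mzeta.
by exists 1 => w; rewrite (le_trans (coord_le_enorm _ _))// enormE zeta1 sqrtr1.
Qed.

Lemma bounded_measurable_dotv v : bounded_measurable (fun w => dotv v (zeta w)).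
Proof.
apply: bounded_measurable_sum => i; apply: bounded_measurableZ.
exact: bounded_measurable_coord.
Qed.

Lemma unif_cont_at_dotv x : unif_cont_at x (fun y w => dotv y (zeta w)).
Proof.
apply: unif_cont_at_sum => i; apply: unif_cont_atM.
  by apply: unif_cont_at_fun; exact: coord_continuous.
by apply: unif_cont_at_cst; have [_] := bounded_measurable_coord i.
Qed.

Lemma unif_cont_at_dotv_cst (V : topologicalType) v (x : V) :
  unif_cont_at x (fun _ w => dotv v (zeta w)).
Proof. by apply: unif_cont_at_cst; have [] := bounded_measurable_dotv v. Qed.

Lemma bounded_measurable_sqdist_inv y : unit_ball R 4 y ->
  bounded_measurable (fun w => (sqdist y (zeta w))^-1).
Proof.
move=> y1; split; last first.
  exists ((1 - enorm y) ^+ 2)^-1 => w.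
  rewrite normfV gtr0_norm ?sqdist_gt0// lef_pV2 ?posrE ?sqdist_gt0//.
    exact: sqdist_ge.
  by rewrite exprn_gt0// subr_gt0.
have [mD _] : bounded_measurable (fun w => sqdist y (zeta w)).
  apply: bounded_measurableB; first exact: bounded_measurable_cst.
  by apply: bounded_measurableZ; exact: bounded_measurable_dotv.
rewrite (_ : (fun w => _) = (fun w => powR (sqdist y (zeta w)) (-1))).
  exact: (measurableT_comp (measurable_powR (-1)) mD).
by apply/funext => w; rewrite powR_inv1// ltW// sqdist_gt0.
Qed.

Lemma unif_cont_at_sqdist_inv x : unit_ball R 4 x ->
  unif_cont_at x (fun y w => (sqdist y (zeta w))^-1).
Proof.
move=> x1; apply: (@unif_cont_atV _ _ _ _ _ ((1 - enorm x) ^+ 2)).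
- by rewrite exprn_gt0// subr_gt0.
- by move=> w; exact: sqdist_ge.
apply: unif_cont_atD; last first.
  by apply: unif_cont_atN; apply: unif_cont_atZ; exact: unif_cont_at_dotv.
apply: unif_cont_atD; apply: unif_cont_at_fun; first exact: cst_continuous.
exact: continuous_dotvv.
Qed.

Ltac bounded_meas := repeat first
  [ exact: bounded_measurable_dotv | exact: bounded_measurable_sqdist_inv
  | exact: bounded_measurable_cst
  | apply: bounded_measurableD | apply: bounded_measurableN
  | apply: bounded_measurableX | apply: bounded_measurableM ].

Ltac unif_cont := repeat first
  [ exact: unif_cont_at_dotv_cst
  | exact: unif_cont_at_dotv | exact: unif_cont_at_sqdist_inv
  | (apply: unif_cont_at_fun; first [ exact: cst_continuous
      | exact: continuous_dotvv | exact: continuous_dotv])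
  | apply: unif_cont_atD | apply: unif_cont_atN
  | apply: unif_cont_atX | apply: unif_cont_atM ].

Lemma bounded_measurable_poisson y : unit_ball R 4 y ->
  bounded_measurable (fun w => poisson y (zeta w)).
Proof. by move=> y1; rewrite /poisson; bounded_meas. Qed.

Lemma bounded_measurable_poisson1 v y : unit_ball R 4 y ->
  bounded_measurable (fun w => poisson1 v y (zeta w)).
Proof. by move=> y1; rewrite /poisson1; bounded_meas. Qed.

Lemma bounded_measurable_poisson2 v v' y : unit_ball R 4 y ->
  bounded_measurable (fun w => poisson2 v v' y (zeta w)).
Proof. by move=> y1; rewrite /poisson2; bounded_meas. Qed.

Lemma unif_cont_at_poisson x : unit_ball R 4 x ->
  unif_cont_at x (fun y w => poisson y (zeta w)).
Proof. by move=> x1; rewrite /poisson; unif_cont. Qed.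

Lemma unif_cont_at_poisson1 v x : unit_ball R 4 x ->
  unif_cont_at x (fun y w => poisson1 v y (zeta w)).
Proof. by move=> x1; rewrite /poisson1; unif_cont. Qed.

Lemma unif_cont_at_poisson2 v v' x : unit_ball R 4 x ->
  unif_cont_at x (fun y w => poisson2 v v' y (zeta w)).
Proof. by move=> x1; rewrite /poisson2; unif_cont. Qed.

Variable g : T -> R.
Hypothesis bg : bounded_measurable g.

(** The sphere enters through a measurable map [zeta] from a probability space, the density of the
    surface measure being absorbed in [g]. The same results thus apply when [zeta] is composed with
    an isometry. *)
Definition poisson_int (y : 'rV[R]_4) : R := \int[mu]_w (g w * poisson y (zeta w)).

Let ucg (V : topologicalType) (x : V) : unif_cont_at x (fun=> g).
Proof. by apply: unif_cont_at_cst; have [] := bg. Qed.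

Lemma is_derive_poisson_int v x : unit_ball R 4 x ->
  is_derive x v poisson_int (\int[mu]_w (g w * poisson1 v x (zeta w))).
Proof.
move=> x1; apply: (@is_derive_Rintegral_param _ _ _ _ _ _ (fun y w => g w * poisson1 v y (zeta w))).
- near=> y => w; apply: is_derive_cmul; apply: is_derive_poisson.
  by rewrite gt_eqF// sqdist_gt0//; near: y; exact: near_unit_ball.
- by apply: unif_cont_atM => //; exact: unif_cont_at_poisson1.
- near=> y; apply: bounded_measurableM => //; apply: bounded_measurable_poisson.
  by near: y; exact: near_unit_ball.
- by apply: bounded_measurableM => //; exact: bounded_measurable_poisson1.
Unshelve. all: by end_near. Qed.

Lemma partial_poisson_int i x : unit_ball R 4 x -> partial i poisson_int x =
  \int[mu]_w (g w * poisson1 (delta_mx 0 i) x (zeta w)).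
Proof. by move=> x1; have [_] := is_derive_poisson_int (delta_mx 0 i) x1. Qed.

Lemma is_derive_partial_poisson_int i v x : unit_ball R 4 x ->
  is_derive x v (partial i poisson_int)
    (\int[mu]_w (g w * poisson2 (delta_mx 0 i) v x (zeta w))).
Proof.
move=> x1; apply: (@near_eq_is_derive _ _ _
    (fun x => \int[mu]_w (g w * poisson1 (delta_mx 0 i) x (zeta w)))).
  near=> y; rewrite partial_poisson_int//; near: y; exact: near_unit_ball.
apply: (@is_derive_Rintegral_param _ _ _ _ _ _
  (fun y w => g w * poisson2 (delta_mx 0 i) v y (zeta w))).
- near=> y => w; apply: is_derive_cmul; apply: is_derive_poisson1.
  by rewrite gt_eqF// sqdist_gt0//; near: y; exact: near_unit_ball.
- by apply: unif_cont_atM => //; exact: unif_cont_at_poisson2.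
- near=> y; apply: bounded_measurableM => //; apply: bounded_measurable_poisson1.
  by near: y; exact: near_unit_ball.
- by apply: bounded_measurableM => //; exact: bounded_measurable_poisson2.
Unshelve. all: by end_near. Qed.

Lemma harmonic_poisson_int : harmonic_on (unit_ball R 4) poisson_int.
Proof.
split; last first.
  move=> x x1; rewrite /laplacian.
  transitivity (\sum_(i < 4) \int[mu]_w
      (g w * poisson2 (delta_mx 0 i) (delta_mx 0 i) x (zeta w))).
    by apply: eq_bigr => i _; have [_] := is_derive_partial_poisson_int i (delta_mx 0 i) x1.
  rewrite -bounded_measurable_Rintegral_sum; last first.
    by move=> i; apply: bounded_measurableM => //; exact: bounded_measurable_poisson2.
  under eq_Rintegral do rewrite -mulr_sumr laplacian_poisson// mulr0.
  by rewrite Rintegral_probability_cst.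
move=> x x1; split; [|split].
- apply: continuous_Rintegral_param.
    by apply: unif_cont_atM => //; exact: unif_cont_at_poisson.
  near=> y; apply: bounded_measurableM => //; apply: bounded_measurable_poisson.
  by near: y; exact: near_unit_ball.
- move=> i; split; first by have [] := is_derive_poisson_int (delta_mx 0 i) x1.
  apply: (@continuous_near_eq _ _
    (fun x => \int[mu]_w (g w * poisson1 (delta_mx 0 i) x (zeta w)))).
    near=> y; rewrite partial_poisson_int//; near: y; exact: near_unit_ball.
  apply: continuous_Rintegral_param.
    by apply: unif_cont_atM => //; exact: unif_cont_at_poisson1.
  near=> y; apply: bounded_measurableM => //; apply: bounded_measurable_poisson1.
  by near: y; exact: near_unit_ball.
- move=> i j; split.
    by have [] := is_derive_partial_poisson_int i (delta_mx 0 j) x1.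
  apply: (@continuous_near_eq _ _ (fun x => \int[mu]_w
      (g w * poisson2 (delta_mx 0 i) (delta_mx 0 j) x (zeta w)))).
    near=> y; have y1 : unit_ball R 4 y by near: y; exact: near_unit_ball.
    by have [_ <-] := is_derive_partial_poisson_int i (delta_mx 0 j) y1.
  apply: continuous_Rintegral_param.
    by apply: unif_cont_atM => //; exact: unif_cont_at_poisson2.
  near=> y; apply: bounded_measurableM => //; apply: bounded_measurable_poisson2.
  by near: y; exact: near_unit_ball.
Unshelve. all: by end_near. Qed.

End PoissonIntegral.

(** * Poisson representation of bounded harmonic functions *)

Section EuclideanContinuity.
Context {R : realType} {n : nat}.
Implicit Types x y z : 'rV[R]_n.

Lemma norm_le_enorm x : `|x| <= enorm x.
Proof.
rewrite /Num.norm/= mx_normrE; apply/bigmax_leP; split; first exact: enorm_ge0.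
by move=> [i j] _ /=; rewrite ord1 coord_le_enorm.
Qed.

Lemma compact_uniform_continuity (A : set 'rV[R]_n) (f : 'rV[R]_n -> R) (e : R) :
  compact A -> (forall x, A x -> {for x, continuous f}) -> 0 < e ->
  exists2 d, 0 < d & forall x y, A x -> A y -> `|x - y| < d -> `|f x - f y| < e.
Proof.
move=> /compact_near_coveringP cA fC e0.
have e20 : 0 < e / 2 by rewrite divr_gt0.
have := cA R 0^'+ (fun d x => forall y, A y -> `|x - y| < d -> `|f x - f y| < e).
case=> [x Ax|d /= d0 h].
  have /cvgrPdist_lt/(_ _ e20)/nbhs_ballP[r /= r0 fr] := fC x Ax.
  near=> x' d => y Ay xy.
  have rx : ball x (r / 2) x' by near: x'; apply: nbhsx_ballx; rewrite divr_gt0.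
  have dr : d < r / 2 by near: d; apply: nbhs_right_lt; rewrite divr_gt0.
  have h1 : `|f x - f x'| < e / 2.
    by apply: fr; apply: le_ball rx; rewrite ler_pdivrMr// ler_peMr ?ler1n// ltW.
  have h2 : `|f x - f y| < e / 2.
    apply: fr; rewrite (splitr r); apply: ball_triangle rx _.
    by rewrite -ball_normE/= (lt_trans xy).
  rewrite (splitr e) -(subrKA (f x)) (le_lt_trans (ler_normD _ _))// ltrD//.
  by rewrite distrC.
exists (d / 2); first by rewrite divr_gt0.
move=> x y Ax; apply: h => //=.
  by rewrite sub0r normrN gtr0_norm ?divr_gt0// ltr_pdivrMr// ltr_pMr// ltr1n.
by rewrite divr_gt0.
Unshelve. all: by end_near. Qed.

End EuclideanContinuity.

(** Continuity of [f] is known only at the points of [A], so [f] itself may fail to be measurable.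
    The set where f (zeta w) > a is written as a countable union of preimages of rational boxes. *)
Lemma measurable_continuous_comp d (T : measurableType d) (R : realType) n
    (zeta : T -> 'rV[R]_n) (A : set 'rV[R]_n) (f : 'rV[R]_n -> R) :
  (forall i, measurable_fun setT (fun w => zeta w 0 i)) ->
  (forall w, A (zeta w)) -> (forall x, A x -> {for x, continuous f}) ->
  measurable_fun setT (fun w => f (zeta w)).
Proof.
move=> mz Az fC mT; apply: (measurability _ (RGenOInfty.measurableE R)) => //.
move=> /= _ [_ [a ->] <-]; rewrite setTI preimage_itvoy.
(* A pair is a rational centre and a radius 1 / (p.2 + 1); it is good when [f] exceeds [a] on the
   part of its box lying in [A]. *)
pose good (p : 'rV[rat]_n * nat) := forall z, A z ->
  (forall i, `|z 0 i - ratr (p.1 0 i)| < p.2.+1%:R^-1) -> a < f z.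
pose F p := [set w | good p /\ forall i, `|zeta w 0 i - ratr (p.1 0 i)| < p.2.+1%:R^-1].
rewrite (_ : [set _ | _] = \bigcup_p F p).
  apply: countable_bigcupT_measurable => [|p].
    exact: countableP.
  have [gp|ngp] := pselect (good p); last first.
    by rewrite (_ : F p = set0)//; apply/seteqP; split => w // [].
  rewrite (_ : F p = \bigcap_(i in [set: 'I_n])
      [set w | `|zeta w 0 i - ratr (p.1 0 i)| < p.2.+1%:R^-1]).
    apply: fin_bigcap_measurable => [|i _]; first exact: finite_finset.
    have := @measurable_fun_ltr _ T R setT
      (fun w => `|zeta w 0 i - ratr (p.1 0 i)|) (fun=> p.2.+1%:R^-1).
    move=> /(_ _ (measurable_cst _) measurableT [set true]); rewrite setTI; apply => //.
    apply: measurableT_comp => //; apply: measurable_funB => //.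
  apply/seteqP; split => w; first by move=> [_ h] i _; exact: h.
  by move=> h; split => // i; exact: h.
apply/seteqP; split => w /=; last by move=> [p _ [gp h]]; exact: gp.
move=> afw; have /cvgr_gt/(_ _ afw)/nbhs_ballP[r /= r0 hr] := fC _ (Az w).
have [k kr] : exists k, k.+1%:R^-1 < r / 2.
  have r20 : 0 < r / 2 by rewrite divr_gt0.
  by have [k _ /(_ k (leqnn k))] := near_infty_natSinv_lt (PosNum r20); exists k.
have k0 : 0 < k.+1%:R^-1 :> R by rewrite invr_gt0.
have q i : exists q : rat, `|zeta w 0 i - ratr q| < k.+1%:R^-1.
  have /rat_in_itvoo[q] : zeta w 0 i - k.+1%:R^-1 < zeta w 0 i + k.+1%:R^-1.
    by rewrite ltrBlDr -addrA ltrDl addr_gt0.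
  rewrite in_itv/= => /andP[h1 h2]; exists q.
  by rewrite ltr_distlC h1 h2.
exists (\row_i projT1 (cid (q i)), k) => //; split => [z Az' /= h|i/=]; last first.
  by rewrite mxE; case: cid.
apply: hr; rewrite -ball_normE/=.
rewrite /Num.norm/= mx_normrE; apply: bigmax_lt => // -[i0 i] _ /=.
rewrite ord1 !mxE; have := h i; rewrite mxE; case: cid => q' /= hq hz.
rewrite (splitr r) -(subrKA (ratr q')) (le_lt_trans (ler_normD _ _))//.
by rewrite ltrD// ?(lt_trans hq)// distrC (lt_trans hz).
Qed.

Section Scaling.
Context {R : realType} {n : nat}.
Implicit Types (u : 'rV[R]_n -> R) (y v : 'rV[R]_n).

Lemma is_derive_scale u (c d : R) y v :
  is_derive (c *: y) v u d -> is_derive y v (fun y => u (c *: y)) (c * d).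
Proof.
move=> ud; apply: is_derive_of_line.
have h : is_derive (c * 0 : R) 1 (fun t => u (c *: y + t *: v)) d.
  by apply: is_derive_along; rewrite mulr0 scale0r addr0.
have h2 : is_derive (0 : R) 1 (fun t : R => c * t) c.
  by apply: (is_derive_eq (is_derive_cmul c (is_derive_id _ _))); rewrite mulr1.
have h3 := @is_derive1_comp _ (fun t => u (c *: y + t *: v)) (fun t => c * t) 0 d c.
rewrite mulrC (_ : (fun t => _) = (fun t => u (c *: y + t *: v)) \o (fun t => c * t)).
  exact: h3.
by apply/funext => t /=; rewrite scalerDr scalerA.
Qed.

Lemma continuous_scale u (c : R) y :
  {for c *: y, continuous u} -> {for y, continuous (fun y => u (c *: y))}.
Proof.
move=> uc; have sc : {for y, continuous (fun y : 'rV[R]_n => c *: y)}.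
  exact: scaler_continuous.
exact: (@continuous_comp _ _ _ (fun y : 'rV[R]_n => c *: y) u y sc uc).
Qed.

(** Used with 0 < c < 1, where the set in the conclusion contains the closed unit ball: the dilate
    has boundary values. *)
Lemma harmonic_scale u (c : R) : harmonic_on (unit_ball R n) u ->
  harmonic_on [set y | unit_ball R n (c *: y)] (fun y => u (c *: y)).
Proof.
move=> [uC2 ulap]; pose B := [set y | unit_ball R n (c *: y)].
have nB y : B y -> \forall z \near y, B z.
  move=> By; have := @scaler_continuous R 'rV[R]_n c y.
  by apply; exact: near_unit_ball.
have p1 i y : B y ->
    is_derive y (delta_mx 0 i) (fun y => u (c *: y)) (c * partial i u (c *: y)).
  move=> By; apply: is_derive_scale; have [_ [/(_ i) [h _] _]] := uC2 _ By.
  exact: DeriveDef.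
have p1E i y : B y -> partial i (fun y => u (c *: y)) y = c * partial i u (c *: y).
  by move=> /(p1 i) [].
have p2 i j y : B y -> is_derive y (delta_mx 0 j)
    (partial i (fun y => u (c *: y))) (c * (c * partial j (partial i u) (c *: y))).
  move=> By; apply: (@near_eq_is_derive _ _ _ (fun y => c * partial i u (c *: y))).
    by near=> z; rewrite p1E//; near: z; exact: nB.
  apply: is_derive_cmul; apply: is_derive_scale.
  have [_ [_ /(_ i j) [h _]]] := uC2 _ By; exact: DeriveDef.
have cZ (f : 'rV[R]_n -> R) y : {for y, continuous f} ->
    {for y, continuous (fun y => c * f y)}.
  by move=> fc; apply: continuousM => //; exact: cst_continuous.
split => [y By|y By]; last first.
  rewrite /laplacian; transitivity (\sum_(i < n) c * (c * partial i (partial i u) (c *: y))).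
    by apply: eq_bigr => i _; have [] := p2 i i y By.
  by rewrite -!mulr_sumr -[X in c * (c * X)]/(laplacian u (c *: y)) ulap// !mulr0.
have [uc [u1 u2]] := uC2 _ By; split; first exact: continuous_scale.
split=> [i|i j]; split.
- by have [] := p1 i y By.
- apply: (@continuous_near_eq _ _ (fun y => c * partial i u (c *: y))).
    by near=> z; rewrite p1E//; near: z; exact: nB.
  by apply: cZ; apply: continuous_scale; have [] := u1 i.
- by have [] := p2 i j y By.
- apply: (@continuous_near_eq _ _ (fun y => c * (c * partial j (partial i u) (c *: y)))).
    by near=> z; have Bz : B z by [near: z; exact: nB]; have [_ <-] := p2 i j z Bz.
  by apply: (cZ); apply: cZ; apply: continuous_scale; have [] := u2 i j.
Unshelve. all: by end_near. Qed.

End Scaling.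

Lemma harmonic_onB (R : realType) n (A : set 'rV[R]_n) (f g : 'rV[R]_n -> R) :
  (forall x, A x -> \forall y \near x, A y) ->
  harmonic_on A f -> harmonic_on A g -> harmonic_on A (fun y => f y - g y).
Proof.
move=> nA [f2 fl] [g2 gl].
have p1 i y : A y -> is_derive y (delta_mx 0 i) (fun y => f y - g y)
    (partial i f y - partial i g y).
  move=> Ay; have [_ [/(_ i) [fd _] _]] := f2 _ Ay.
  have [_ [/(_ i) [gd _] _]] := g2 _ Ay.
  by apply: is_derive_sub; exact: DeriveDef.
have p1E i y : A y -> partial i (fun y => f y - g y) y = partial i f y - partial i g y.
  by move=> /(p1 i) [].
have p2 i j y : A y -> is_derive y (delta_mx 0 j) (partial i (fun y => f y - g y))
    (partial j (partial i f) y - partial j (partial i g) y).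
  move=> Ay; apply: (@near_eq_is_derive _ _ _ (fun y => partial i f y - partial i g y)).
    by near=> z; rewrite p1E//; near: z; exact: nA.
  have [_ [_ /(_ i j) [fd _]]] := f2 _ Ay; have [_ [_ /(_ i j) [gd _]]] := g2 _ Ay.
  by apply: is_derive_sub; exact: DeriveDef.
have cB (p q : 'rV[R]_n -> R) y : {for y, continuous p} -> {for y, continuous q} ->
    {for y, continuous (fun y => p y - q y)}.
  by move=> pc qc; exact: (continuousB pc qc).
split => [y Ay|y Ay]; last first.
  rewrite /laplacian; transitivity (\sum_(i < n) (partial i (partial i f) y
      - partial i (partial i g) y)).
    by apply: eq_bigr => i _; have [] := p2 i i y Ay.
  rewrite sumrB -[X in X - _]/(laplacian f y) -[X in _ - X]/(laplacian g y).
  by rewrite fl// gl// subrr.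
have [fc [f1 f12]] := f2 _ Ay; have [gc [g1 g12]] := g2 _ Ay.
split; first exact: cB.
split=> [i|i j]; split.
- by have [] := p1 i y Ay.
- apply: (@continuous_near_eq _ _ (fun y => partial i f y - partial i g y)).
    by near=> z; rewrite p1E//; near: z; exact: nA.
  by apply: cB; [have [] := f1 i|have [] := g1 i].
- by have [] := p2 i j y Ay.
- apply: (@continuous_near_eq _ _
    (fun y => partial j (partial i f) y - partial j (partial i g) y)).
    by near=> z; have Az : A z by [near: z; exact: nA]; have [_ <-] := p2 i j z Az.
  by apply: cB; [have [] := f12 i j|have [] := g12 i j].
Unshelve. all: by end_near. Qed.

Lemma dotv0l (R : realType) n (z : 'rV[R]_n) : dotv 0 z = 0.
Proof. by rewrite -(scale0r z) dotvZl mul0r. Qed.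

Lemma poisson1_sum (R : realType) n (v y z : 'rV[R]_n) :
  \sum_(i < n) v 0 i * poisson1 (delta_mx 0 i) y z = poisson1 v y z.
Proof.
rewrite /poisson1; set I := (sqdist y z)^-1; set N := dotv y y.
transitivity (\sum_(i < n) ((- 2 * I ^+ 2 - 4 * (1 - N) * I ^+ 3) * (y 0 i * v 0 i)
    + 4 * (1 - N) * I ^+ 3 * (v 0 i * z 0 i))).
  by apply: eq_bigr => i _; rewrite dotv_delta (dotvC _ z) dotv_delta; ring.
by rewrite big_split/= -!mulr_sumr -/(dotv y v) -/(dotv v z); ring.
Qed.

Lemma compact_bounded_fun (R : realType) n (A : set 'rV[R]_n) (f : 'rV[R]_n -> R) :
  compact A -> A !=set0 -> (forall x, A x -> {for x, continuous f}) ->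
  exists2 M, 0 < M & forall x, A x -> `|f x| <= M.
Proof.
move=> cA A0 fC.
have fn : {within A, continuous (fun x => `|f x|)}.
  apply: continuous_in_subspaceT => z; rewrite inE => Az.
  have nf : {for f z, continuous (fun t : R => `|t|)} by exact: norm_continuous.
  exact: (@continuous_comp _ _ _ f (fun t : R => `|t|) z (fC z Az) nf).
have [c _ h] := EVT_max_rV A0 cA fn.
exists (`|f c| + 1); first by rewrite ltr_wpDl.
by move=> y Ay; rewrite (le_trans (h y _)) ?inE// lerDl.
Qed.

(** * Poisson integrals near the boundary and the representation formula *)

Section Representation.
Context d {T : measurableType d} {R : realType} (mu : probability T R).
Variable zeta : T -> 'rV[R]_4.
Hypothesis zeta1 : forall w, dotv (zeta w) (zeta w) = 1.
Hypothesis mzeta : forall i, measurable_fun setT (fun w => zeta w 0 i).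
Variable dens : T -> R.
Hypothesis bdens : bounded_measurable dens.
Hypothesis dens_ge0 : forall w, 0 <= dens w.
Hypothesis mass1 : forall y, unit_ball R 4 y ->
  poisson_int mu zeta dens y = 1.

Let bpoisson := bounded_measurable_poisson zeta1 mzeta.
Let bpoisson1 := bounded_measurable_poisson1 zeta1 mzeta.

(** Mass 1 brings [f y] under the integral. Where [zeta w] is close to [y], uniform continuity
    bounds the integrand; elsewhere the kernel is at most (1 - |y|^2) / dl^4, which tends to 0 at
    the boundary. *)
Lemma poisson_int_boundary (f : 'rV[R]_4 -> R) (e : R) :
  (forall x, enorm x <= 1 -> {for x, continuous f}) -> 0 < e ->
  exists t, [/\ 0 <= t, t < 1 & forall y, t <= enorm y -> enorm y < 1 ->
    `|f y - poisson_int mu zeta (fun w => dens w * f (zeta w)) y| <= e].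
Proof.
move=> fC e0.
have z1 w : enorm (zeta w) <= 1 by rewrite enormE zeta1 sqrtr1.
have cK := @closed_ball_compact R 4 1 ler01.
have B0 : [set x : 'rV[R]_4 | enorm x <= 1] !=set0.
  by exists 0 => /=; rewrite enormE dotv0l sqrtr0.
have [M M0 fM] := compact_bounded_fun cK B0 fC.
have e20 : 0 < e / 2 by rewrite divr_gt0.
have [dl dl0 fu] := compact_uniform_continuity cK fC e20.
(* 2 M bounds the oscillation of [f], and dl^-4 bounds the squared inverse of [sqdist] away from
   [y]. *)
pose C := 2 * M / dl ^+ 4.
have C0 : 0 < C by rewrite divr_gt0 ?mulr_gt0// exprn_gt0.
have bgz : bounded_measurable (fun w => f (zeta w)).
  split; first exact: (measurable_continuous_comp mzeta z1 fC).
  by exists M => w; exact: (fM _ (z1 w)).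
(* The kernel is 1 at the origin, so the mass there is the integral of [dens]. *)
have dens1 : \int[mu]_w dens w = 1.
  have u0 : unit_ball R 4 0 by apply/unit_ballE; rewrite dotv0l ltr01.
  rewrite -(mass1 u0); apply: eq_Rintegral => w _.
  by rewrite /poisson /sqdist !dotv0l mulr0 !subr0 addr0 invr1 expr1n !mulr1.
have key y : enorm y < 1 ->
    `|f y - poisson_int mu zeta (fun w => dens w * f (zeta w)) y| <=
    e / 2 + C * (1 - dotv y y).
  move=> y1; have fE : f y = f y * poisson_int mu zeta dens y.
    by rewrite mass1// mulr1.
  rewrite {1}fE /poisson_int.
  have bp := bpoisson y1.
  rewrite -bounded_measurable_RintegralZ; last exact: bounded_measurableM.
  rewrite -bounded_measurable_RintegralB; last 2 first.
  - by apply: bounded_measurableZ; exact: bounded_measurableM.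
  - by apply: bounded_measurableM => //; exact: bounded_measurableM.
  have b1 : bounded_measurable (fun w => f y * (dens w * poisson y (zeta w)) -
       dens w * f (zeta w) * poisson y (zeta w)).
    apply: bounded_measurableB.
      by apply: bounded_measurableZ; exact: bounded_measurableM.
    by apply: bounded_measurableM => //; exact: bounded_measurableM.
  rewrite (le_trans (bounded_measurable_norm_Rintegral _ b1))//.
  have -> : e / 2 + C * (1 - dotv y y) =
      \int[mu]_w (e / 2 * (dens w * poisson y (zeta w)) + C * (1 - dotv y y) * dens w).
    rewrite bounded_measurable_RintegralD; last 2 first.
    - by apply: bounded_measurableZ; exact: bounded_measurableM.
    - exact: bounded_measurableZ.
    rewrite !bounded_measurable_RintegralZ//; last exact: bounded_measurableM.
    by rewrite dens1 -/(poisson_int mu zeta dens y) mass1// !mulr1.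
  apply: bounded_measurable_le_Rintegral; first exact: bounded_measurable_norm.
    apply: bounded_measurableD; last exact: bounded_measurableZ.
    by apply: bounded_measurableZ; exact: bounded_measurableM.
  move=> w.
  have -> : f y * (dens w * poisson y (zeta w)) - dens w * f (zeta w) * poisson y (zeta w) =
    (dens w * poisson y (zeta w)) * (f y - f (zeta w)) by ring.
  have p0 := poisson_gt0 (zeta1 w) y1.
  rewrite normrM ger0_norm; last by rewrite mulr_ge0// ltW.
  have N1 : 0 < 1 - dotv y y by rewrite subr_gt0; exact/unit_ballE.
  have [yd|yd] := ltP `|y - zeta w| dl.
    rewrite -[leLHS]addr0; apply: lerD; last by rewrite mulr_ge0// (mulr_ge0 (ltW C0) (ltW N1)).
    rewrite [leRHS]mulrC ler_wpM2l//; first by rewrite mulr_ge0// ltW.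
    by rewrite ltW// fu//= ltW.
  rewrite -[leLHS]add0r; apply: lerD.
    by rewrite (mulr_ge0 (ltW e20))// mulr_ge0// ltW.
  rewrite [leRHS]mulrC -mulrA ler_wpM2l//.
  have D0 : dl ^+ 2 <= sqdist y (zeta w).
    rewrite sqdistE// -enorm_sqr ler_pXn2r// ?nnegrE ?enorm_ge0 ?(ltW dl0)//.
    exact: le_trans yd (norm_le_enorm _).
  have h1 : poisson y (zeta w) <= (1 - dotv y y) / dl ^+ 4.
    have s0 := sqdist_gt0 (zeta1 w) y1.
    have -> : dl ^+ 4 = (dl ^+ 2) ^+ 2 by rewrite -exprM.
    rewrite /poisson ler_wpM2l ?(ltW N1)// -exprVn.
    rewrite ler_pXn2r ?nnegrE ?invr_ge0 ?sqr_ge0 ?(ltW s0)//.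
    by rewrite lef_pV2 ?posrE ?exprn_gt0.
  have h2 : `|f y - f (zeta w)| <= 2 * M.
    by rewrite (le_trans (ler_normB _ _))// mulr_natl mulr2n lerD// fM//=; exact: ltW.
  rewrite (le_trans (ler_pM _ _ h1 h2))// ?(ltW p0)//.
  by rewrite le_eqVlt; apply/orP; left; apply/eqP; rewrite /C; ring.
(* C (1 - |y|^2) <= e / 2 means |y|^2 >= 1 - e / (2 C); the minimum with 1 keeps the radicand
   nonnegative. *)
exists (Num.sqrt (1 - Num.min 1 (e / (2 * C)))).
have m0 : 0 < Num.min 1 (e / (2 * C)) by rewrite lt_min ltr01 divr_gt0// mulr_gt0.
have m1 : Num.min 1 (e / (2 * C)) <= 1 by rewrite ge_min lexx.
split; first exact: sqrtr_ge0.
  by rewrite -[ltRHS]sqrtr1 ltr_sqrt// gtrBl.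
move=> y ty y1; rewrite (le_trans (key y y1))// [leRHS]splitr lerD2l.
have : 1 - dotv y y <= e / (2 * C).
  have : 1 - Num.min 1 (e / (2 * C)) <= dotv y y.
    by rewrite -enorm_sqr -[leLHS]sqr_sqrtr ?subr_ge0// ler_pXn2r// nnegrE ?sqrtr_ge0 ?enorm_ge0.
  rewrite lerBlDr -lerBlDl => h; apply: le_trans h _.
  by rewrite ge_min lexx orbT.
have C2 : 0 < 2 * C by rewrite mulr_gt0.
rewrite (ler_pdivlMr _ _ C2) => h; rewrite ler_pdivlMr//.
by apply: le_trans h; rewrite le_eqVlt; apply/orP; left; apply/eqP; ring.
Qed.

(** The difference between [f] and its Poisson integral is harmonic and at most [e] in a layer along
    the boundary; the maximum principle, applied to it and to its opposite, carries the bound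
    inside. *)
Theorem poisson_representation (f : 'rV[R]_4 -> R) (y : 'rV[R]_4) :
  (forall x, enorm x <= 1 -> {for x, continuous f}) ->
  harmonic_on (unit_ball R 4) f -> unit_ball R 4 y ->
  f y = poisson_int mu zeta (fun w => dens w * f (zeta w)) y.
Proof.
move=> fC fh y1.
have z1 w : enorm (zeta w) <= 1 by rewrite enormE zeta1 sqrtr1.
set g := fun w => _.
have bg : bounded_measurable g.
  apply: bounded_measurableM => //; split.
    exact: (measurable_continuous_comp mzeta z1 fC).
  have cK := @closed_ball_compact R 4 1 ler01.
  have [|M _ fM] := compact_bounded_fun cK _ fC; first by exists y; rewrite /= ltW.
  by exists M => w; exact: (fM _ (z1 w)).
have ph := harmonic_poisson_int mu zeta1 mzeta bg.
have nB := @near_unit_ball R 4.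
have h1 := harmonic_onB nB fh ph; have h2 := harmonic_onB nB ph fh.
apply/eqP; rewrite -subr_eq0 -normr_le0; apply/ler_addgt0Pr => e e0; rewrite add0r.
have [t [t0 t1 ht]] := poisson_int_boundary fC e0.
(* The sphere of radius [s] < 1 lies in the boundary layer and encloses [y]. *)
pose s := Num.max t (enorm y).
have s1 : s < 1 by rewrite gt_max t1.
have sB z : enorm z <= s -> unit_ball R 4 z by move=> zs; exact: le_lt_trans s1.
have ys : enorm y <= s by rewrite le_max lexx orbT.
have hs z : enorm z = s -> `|f z - poisson_int mu zeta g z| <= e.
  by move=> zs; apply: ht; rewrite zs// le_max lexx.
rewrite ler_norml; apply/andP; split; last first.
  apply: (@maximum_principle R 4 isT _ _ s e h1) => // z /hs.
  by rewrite ler_norml => /andP[].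
rewrite lerNl opprB.
apply: (@maximum_principle R 4 isT _ _ s e h2) => // z /hs.
by rewrite distrC ler_norml => /andP[].
Qed.

End Representation.

(** * The norm of a directional derivative as a functional on bounded harmonic functions *)

Section GradientMass.
Context d {T : measurableType d} {R : realType} (mu : probability T R).
Variable zeta : T -> 'rV[R]_4.
Hypothesis zeta1 : forall w, dotv (zeta w) (zeta w) = 1.
Hypothesis mzeta : forall i, measurable_fun setT (fun w => zeta w 0 i).
Variable dens : T -> R.
Hypothesis bdens : bounded_measurable dens.
Hypothesis dens_ge0 : forall w, 0 <= dens w.
Hypothesis mass1 : forall y, unit_ball R 4 y -> poisson_int mu zeta dens y = 1.

(** The L^1 norm of the derivative of the Poisson kernel at [x] along [l]. [gradient_dotv_le] and
    [exists_gradient_mass] show that it is the best constant for that directional derivative. *)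
Definition gradient_mass (x l : 'rV[R]_4) : R :=
  \int[mu]_w (dens w * `|poisson1 l x (zeta w)|).

Let bpoisson := bounded_measurable_poisson zeta1 mzeta.
Let bpoisson1 := bounded_measurable_poisson1 zeta1 mzeta.

Lemma dotv_gradient_poisson_int (g : T -> R) x l :
  bounded_measurable g -> unit_ball R 4 x ->
  dotv (gradient (poisson_int mu zeta g) x) l =
  \int[mu]_w (g w * poisson1 l x (zeta w)).
Proof.
move=> bg x1; rewrite /dotv.
transitivity (\sum_(i < 4) \int[mu]_w
    (l 0 i * (g w * poisson1 (delta_mx 0 i) x (zeta w)))).
  apply: eq_bigr => i _; rewrite mxE partial_poisson_int// mulrC.
  by rewrite bounded_measurable_RintegralZ//; exact: bounded_measurableM (bpoisson1 _ x1).
rewrite -bounded_measurable_Rintegral_sum; last first.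
  by move=> i; apply: bounded_measurableZ; exact: bounded_measurableM (bpoisson1 _ x1).
apply: eq_Rintegral => w _; rewrite -poisson1_sum mulr_sumr.
by apply: eq_bigr => i _; rewrite mulrCA.
Qed.

(** The dilate u (c y) obeys the Poisson formula with the same bound [M], and its gradient at [x] is
    c times the gradient of [u] at c x. Continuity of the partial derivatives allows c to tend to
    1. *)
Lemma gradient_dotv_le u M x l : harmonic_on (unit_ball R 4) u ->
  (forall y, unit_ball R 4 y -> `|u y| <= M) -> unit_ball R 4 x ->
  dotv (gradient u x) l <= M * gradient_mass x l.
Proof.
move=> uh uM x1; have [uC2 _] := uh.
have scaled c : 0 < c -> c < 1 ->
    c * dotv (gradient u (c *: x)) l <= M * gradient_mass x l.
  move=> c0 c1; pose f y := u (c *: y).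
  have cB y : enorm y <= 1 -> unit_ball R 4 (c *: y).
    move=> y1; rewrite /unit_ball/= enormZ gtr0_norm//.
    by rewrite (le_lt_trans _ c1)// ler_piMr// ltW.
  have [fC2 flap] := harmonic_scale c uh.
  have fh : harmonic_on (unit_ball R 4) f.
    by split => y y1; [apply: fC2|apply: flap]; apply: cB; exact: ltW.
  have fC y : enorm y <= 1 -> {for y, continuous f}.
    by move=> /cB h; have [] := fC2 _ h.
  pose g w := dens w * f (zeta w).
  have z1 w : enorm (zeta w) <= 1 by rewrite enormE zeta1 sqrtr1.
  have fM w : `|f (zeta w)| <= M by apply: uM; exact: cB.
  have bg : bounded_measurable g.
    apply: bounded_measurableM => //; split; last by exists M.
    exact: (measurable_continuous_comp mzeta z1 fC).
  have gE : gradient f x = gradient (poisson_int mu zeta g) x.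
    apply/rowP => i; rewrite !mxE; apply: near_eq_derive; near=> y.
    apply: (poisson_representation zeta1 mzeta bdens dens_ge0 mass1) => //.
    by near: y; exact: near_unit_ball.
  have -> : c * dotv (gradient u (c *: x)) l = dotv (gradient f x) l.
    rewrite -dotvZl; congr dotv; apply/rowP => i; rewrite !mxE.
    have [_ [/(_ i) [ud _] _]] := uC2 _ (cB _ (ltW x1)).
    by have [_] := is_derive_scale (DeriveDef ud erefl).
  rewrite gE dotv_gradient_poisson_int// /gradient_mass.
  have bn : bounded_measurable (fun w => dens w * `|poisson1 l x (zeta w)|).
    by apply: bounded_measurableM => //; apply: bounded_measurable_norm; exact: bpoisson1.
  rewrite -bounded_measurable_RintegralZ//.
  apply: bounded_measurable_le_Rintegral.
  - exact: bounded_measurableM (bpoisson1 _ x1).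
  - exact: bounded_measurableZ.
  move=> w; rewrite /g -mulrA [leRHS]mulrCA ler_wpM2l//.
  by rewrite (le_trans (ler_norm _))// normrM ler_wpM2r.
(* A strict reverse inequality at c = 1 would persist for nearby c < 1, against [scaled]. *)
rewrite leNgt; apply/negP => h.
have lim1 : (fun c : R => c * dotv (gradient u (c *: x)) l) @ (1 : R)
    --> (1 : R) * dotv (gradient u ((1 : R) *: x)) l.
  apply: cvgM; first exact: cvg_id.
  apply: (@continuous_sum_fun R R 4 (fun i c => gradient u (c *: x) 0 i * l 0 i)) => i.
  apply: cvgM; last exact: cvg_cst.
  rewrite mxE; under eq_fun do rewrite mxE.
  have sx : {for (1 : R), continuous (fun c : R => c *: x)} by exact: scalel_continuous.
  apply: (@continuous_comp _ _ _ (fun c : R => c *: x) (partial i u) 1 sx).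
  by rewrite scale1r; have [_ [/(_ i) []]] := uC2 _ x1.
move: lim1; rewrite scale1r mul1r => /cvgr_gt/(_ _ h)/nbhs_ballP[r /= r0 hr].
pose c := 1 - Num.min r 1 / 2.
have m0 : 0 < Num.min r 1 by rewrite lt_min r0 ltr01.
have mr : Num.min r 1 <= r by rewrite ge_min lexx.
have m1 : Num.min r 1 <= 1 by rewrite ge_min lexx orbT.
have c0 : 0 < c by rewrite /c; lra.
have c1 : c < 1 by rewrite /c; lra.
have cr : ball (1 : R) r c.
  by rewrite /ball/= /c opprB addrC subrK gtr0_norm ?divr_gt0//; lra.
by have := hr c cr; rewrite /= ltNge scaled.
Unshelve. all: by end_near. Qed.

(** The extremal function is the Poisson integral of the sign of the kernel derivative; positivity
    and unit mass of the kernel keep it within [-1, 1]. *)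
Lemma exists_gradient_mass x l : unit_ball R 4 x ->
  exists u, [/\ harmonic_on (unit_ball R 4) u,
    forall y, unit_ball R 4 y -> `|u y| <= 1 &
    dotv (gradient u x) l = gradient_mass x l].
Proof.
(* The value -1 at the zeros of the kernel derivative is immaterial, since the integrand vanishes
   there. *)
move=> x1; pose s w : R := if 0 < poisson1 l x (zeta w) then 1 else -1.
have [mp _] := bpoisson1 l x1.
have s1 w : `|s w| = 1 by rewrite /s; case: ifP => _; rewrite ?normrN normr1.
have bs : bounded_measurable s.
  split; last by exists 1 => w; rewrite s1.
  by apply: measurable_fun_ifT => //; apply: measurable_fun_ltr => //; exact: measurable_cst.
have bg : bounded_measurable (fun w => dens w * s w) by exact: bounded_measurableM.
exists (poisson_int mu zeta (fun w => dens w * s w)); split.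
- exact: harmonic_poisson_int.
- move=> y y1; rewrite -(mass1 y1) /poisson_int.
  have b2 := bounded_measurableM bg (bpoisson y1).
  rewrite (le_trans (bounded_measurable_norm_Rintegral _ b2))//.
  apply: bounded_measurable_le_Rintegral.
  - exact: bounded_measurable_norm.
  - exact: bounded_measurableM (bpoisson y1).
  move=> w; have p0 := ltW (poisson_gt0 (zeta1 w) y1).
  by rewrite normrM (ger0_norm p0) normrM s1 mulr1 ger0_norm.
- rewrite dotv_gradient_poisson_int//; apply: eq_Rintegral => w _.
  rewrite -mulrA; congr (_ * _); rewrite /s; case: ifPn => [p0|].
    by rewrite mul1r gtr0_norm.
  by rewrite -leNgt => p0; rewrite mulN1r ler0_norm.
Qed.

End GradientMass.

(** * Spherical coordinates *)

Section FubiniBounded.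
Context d1 d2 (T1 : measurableType d1) (T2 : measurableType d2) (R : realType).
Variables (P1 : probability T1 R) (P2 : probability T2 R).
Variable f : T1 * T2 -> R.
Hypothesis bf : bounded_measurable f.

Lemma bounded_measurable_section1 x : bounded_measurable (fun y => f (x, y)).
Proof.
have [mf [M fM]] := bf; split; last by exists M => y; exact: fM.
by apply: (measurableT_comp mf); exact: pair1_measurable.
Qed.

Lemma bounded_measurable_section2 y : bounded_measurable (fun x => f (x, y)).
Proof.
have [mf [M fM]] := bf; split; last by exists M => x; exact: fM.
by apply: (measurableT_comp mf); exact: pair2_measurable.
Qed.

Let intf : (P1 \x P2)%E.-integrable setT (EFin \o f).
Proof. exact: bounded_measurable_integrable. Qed.

Let inner1 x : (\int[P2]_y f (x, y))%:E = (\int[P2]_y (f (x, y))%:E)%E.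
Proof.
rewrite fineK//; apply: integrable_fin_num => //.
by apply: bounded_measurable_integrable; exact: bounded_measurable_section1.
Qed.

Let inner2 y : (\int[P1]_x f (x, y))%:E = (\int[P1]_x (f (x, y))%:E)%E.
Proof.
rewrite fineK//; apply: integrable_fin_num => //.
by apply: bounded_measurable_integrable; exact: bounded_measurable_section2.
Qed.

Lemma Rintegral_prod12 :
  \int[(P1 \x P2)%E]_z f z = \int[P1]_x \int[P2]_y f (x, y).
Proof.
rewrite /Rintegral; congr fine; rewrite -integral12_prod_meas1//.
by apply: eq_integral => x _; rewrite /fubini_F -inner1.
Qed.

Lemma Rintegral_prod21 :
  \int[(P1 \x P2)%E]_z f z = \int[P2]_y \int[P1]_x f (x, y).
Proof.
rewrite /Rintegral; congr fine; rewrite -integral21_prod_meas1//.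
by apply: eq_integral => x _; rewrite /fubini_G -inner2.
Qed.

Lemma bounded_measurable_Rintegral1 :
  bounded_measurable (fun x => \int[P2]_y f (x, y)).
Proof.
split.
  apply/measurable_EFinP; rewrite (_ : _ \o _ = fubini_F P2 (EFin \o f)).
    exact: (measurable_fubini_F intf).
  by apply/funext => x; rewrite /= inner1.
have [_ [M fM]] := bf; exists M => x; apply: Rintegral_norm_le => //.
exact: bounded_measurable_section1.
Qed.

End FubiniBounded.

Section UniformIntegral.
Context {R : realType}.
Variables (a b : R) (ab : a < b).
Implicit Types f F : R -> R.

Lemma Rintegral_uniform f : bounded_measurable (f : measurableTypeR R -> R) ->
  \int[uniform_prob ab]_x f x =
  (b - a)^-1 * \int[lebesgue_measure]_(x in `[a, b]) f x.
Proof.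
move=> bf; have [mf [M fM]] := bf.
have ab0 : b - a != 0 by rewrite gt_eqF// subr_gt0.
have lab : (lebesgue_measure `[a, b]%classic < +oo :> \bar R)%E.
  by rewrite lebesgue_measure_itv/= lte_fin ab ltry.
have leb : fine (lebesgue_measure `[a, b]%classic : \bar R) = b - a.
  by rewrite lebesgue_measure_itv/= lte_fin ab.
have iL (g : measurableTypeR R -> R) : measurable_fun setT g -> (exists N, forall x, `|g x| <= N) ->
    lebesgue_measure.-integrable `[a, b] (EFin \o g).
  move=> mg [N gN]; apply: measurable_bounded_integrable => //.
    exact: measurable_funTS.
  exists N; split; first exact: num_real.
  by move=> y Ny x _ /=; rewrite (le_trans (gN x))// ltW.
have fM0 x : 0 <= f x + M.
  by rewrite -lerBlDr sub0r; have := fM x; rewrite ler_norml => /andP[].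
have bM := @bounded_measurable_cst _ (measurableTypeR R) R M.
(* [integral_uniform] speaks of nonnegative functions: [f] is shifted by its bound [M], and the
   constant is subtracted afterwards. *)
have E : \int[uniform_prob ab]_x (f x + M) =
    (b - a)^-1 * \int[lebesgue_measure]_(x in `[a, b]) (f x + M).
  have mfM := iffRL (measurable_EFinP setT (fun x : measurableTypeR R => f x + M))
      (measurable_funD mf (measurable_cst M)).
  have fM0' x : (0 <= (f x + M)%:E)%E by rewrite lee_fin.
  rewrite /Rintegral (integral_uniform ab mfM fM0').
  rewrite fineM//; apply: integrable_fin_num => //; apply: iL.
    exact: measurable_funD.
  exists (M + `|M|) => x; rewrite (le_trans (ler_normD _ _))// lerD//.
move: E; rewrite bounded_measurable_RintegralD// Rintegral_probability_cst.
rewrite RintegralD//; last 2 first.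
- by apply: iL => //; exists M.
- by apply: iL => //; exists `|M|.
rewrite Rintegral_cst// leb mulrDr [M * _]mulrC mulKf// => /addIr; exact.
Qed.

Lemma Rintegral_derive f F :
  (forall x : R, x \in `[a, b] -> is_derive x 1 F (f x)) ->
  {within `[a, b], continuous f} ->
  \int[lebesgue_measure]_(x in `[a, b]) f x = F b - F a.
Proof.
move=> Fd fc; rewrite /Rintegral (continuous_FTC2 ab fc (F := F)) //.
- have Fc x : x \in `[a, b] -> {for x, continuous F}.
    by move=> /Fd[Fx _]; apply: differentiable_continuous; exact/derivable1_diffP.
  split.
  + by move=> x xab; have [] := Fd x (subset_itv_oo_cc xab).
  + by apply: cvg_at_right_filter; apply: Fc; rewrite in_itv/= lexx ltW.
  + by apply: cvg_at_left_filter; apply: Fc; rewrite in_itv/= lexx ltW.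
- move=> x xab; rewrite derive1E.
  by have [_ ->] := Fd x (subset_itv_oo_cc xab).
Qed.

Lemma Rintegral_uniform_derive f F :
  bounded_measurable (f : measurableTypeR R -> R) ->
  (forall x : R, is_derive x 1 F (f x)) -> continuous f ->
  \int[uniform_prob ab]_x f x = (b - a)^-1 * (F b - F a).
Proof.
move=> bf Fd fc; rewrite Rintegral_uniform//; congr (_ * _).
by apply: Rintegral_derive => //; exact: continuous_subspaceT.
Qed.

End UniformIntegral.

Section SphericalCoordinates.
Context {R : realType}.
Local Notation RR := (measurableTypeR R).

Lemma twopi_gt0 : 0 < 2 * pi :> R.
Proof. by rewrite mulr_gt0// pi_gt0. Qed.

(** Triples are [((th, ps), ph)]: two polar angles in [0, pi] and a longitude in [0, 2 pi]. *)
Definition angles_prob : probability ((RR * RR) * RR)%type R :=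
  ((uniform_prob (pi_gt0 R) \x uniform_prob (pi_gt0 R)) \x
    uniform_prob twopi_gt0)%E.

Definition sphere (w : (RR * RR) * RR) : 'rV[R]_4 :=
  \row_(i < 4) nth 0 [:: cos w.1.1; sin w.1.1 * cos w.1.2;
    sin w.1.1 * sin w.1.2 * cos w.2; sin w.1.1 * sin w.1.2 * sin w.2] i.

(* The density that turns the uniform law [angles_prob] of the three angles into the
   normalized area of the sphere. *)
Definition angle_density (w : (RR * RR) * RR) : R :=
  pi * sin w.1.1 ^+ 2 * `|sin w.1.2|.

Let i0 : 'I_4 := inord 0.
Let i1 : 'I_4 := inord 1.
Let i2 : 'I_4 := inord 2.
Let i3 : 'I_4 := inord 3.

Lemma sum_ord4 (F : 'I_4 -> R) : \sum_(i < 4) F i = F i0 + F i1 + F i2 + F i3.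
Proof.
rewrite !big_ord_recr big_ord0/= add0r.
by do ![congr (_ + _)]; congr F; apply: val_inj; rewrite /= inordK.
Qed.

Lemma sphereE w : [/\ sphere w 0 i0 = cos w.1.1,
  sphere w 0 i1 = sin w.1.1 * cos w.1.2,
  sphere w 0 i2 = sin w.1.1 * sin w.1.2 * cos w.2 &
  sphere w 0 i3 = sin w.1.1 * sin w.1.2 * sin w.2].
Proof. by split; rewrite mxE inordK. Qed.

Lemma dotv_sphere y w : dotv y (sphere w) = y 0 i0 * cos w.1.1
  + y 0 i1 * (sin w.1.1 * cos w.1.2)
  + y 0 i2 * (sin w.1.1 * sin w.1.2 * cos w.2)
  + y 0 i3 * (sin w.1.1 * sin w.1.2 * sin w.2).
Proof. by have [e0 e1 e2 e3] := sphereE w; rewrite /dotv sum_ord4 e0 e1 e2 e3. Qed.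

Lemma dotv_sphere_sphere w : dotv (sphere w) (sphere w) = 1.
Proof.
rewrite dotv_sphere; have [-> -> -> ->] := sphereE w.
have h (t : R) : sin t ^+ 2 = 1 - cos t ^+ 2.
  by have := cos2Dsin2 t; lra.
transitivity (cos w.1.1 ^+ 2 + sin w.1.1 ^+ 2 * (cos w.1.2 ^+ 2 +
  sin w.1.2 ^+ 2 * (cos w.2 ^+ 2 + sin w.2 ^+ 2))); first by ring.
by rewrite !h; ring.
Qed.

Lemma bounded_measurable_cos d (T : measurableType d) (p : T -> RR) :
  measurable_fun setT p -> bounded_measurable (fun w => cos (p w)).
Proof.
move=> mp; split; last by exists 1 => w; exact: cos_max.
apply: (measurableT_comp _ mp); apply: continuous_measurable_fun.
exact: continuous_cos.
Qed.

Lemma bounded_measurable_sin d (T : measurableType d) (p : T -> RR) :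
  measurable_fun setT p -> bounded_measurable (fun w => sin (p w)).
Proof.
move=> mp; split; last by exists 1 => w; exact: sin_max.
apply: (measurableT_comp _ mp); apply: continuous_measurable_fun.
exact: continuous_sin.
Qed.

Let mth : measurable_fun setT (fun w : (RR * RR) * RR => w.1.1).
Proof. exact: (measurableT_comp measurable_fst measurable_fst). Qed.

Let mps : measurable_fun setT (fun w : (RR * RR) * RR => w.1.2).
Proof. exact: (measurableT_comp measurable_snd measurable_fst). Qed.

Let mph : measurable_fun setT (fun w : (RR * RR) * RR => w.2).
Proof. exact: measurable_snd. Qed.

Lemma bounded_measurable_angles :
  [/\ bounded_measurable (fun w : (RR * RR) * RR => cos w.1.1),
    bounded_measurable (fun w : (RR * RR) * RR => sin w.1.1),
    bounded_measurable (fun w : (RR * RR) * RR => cos w.1.2),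
    bounded_measurable (fun w : (RR * RR) * RR => sin w.1.2) &
    bounded_measurable (fun w : (RR * RR) * RR => cos w.2) /\
    bounded_measurable (fun w : (RR * RR) * RR => sin w.2)].
Proof.
by split; [exact: bounded_measurable_cos|exact: bounded_measurable_sin
  |exact: bounded_measurable_cos|exact: bounded_measurable_sin|split;
  [exact: bounded_measurable_cos|exact: bounded_measurable_sin]].
Qed.

Lemma measurable_sphere i : measurable_fun setT (fun w => sphere w 0 i).
Proof.
have [cth sth cps sps [cph sph]] := bounded_measurable_angles.
have h : bounded_measurable (fun w => sphere w 0 i).
  under eq_fun do rewrite mxE.
  case: i => [[|[|[|[|//]]]] hi] /=; [exact: cth|exact: bounded_measurableM| |].
    by do 2 apply: bounded_measurableM => //.
  by do 2 apply: bounded_measurableM => //.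
by case: h.
Qed.

Lemma bounded_measurable_angle_density : bounded_measurable angle_density.
Proof.
have [cth sth cps sps [cph sph]] := bounded_measurable_angles.
apply: bounded_measurableM; last exact: bounded_measurable_norm.
by apply: bounded_measurableZ; exact: bounded_measurableX.
Qed.

Lemma angle_density_ge0 w : 0 <= angle_density w.
Proof. by rewrite mulr_ge0// mulr_ge0 ?sqr_ge0// pi_ge0. Qed.

Section AngleIntegrals.
Variable f : (RR * RR) * RR -> R.
Hypothesis bf : bounded_measurable f.

Let Uth := uniform_prob (pi_gt0 R).
Let Uph := uniform_prob twopi_gt0.

Lemma Rintegral_angles : \int[angles_prob]_w f w =
  \int[Uph]_ph \int[Uth]_th \int[Uth]_ps f ((th, ps), ph).
Proof.
rewrite /angles_prob Rintegral_prod21//; apply: eq_Rintegral => ph _.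
by rewrite Rintegral_prod12//; exact: bounded_measurable_section2.
Qed.

(** This lemma and the next two let an exact derivative in one angle be integrated in that angle
    first. *)
Lemma Rintegral_angles_th0 :
  (forall ps ph, \int[Uth]_th f ((th, ps), ph) = 0) -> \int[angles_prob]_w f w = 0.
Proof.
move=> h; rewrite /angles_prob Rintegral_prod21//.
rewrite (@eq_Rintegral _ _ _ _ _ (fun=> 0)) ?Rintegral_probability_cst// => ph _.
rewrite Rintegral_prod21; last exact: bounded_measurable_section2.
by rewrite (@eq_Rintegral _ _ _ _ _ (fun=> 0)) ?Rintegral_probability_cst.
Qed.

Lemma Rintegral_angles_ps0 :
  (forall th ph, \int[Uth]_ps f ((th, ps), ph) = 0) -> \int[angles_prob]_w f w = 0.
Proof.
move=> h; rewrite Rintegral_angles.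
rewrite (@eq_Rintegral _ _ _ _ _ (fun=> 0)) ?Rintegral_probability_cst// => ph _.
by rewrite (@eq_Rintegral _ _ _ _ _ (fun=> 0)) ?Rintegral_probability_cst.
Qed.

Lemma Rintegral_angles_ph0 :
  (forall th ps, \int[Uph]_ph f ((th, ps), ph) = 0) -> \int[angles_prob]_w f w = 0.
Proof.
move=> h; rewrite /angles_prob Rintegral_prod12//.
by rewrite (@eq_Rintegral _ _ _ _ _ (fun=> 0)) ?Rintegral_probability_cst// => -[th ps] _.
Qed.

(** The absolute value makes the density nonnegative at all real angles. It is harmless under the
    integral, where [ps] stays in [0, pi], and without it the integrand is smooth. *)
Lemma Rintegral_angle_density : \int[angles_prob]_w (angle_density w * f w) =
  \int[angles_prob]_w (pi * sin w.1.1 ^+ 2 * sin w.1.2 * f w).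
Proof.
have [cth sth cps sps [cph sph]] := bounded_measurable_angles.
have b1 : bounded_measurable (fun w => angle_density w * f w).
  by apply: bounded_measurableM => //; exact: bounded_measurable_angle_density.
have b2 : bounded_measurable
    (fun w : (RR * RR) * RR => pi * sin w.1.1 ^+ 2 * sin w.1.2 * f w).
  apply: bounded_measurableM => //; apply: bounded_measurableM => //.
  by apply: bounded_measurableZ; exact: bounded_measurableX.
rewrite /angles_prob !Rintegral_prod21//; apply: eq_Rintegral => ph _.
have b1' := bounded_measurable_section2 b1 ph.
have b2' := bounded_measurable_section2 b2 ph.
rewrite !Rintegral_prod12//; apply: eq_Rintegral => th _.
rewrite !Rintegral_uniform; [|exact: bounded_measurable_section1 b2' th
  |exact: bounded_measurable_section1 b1' th].
congr (_ * _); apply: eq_Rintegral => ps; rewrite inE/= in_itv/= => /sin_ge0_pi h.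
by rewrite /angle_density/= ger0_norm.
Qed.

End AngleIntegrals.

Lemma continuous_of_is_derive (f df : R -> R) :
  (forall x : R, is_derive x 1 f (df x)) -> continuous f.
Proof.
move=> fd x; apply: differentiable_continuous; apply/derivable1_diffP.
by have [] := fd x.
Qed.

(** The integrand is the derivative of a I^2, whose values at the two ends agree. In each single
    angle [sqdist] has the form 1 + N - 2 (al cos s + be sin s + ga), so this one statement serves
    all three angles. *)
Lemma angle_integral0 (lo hi : R) (lh : lo < hi) (al be ga N : R)
    (a a' I f : R -> R) :
  (forall s, 0 < 1 + N - 2 * (al * cos s + be * sin s + ga)) ->
  (forall s : R, is_derive s 1 a (a' s)) -> continuous a' ->
  (forall s, I s = (1 + N - 2 * (al * cos s + be * sin s + ga))^-1) ->
  a lo * I lo ^+ 2 = a hi * I hi ^+ 2 ->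
  (forall s, f s = a' s * I s ^+ 2 + a s * (4 * (be * cos s - al * sin s) * I s ^+ 3)) ->
  bounded_measurable (f : RR -> R) ->
  \int[uniform_prob lh]_s f s = 0.
Proof.
move=> D0 ad a'c IE ahl fE bf.
have Id (s : R) : is_derive s 1 I (2 * (be * cos s - al * sin s) * I s ^+ 2).
  rewrite (_ : I = fun s => (1 + N - 2 * (al * cos s + be * sin s + ga))^-1); last exact/funext.
  have h1 := is_derive_add (is_derive_cmul al (is_derive_cos s))
    (is_derive_cmul be (is_derive_sin s)).
  have h2 := is_derive_cmul 2 (is_derive_add h1 (is_derive_const ga s 1)).
  have h3 := is_derive_sub (is_derive_const (1 + N) s 1) h2.
  have n0 : 1 + N - 2 * (al * cos s + be * sin s + ga) != 0 by rewrite gt_eqF.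
  have h4 := @is_derive_inv R _
    (fun s => 1 + N - 2 * (al * cos s + be * sin s + ga)) s 1 _ n0 h3.
  by apply: (is_derive_eq h4); rewrite addr0; ring.
have Fd (s : R) : is_derive s 1 (fun s => a s * I s ^+ 2) (f s).
  by rewrite fE; apply: (is_derive_eq (is_derive_mul (ad s) (is_derive_pow 1 (Id s)))); ring.
rewrite (Rintegral_uniform_derive lh bf Fd); first by rewrite ahl subrr mulr0.
rewrite (_ : f = fun s => a' s * I s ^+ 2 + a s * (4 * (be * cos s - al * sin s) * I s ^+ 3)); last exact/funext.
have Ic := continuous_of_is_derive Id; have ac := continuous_of_is_derive ad.
have cM (p q : R -> R) : continuous p -> continuous q -> continuous (fun s => p s * q s).
  by move=> pc qc s; apply: cvgM; [exact: pc|exact: qc].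
have cX n : continuous (fun s => I s ^+ n).
  elim: n => [|n IH]; first by under eq_fun do rewrite expr0; exact: cst_continuous.
  by under eq_fun do rewrite exprS; exact: cM.
have cD (p q : R -> R) : continuous p -> continuous q -> continuous (fun s => p s + q s).
  by move=> pc qc s; apply: cvgD; [exact: pc|exact: qc].
apply: (cD); first by apply: (cM) => //; exact: cX.
apply: (cM) => //; apply: (cM); last exact: cX.
apply: (cM); first exact: cst_continuous.
apply: (cD); first by apply: (cM); [exact: cst_continuous|exact: continuous_cos].
under eq_fun do rewrite -mulNr.
by apply: cM; [exact: cst_continuous|exact: continuous_sin].
Qed.

End SphericalCoordinates.

(** * Rotation invariance and mass of the Poisson kernel *)

Section Killing.
Context {R : realType}.
Local Notation RR := (measurableTypeR R).
Local Notation W := ((RR * RR) * RR)%type.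
Variable y : 'rV[R]_4.
Hypothesis y1 : unit_ball R 4 y.

Local Notation y_ k := (y 0 (inord k)).
Local Notation z_ w k := (sphere w 0 (inord k)).
Let I (w : W) : R := (sqdist y (sphere w))^-1.

Let tt (th ps ph : R) : R := y_ 0 * cos th + y_ 1 * (sin th * cos ps)
  + y_ 2 * (sin th * sin ps * cos ph) + y_ 3 * (sin th * sin ps * sin ph).

Let sqdistE' th ps ph : sqdist y (sphere ((th, ps), ph)) =
  1 + dotv y y - 2 * tt th ps ph.
Proof. by rewrite /sqdist dotv_sphere. Qed.

Let D0 th ps ph : 0 < 1 + dotv y y - 2 * tt th ps ph.
Proof. by rewrite -sqdistE' sqdist_gt0// dotv_sphere_sphere. Qed.

Let bI : bounded_measurable I.
Proof.
apply: bounded_measurable_sqdist_inv => //; first exact: dotv_sphere_sphere.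
exact: measurable_sphere.
Qed.

Let bsphere i : bounded_measurable (fun w : W => sphere w 0 i).
Proof.
apply: bounded_measurable_coord; first exact: dotv_sphere_sphere.
exact: measurable_sphere.
Qed.

Let bc0 := let: And5 h _ _ _ _ := @bounded_measurable_angles R in h.
Let bs0 := let: And5 _ h _ _ _ := @bounded_measurable_angles R in h.
Let bc1 := let: And5 _ _ h _ _ := @bounded_measurable_angles R in h.
Let bs1 := let: And5 _ _ _ h _ := @bounded_measurable_angles R in h.
Let bc2 := let: And5 _ _ _ _ (conj h _) := @bounded_measurable_angles R in h.
Let bs2 := let: And5 _ _ _ _ (conj _ h) := @bounded_measurable_angles R in h.

Ltac bounded_trig := repeat first
  [ exact: bI | exact: bc0 | exact: bs0 | exact: bc1 | exact: bs1 | exact: bc2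
  | exact: bs2 | exact: bsphere | exact: bounded_measurable_cst
  | apply: bounded_measurableD | apply: bounded_measurableN
  | apply: bounded_measurableX | apply: bounded_measurableM ].

Let dens_eq (f : W -> R) : bounded_measurable f ->
  \int[angles_prob]_w (angle_density w * f w) =
  \int[angles_prob]_w (pi * sin w.1.1 ^+ 2 * sin w.1.2 * f w).
Proof. exact: Rintegral_angle_density. Qed.

(* The integrand is, up to a factor, the derivative of [I ^+ 2] along the rotation of
   the sphere in a coordinate plane, hence a divergence in the angles. *)
Lemma killing23 : \int[angles_prob]_w
  (angle_density w * ((y_ 2 * z_ w 3 - y_ 3 * z_ w 2) * I w ^+ 3)) = 0.
Proof.
rewrite dens_eq; last by bounded_trig.
set f := fun w => _.
have bf : bounded_measurable f by rewrite /f; bounded_trig.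
apply: Rintegral_angles_ph0 => // th ps.
apply: (@angle_integral0 _ _ _ _ (y_ 2 * sin th * sin ps) (y_ 3 * sin th * sin ps)
  (y_ 0 * cos th + y_ 1 * (sin th * cos ps)) (dotv y y)
  (fun=> - pi / 4 * sin th ^+ 2 * sin ps) (fun=> 0)
  (fun ph => I ((th, ps), ph))).
- by move=> ph; have := D0 th ps ph; congr (0 < _); rewrite /tt; ring.
- exact: cst_continuous.
- by move=> ph; rewrite /I sqdistE'; congr (_^-1); rewrite /tt; ring.
- by rewrite /I !sqdistE' /tt [2 * pi]mulr_natl cos2pi sin2pi cos0 sin0.
- move=> ph; rewrite /f; have [_ _ -> ->] := sphereE (th, ps, ph).
  by rewrite /=; field.
- exact: (bounded_measurable_section1 bf).
Qed.

(** The rotation moves [ps] at speed cos ph and [ph] at speed -cot ps sin ph. Multiplied by the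
    density this field has divergence zero: [fA] and [fB] are the derivatives, in [ps] and in [ph],
    of its two components times I^2 (up to a constant), and their terms in I^2 cancel. *)
Lemma killing12 : \int[angles_prob]_w
  (angle_density w * ((y_ 1 * z_ w 2 - y_ 2 * z_ w 1) * I w ^+ 3)) = 0.
Proof.
rewrite dens_eq; last by bounded_trig.
pose fA (w : W) : R := - pi / 4 * sin w.1.1 ^+ 2 * cos w.1.2 * cos w.2 * I w ^+ 2
  + - pi / 4 * sin w.1.1 ^+ 2 * sin w.1.2 * cos w.2 *
    (4 * (sin w.1.1 * (y_ 2 * cos w.2 + y_ 3 * sin w.2) * cos w.1.2
      - y_ 1 * sin w.1.1 * sin w.1.2) * I w ^+ 3).
pose fB (w : W) : R := pi / 4 * sin w.1.1 ^+ 2 * cos w.1.2 * cos w.2 * I w ^+ 2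
  + pi / 4 * sin w.1.1 ^+ 2 * cos w.1.2 * sin w.2 *
    (4 * (y_ 3 * sin w.1.1 * sin w.1.2 * cos w.2
      - y_ 2 * sin w.1.1 * sin w.1.2 * sin w.2) * I w ^+ 3).
have bA : bounded_measurable fA by rewrite /fA; bounded_trig.
have bB : bounded_measurable fB by rewrite /fB; bounded_trig.
rewrite (@eq_Rintegral _ _ _ _ _ (fun w => fA w + fB w)); last first.
  move=> w _; have [_ -> -> _] := sphereE w; rewrite /fA/fB.
  have := cos2Dsin2 w.2; set c2 := cos w.2; set s2 := sin w.2.
  move=> /(canRL (addrK _)) h.
  transitivity (pi * sin w.1.1 ^+ 3 * sin w.1.2 * I w ^+ 3 *
    (y_ 1 * sin w.1.2 * c2 - y_ 2 * cos w.1.2 * (c2 ^+ 2 + s2 ^+ 2))).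
    by rewrite h; ring.
  by field.
rewrite bounded_measurable_RintegralD// Rintegral_angles_ps0//; last first.
  move=> th ph.
  apply: (@angle_integral0 _ _ _ _ (y_ 1 * sin th)
    (sin th * (y_ 2 * cos ph + y_ 3 * sin ph)) (y_ 0 * cos th) (dotv y y)
    (fun ps => - pi / 4 * sin th ^+ 2 * cos ph * sin ps)
    (fun ps => - pi / 4 * sin th ^+ 2 * cos ph * cos ps)
    (fun ps => I ((th, ps), ph))).
  - by move=> ps; have := D0 th ps ph; congr (0 < _); rewrite /tt; ring.
  - by move=> ps; apply: cvgM; [exact: cvg_cst|exact: continuous_cos].
  - by move=> ps; rewrite /I sqdistE'; congr (_^-1); rewrite /tt; ring.
  - by rewrite sin0 sinpi !mulr0 !mul0r.
  - by move=> ps; rewrite /fA/=; ring.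
  - exact: bounded_measurable_section1 (bounded_measurable_section2 bA ph) th.
rewrite add0r Rintegral_angles_ph0// => th ps.
apply: (@angle_integral0 _ _ _ _ (y_ 2 * sin th * sin ps) (y_ 3 * sin th * sin ps)
  (y_ 0 * cos th + y_ 1 * (sin th * cos ps)) (dotv y y)
  (fun ph => pi / 4 * sin th ^+ 2 * cos ps * sin ph)
  (fun ph => pi / 4 * sin th ^+ 2 * cos ps * cos ph)
  (fun ph => I ((th, ps), ph))).
- by move=> ph; have := D0 th ps ph; congr (0 < _); rewrite /tt; ring.
- by move=> ph; apply: cvgM; [exact: cvg_cst|exact: continuous_cos].
- by move=> ph; rewrite /I sqdistE'; congr (_^-1); rewrite /tt; ring.
- by rewrite [2 * pi]mulr_natl sin2pi sin0 !mulr0 !mul0r.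
- by move=> ph; rewrite /fB/=; ring.
- exact: bounded_measurable_section1 bB (th, ps).
Qed.

(** Here the rotation moves [th] at speed cos ps and [ps] at speed -cot th sin ps; [fA] is a
    derivative in [th] and [fB] one in [ps]. *)
Lemma killing01 : \int[angles_prob]_w
  (angle_density w * ((y_ 0 * z_ w 1 - y_ 1 * z_ w 0) * I w ^+ 3)) = 0.
Proof.
rewrite dens_eq; last by bounded_trig.
pose be (w : W) : R := y_ 1 * cos w.1.2 + y_ 2 * (sin w.1.2 * cos w.2)
  + y_ 3 * (sin w.1.2 * sin w.2).
pose fA (w : W) : R := - pi / 2 * sin w.1.1 * cos w.1.1 * sin w.1.2 * cos w.1.2 * I w ^+ 2
  + - pi / 4 * sin w.1.1 ^+ 2 * sin w.1.2 * cos w.1.2 *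
    (4 * (be w * cos w.1.1 - y_ 0 * sin w.1.1) * I w ^+ 3).
pose fB (w : W) : R := pi / 2 * sin w.1.1 * cos w.1.1 * sin w.1.2 * cos w.1.2 * I w ^+ 2
  + pi / 4 * sin w.1.1 * cos w.1.1 * sin w.1.2 ^+ 2 *
    (4 * (sin w.1.1 * (y_ 2 * cos w.2 + y_ 3 * sin w.2) * cos w.1.2
      - y_ 1 * sin w.1.1 * sin w.1.2) * I w ^+ 3).
have bA : bounded_measurable fA by rewrite /fA /be; bounded_trig.
have bB : bounded_measurable fB by rewrite /fB; bounded_trig.
rewrite (@eq_Rintegral _ _ _ _ _ (fun w => fA w + fB w)); last first.
  move=> w _; have [-> -> _ _] := sphereE w; rewrite /fA/fB/be.
  have := cos2Dsin2 w.1.2; set c1 := cos w.1.2; set s1 := sin w.1.2.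
  move=> /(canRL (addrK _)) h.
  transitivity (pi * sin w.1.1 ^+ 2 * s1 * I w ^+ 3 *
    (y_ 0 * sin w.1.1 * c1 - y_ 1 * cos w.1.1 * (c1 ^+ 2 + s1 ^+ 2))).
    by rewrite h; ring.
  by field.
have dsin2 (s : R) : is_derive s 1 (fun s : R => sin s ^+ 2) (2 * sin s * cos s).
  by apply: (is_derive_eq (is_derive_pow 1 (is_derive_sin s))); ring.
have csc (k : R) : continuous (fun s : R => k * (2 * sin s * cos s)).
  move=> s; apply: cvgM; first exact: cvg_cst.
  apply: cvgM; last exact: continuous_cos.
  by apply: cvgM; [exact: cvg_cst|exact: continuous_sin].
rewrite bounded_measurable_RintegralD// Rintegral_angles_th0//; last first.
  move=> ps ph.
  apply: (@angle_integral0 _ _ _ _ (y_ 0) (be ((0, ps), ph)) 0 (dotv y y)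
    (fun th => - pi / 4 * sin ps * cos ps * sin th ^+ 2)
    (fun th => - pi / 4 * sin ps * cos ps * (2 * sin th * cos th))
    (fun th => I ((th, ps), ph))).
  - by move=> th; have := D0 th ps ph; congr (0 < _); rewrite /tt /be/=; ring.
  - exact: csc.
  - by move=> th; rewrite /I sqdistE'; congr (_^-1); rewrite /tt /be/=; ring.
  - by rewrite sin0 sinpi expr0n/= !mulr0 !mul0r.
  - by move=> th; rewrite /fA/be/=; field.
  - exact: bounded_measurable_section2 (bounded_measurable_section2 bA ph) ps.
rewrite add0r Rintegral_angles_ps0// => th ph.
apply: (@angle_integral0 _ _ _ _ (y_ 1 * sin th)
  (sin th * (y_ 2 * cos ph + y_ 3 * sin ph)) (y_ 0 * cos th) (dotv y y)
  (fun ps => pi / 4 * sin th * cos th * sin ps ^+ 2)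
  (fun ps => pi / 4 * sin th * cos th * (2 * sin ps * cos ps))
  (fun ps => I ((th, ps), ph))).
- by move=> ps; have := D0 th ps ph; congr (0 < _); rewrite /tt; ring.
- exact: csc.
- by move=> ps; rewrite /I sqdistE'; congr (_^-1); rewrite /tt; ring.
- by rewrite sin0 sinpi expr0n/= !mulr0 !mul0r.
- by move=> ps; rewrite /fB/=; field.
- exact: bounded_measurable_section1 (bounded_measurable_section2 bB ph) th.
Qed.

End Killing.

(** * Rotations in a coordinate plane *)

Section PlaneRotation.
Context {R : realType}.
Implicit Types (y z : 'rV[R]_4) (i j k : 'I_4).

Definition plane_rot i j (t : R) y : 'rV[R]_4 :=
  \row_k (if k == i then cos t * y 0 i - sin t * y 0 j
          else if k == j then sin t * y 0 i + cos t * y 0 j else y 0 k).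

Lemma dotv_plane_rot i j t y z : i != j -> dotv (plane_rot i j t y) z =
  dotv y z + (cos t * y 0 i - sin t * y 0 j - y 0 i) * z 0 i
  + (sin t * y 0 i + cos t * y 0 j - y 0 j) * z 0 j.
Proof.
move=> ij; have ji : j != i by rewrite eq_sym.
rewrite /dotv (bigD1 i)//= (bigD1 j)//= [in RHS](bigD1 i)//= [in RHS](bigD1 j)//=.
rewrite !mxE !eqxx (negPf ji).
rewrite (eq_bigr (fun k => y 0 k * z 0 k)); first by ring.
by move=> k /andP[/negPf ki /negPf kj]; rewrite mxE ki kj.
Qed.

Lemma dotv_plane_rot_self i j t y : i != j ->
  dotv (plane_rot i j t y) (plane_rot i j t y) = dotv y y.
Proof.
move=> ij; have /negPf ji : j != i by rewrite eq_sym.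
rewrite dotv_plane_rot// (dotvC y) dotv_plane_rot// !mxE !eqxx ji.
have := cos2Dsin2 t => /(canRL (addrK _)); set c := cos t; set s := sin t.
set a := y 0 i; set b := y 0 j => h.
transitivity (dotv y y + (c ^+ 2 + s ^+ 2 - 1) * (a ^+ 2 + b ^+ 2)); first by ring.
by rewrite h; ring.
Qed.

Lemma plane_rot0 i j y : plane_rot i j 0 y = y.
Proof.
apply/rowP => k; rewrite mxE cos0 sin0 !mul1r !mul0r subr0 add0r.
by case: eqP => [->//|_]; case: eqP => [->|].
Qed.

(** The angle that turns (a, b) onto the nonnegative half-axis has cos t = a / p and sin t = -b / p.
    Since [acos] yields a nonnegative sine, the sign of [b] decides the sign of the angle. *)
Lemma polar_angle (a b : R) : exists t, cos t * a - sin t * b = Num.sqrt (a ^+ 2 + b ^+ 2)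
  /\ sin t * a + cos t * b = 0.
Proof.
set p := Num.sqrt _.
have p2 : p ^+ 2 = a ^+ 2 + b ^+ 2 by rewrite sqr_sqrtr// addr_ge0 ?sqr_ge0.
have [p0|p0] := eqVneq p 0.
  exists 0; rewrite p0 cos0 sin0 !mul1r !mul0r subr0 add0r.
  move: p2; rewrite p0 expr0n/= => /esym/eqP.
  by rewrite paddr_eq0 ?sqr_ge0// !sqrf_eq0 => /andP[/eqP-> /eqP->].
have pp : 0 < p by rewrite lt_neqAle eq_sym p0 sqrtr_ge0.
pose c := a / p.
have c1 : -1 <= c <= 1.
  rewrite -ler_norml normrM normfV (gtr0_norm pp) ler_pdivrMr// mul1r.
  by rewrite -sqrtr_sqr ler_wsqrtr// lerDl sqr_ge0.
have s2 : Num.sqrt (1 - c ^+ 2) = `|b| / p.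
  rewrite (_ : 1 - c ^+ 2 = (b / p) ^+ 2); last first.
    by rewrite /c !exprMn !exprVn p2; field; rewrite -p2 expf_neq0.
  by rewrite sqrtr_sqr normrM normfV (gtr0_norm pp).
have [b0|b0] := leP b 0.
  exists (acos c); rewrite acosK// sin_acos// s2 ler0_norm// /c; split.
    by transitivity ((a ^+ 2 + b ^+ 2) / p); [field|rewrite -p2; field].
  by field.
exists (- acos c); rewrite cosN sinN acosK// sin_acos// s2 gtr0_norm// /c; split.
  by transitivity ((a ^+ 2 + b ^+ 2) / p); [field|rewrite -p2; field].
by field.
Qed.

End PlaneRotation.

Section Mass.
Context {R : realType}.
Implicit Types (y z : 'rV[R]_4) (i j k : 'I_4).

Let mass := poisson_int (@angles_prob R) sphere angle_density.
Let bdens := @bounded_measurable_angle_density R.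
Let z1 := @dotv_sphere_sphere R.
Let mz := @measurable_sphere R.

(** A rotation of [y] fixes |y|^2 and changes [sqdist] only through the dot product, so the
    derivative of the mass in the angle is a multiple of the integral that [kill] annihilates. *)
Lemma mass_plane_rot i j t y : i != j -> unit_ball R 4 y ->
  (forall y, unit_ball R 4 y -> \int[angles_prob]_w (angle_density w *
    ((y 0 i * sphere w 0 j - y 0 j * sphere w 0 i) * (sqdist y (sphere w))^-1 ^+ 3)) = 0) ->
  mass (plane_rot i j t y) = mass y.
Proof.
move=> ij y1 kill; rewrite -[in RHS](plane_rot0 i j y).
have /negPf ji : j != i by rewrite eq_sym.
have ry s : unit_ball R 4 (plane_rot i j s y).
  by apply/unit_ballE; rewrite dotv_plane_rot_self//; exact/unit_ballE.
pose K1 s w := angle_density w * (4 * (1 - dotv y y) *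
  ((plane_rot i j s y 0 i * sphere w 0 j - plane_rot i j s y 0 j * sphere w 0 i) *
   (sqdist (plane_rot i j s y) (sphere w))^-1 ^+ 3)).
suff key (s : R) : is_derive s 1 (fun s => mass (plane_rot i j s y)) 0.
  exact: (is_derive_0_is_cst (f := fun s => mass (plane_rot i j s y))).
have <- : \int[angles_prob]_w K1 s w = 0.
  rewrite /K1; under eq_Rintegral do rewrite mulrCA.
  rewrite bounded_measurable_RintegralZ ?kill ?mulr0//.
  apply: bounded_measurableM => //; apply: bounded_measurableM; last first.
    by apply: bounded_measurableX; exact: bounded_measurable_sqdist_inv.
  by apply: bounded_measurableB; apply: bounded_measurableZ; exact: bounded_measurable_coord.
have dd w (x : R) : is_derive x 1 (fun s => dotv (plane_rot i j s y) (sphere w))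
    (plane_rot i j x y 0 i * sphere w 0 j - plane_rot i j x y 0 j * sphere w 0 i).
  rewrite (_ : (fun s => _) = fun s => dotv y (sphere w)
      + (y 0 i * cos s - y 0 j * sin s - y 0 i) * sphere w 0 i
      + (y 0 i * sin s + y 0 j * cos s - y 0 j) * sphere w 0 j); last first.
    by apply/funext => a; rewrite dotv_plane_rot//; ring.
  have hc := is_derive_cos x; have hs := is_derive_sin x.
  have k c := is_derive_const (c : R) x 1.
  have h1 := is_derive_sub (is_derive_sub (is_derive_cmul (y 0 i) hc)
    (is_derive_cmul (y 0 j) hs)) (k (y 0 i)).
  have h2 := is_derive_sub (is_derive_add (is_derive_cmul (y 0 i) hs)
    (is_derive_cmul (y 0 j) hc)) (k (y 0 j)).
  have h3 := is_derive_add (is_derive_add (k (dotv y (sphere w)))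
    (is_derive_mul h1 (k (sphere w 0 i)))) (is_derive_mul h2 (k (sphere w 0 j))).
  by apply: (is_derive_eq h3); rewrite !mxE !eqxx ji; ring.
have ucoord k : @unif_cont_at R _ R s (fun (_ : R) w => sphere w 0 k).
  by apply: unif_cont_at_cst; have [] := bounded_measurable_coord z1 mz k.
have udens : @unif_cont_at R _ R s (fun _ : R => angle_density).
  by apply: unif_cont_at_cst; have [] := bdens.
have ucst (c : R) : @unif_cont_at R _ R s (fun (_ : R) (_ : (measurableTypeR R * measurableTypeR R) * measurableTypeR R) => c).
  by apply: unif_cont_at_cst; exists `|c|.
have urot k : {for s, continuous (fun s => plane_rot i j s y 0 k)}.
  have cc (c : R) (f : R -> R) : continuous f -> continuous (fun s => f s * c).
    by move=> fc x; apply: cvgM; [exact: fc|exact: cvg_cst].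
  have [ki|ki] := boolP (k == i).
    rewrite (_ : (fun s => _) = fun s => cos s * y 0 i - sin s * y 0 j).
      exact: (continuousB (cc _ _ (@continuous_cos R) s) (cc _ _ (@continuous_sin R) s)).
    by apply/funext => a; rewrite mxE ki.
  have [kj|kj] := boolP (k == j).
    rewrite (_ : (fun s => _) = fun s => sin s * y 0 i + cos s * y 0 j).
      exact: (continuousD (cc _ _ (@continuous_sin R) s) (cc _ _ (@continuous_cos R) s)).
    by apply/funext => a; rewrite mxE (negPf ki) kj.
  rewrite (_ : (fun s => _) = fun=> y 0 k); first exact: cst_continuous.
  by apply/funext => a; rewrite mxE (negPf ki) (negPf kj).
have urotk k : @unif_cont_at R _ R s (fun (s : R)
   (_ : (measurableTypeR R * measurableTypeR R) * measurableTypeR R) => plane_rot i j s y 0 k).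
  by apply: unif_cont_at_fun; exact: urot.
have uD : @unif_cont_at R _ R s (fun s w => (sqdist (plane_rot i j s y) (sphere w))^-1).
  apply: (@unif_cont_atV _ _ _ _ _ ((1 - enorm (plane_rot i j s y)) ^+ 2)).
  - by rewrite exprn_gt0// subr_gt0; exact: ry.
  - by move=> w; apply: sqdist_ge; exact: z1.
  apply: unif_cont_atD.
    rewrite [X in unif_cont_at _ X](_ : _ = fun _ _ => 1 + dotv y y); first exact: ucst.
    by apply/funext => a; apply/funext => w; rewrite dotv_plane_rot_self.
  apply: unif_cont_atN; apply: unif_cont_atZ; apply: unif_cont_at_sum => k.
  exact: unif_cont_atM.
apply: (@is_derive_Rintegral_param _ _ _ _ _ _ K1).
- near=> x => w; apply: is_derive_cmul.
  have D0 : sqdist (plane_rot i j x y) (sphere w) != 0.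
    by rewrite gt_eqF// sqdist_gt0.
  have h1 := is_derive_sub (is_derive_const (1 + dotv y y) x 1) (is_derive_cmul 2 (dd w x)).
  rewrite (_ : (fun s => _) = fun s => (1 - dotv y y) *
      (1 + dotv y y - 2 * dotv (plane_rot i j s y) (sphere w))^-1 ^+ 2); last first.
    by apply/funext => a; rewrite /poisson /sqdist dotv_plane_rot_self.
  have n0 : 1 + dotv y y - 2 * dotv (plane_rot i j x y) (sphere w) != 0.
    by rewrite -(dotv_plane_rot_self x y ij).
  have h2 := @is_derive_inv R _
    (fun s => 1 + dotv y y - 2 * dotv (plane_rot i j s y) (sphere w)) x 1 _ n0 h1.
  apply: (is_derive_eq (is_derive_cmul (1 - dotv y y) (is_derive_pow 1 h2))).
  by rewrite /K1/sqdist dotv_plane_rot_self//; ring.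
- apply: unif_cont_atM => //; apply: unif_cont_atZ; apply: unif_cont_atM.
    by apply: unif_cont_atD; [|apply: unif_cont_atN]; exact: unif_cont_atM.
  exact: unif_cont_atX.
- near=> x; apply: bounded_measurableM => //; exact: bounded_measurable_poisson.
- apply: bounded_measurableM => //; apply: bounded_measurableZ; apply: bounded_measurableM.
    by apply: bounded_measurableB; apply: bounded_measurableZ; exact: bounded_measurable_coord.
  by apply: bounded_measurableX; exact: bounded_measurable_sqdist_inv.
Unshelve. all: by end_near. Qed.

(** The means of sin^2 and sin over [0, pi] are 1/2 and 2/pi. The factor pi of the density is the
    volume 2 pi^3 of the box of angles divided by the area 2 pi^2 of the sphere. *)
Lemma Rintegral_angle_density1 : \int[@angles_prob R]_w angle_density w = 1.
Proof.
have := Rintegral_angle_density (@bounded_measurable_cst _ _ R 1).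
under eq_Rintegral do rewrite mulr1.
under [in RHS]eq_Rintegral do rewrite mulr1.
move=> ->; rewrite Rintegral_angles; last first.
  have [_ bs0 _ bs1 _] := @bounded_measurable_angles R.
  by apply: bounded_measurableM => //; apply: bounded_measurableZ; exact: bounded_measurableX.
have bs := @bounded_measurable_sin R _ (measurableTypeR R) id (@measurable_id _ _ _).
have p0 : pi != 0 :> R by rewrite gt_eqF// pi_gt0.
have i1 : \int[uniform_prob (pi_gt0 R)]_ps sin ps = 2 / pi.
  have dF (x : R) : is_derive x 1 (fun s : R => - cos s) (sin x).
    by apply: (is_derive_eq (is_deriveN (is_derive_cos x))); rewrite opprK.
  rewrite (Rintegral_uniform_derive _ bs dF); last exact: continuous_sin.
  by rewrite cospi cos0 subr0 !opprK; ring.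
have i2 : \int[uniform_prob (pi_gt0 R)]_th (sin th ^+ 2) = 1 / 2.
  have dF (x : R) : is_derive x 1 (fun s : R => 2^-1 * (s - sin s * cos s)) (sin x ^+ 2).
    have h := is_derive_cmul 2^-1 (is_derive_sub (is_derive_id x 1)
      (is_derive_mul (is_derive_sin x) (is_derive_cos x))).
    apply: (is_derive_eq h); have := cos2Dsin2 x; set c := cos x; set s := sin x.
    move=> /(canRL (addrK _)) h2.
    by transitivity (2^-1 * (1 - c ^+ 2 + s ^+ 2)); [ring|rewrite h2; field].
  rewrite (Rintegral_uniform_derive _ _ dF).
  - by rewrite sinpi sin0 !mul0r !subr0 mulr0 subr0 mulrCA mulVf// mulr1 div1r.
  - exact: bounded_measurableX.
  - by move=> x; apply: cvgM; exact: continuous_sin.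
rewrite (@eq_Rintegral _ _ _ _ _ (fun=> 1)) ?Rintegral_probability_cst// => ph _.
transitivity (\int[uniform_prob (pi_gt0 R)]_th (2 * sin th ^+ 2)).
  apply: eq_Rintegral => th _ /=.
  rewrite bounded_measurable_RintegralZ// i1.
  by transitivity (2 * sin th ^+ 2 * (pi / pi)); [ring|rewrite divff// mulr1].
by rewrite bounded_measurable_RintegralZ ?i2; [field|exact: bounded_measurableX].
Qed.

(** Rotations in the planes (2,3), (1,2) and (0,1) clear the coordinates 3, 2 and 1 in turn, each
    without restoring one already cleared; the last also makes coordinate 0 nonnegative. *)
Lemma mass_axis y : unit_ball R 4 y -> mass y = mass (enorm y *: delta_mx 0 ord0).
Proof.
move=> y1.
have ne a b : (a < 4)%N -> (b < 4)%N -> a != b -> inord a != inord b :> 'I_4.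
  by move=> a4 b4 ab; rewrite -val_eqE/= !inordK.
have n01 := ne 0%N 1%N isT isT isT; have n12 := ne 1%N 2%N isT isT isT.
have n23 := ne 2%N 3%N isT isT isT; have n02 := ne 0%N 2%N isT isT isT.
have n03 := ne 0%N 3%N isT isT isT; have n13 := ne 1%N 3%N isT isT isT.
have step i j x : i != j -> unit_ball R 4 x ->
    (forall x, unit_ball R 4 x -> \int[angles_prob]_w (angle_density w *
      ((x 0 i * sphere w 0 j - x 0 j * sphere w 0 i) * (sqdist x (sphere w))^-1 ^+ 3)) = 0) ->
    exists x', [/\ mass x' = mass x, dotv x' x' = dotv x x,
      0 <= x' 0 i, x' 0 j = 0 & forall k, k != i -> k != j -> x' 0 k = x 0 k].
  move=> ij x1 kill; have [t [h1 h2]] := polar_angle (x 0 i) (x 0 j).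
  have /negPf ji : j != i by rewrite eq_sym.
  exists (plane_rot i j t x); rewrite mass_plane_rot// dotv_plane_rot_self//.
  split => //; rewrite ?mxE ?eqxx ?ji ?h1 ?h2 ?sqrtr_ge0//.
  by move=> k /negPf ki /negPf kj; rewrite mxE ki kj.
have [x2 [m2 d2 _ z23 e2]] := step _ _ y n23 y1 (@killing23 R).
have x21 : unit_ball R 4 x2 by apply/unit_ballE; rewrite d2; exact/unit_ballE.
have [x3 [m3 d3 _ z32 e3]] := step _ _ x2 n12 x21 (@killing12 R).
have x31 : unit_ball R 4 x3 by apply/unit_ballE; rewrite d3; exact/unit_ballE.
have [x4 [m4 d4 p4 z41 e4]] := step _ _ x3 n01 x31 (@killing01 R).
rewrite -m2 -m3 -m4; congr mass.
have z42 : x4 0 (inord 2) = 0 by rewrite e4// eq_sym.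
have z43 : x4 0 (inord 3) = 0.
  by rewrite e4 ?e3//; rewrite eq_sym.
have E : enorm y = x4 0 (inord 0).
  rewrite enormE -d2 -d3 -d4 /dotv sum_ord4 z41 z42 z43 !mulr0 !addr0.
  by rewrite -expr2 sqrtr_sqr ger0_norm.
have i0 : ord0 = inord 0 :> 'I_4 by apply: val_inj; rewrite /= inordK.
apply/rowP => k; rewrite E !mxE eqxx/= i0.
have : k \in [:: inord 0; inord 1; inord 2; inord 3 : 'I_4].
  rewrite !inE -!val_eqE/= !inordK//; case: k => [[|[|[|[|//]]]] ] //.
rewrite !inE => /or4P[]/eqP->; rewrite ?eqxx ?mulr1//.
- by rewrite z41 eq_sym (negPf n01) mulr0.
- by rewrite z42 eq_sym (negPf n02) mulr0.
- by rewrite z43 eq_sym (negPf n03) mulr0.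
Qed.

(* A function harmonic in the ball and constant on spheres is constant, by the
   maximum principle. *)
Lemma poisson_mass y : unit_ball R 4 y ->
  poisson_int angles_prob sphere angle_density y = 1.
Proof.
move=> y1; rewrite -/(mass y).
have bn : bounded_measurable (fun w => - angle_density w : R).
  exact: bounded_measurableN.
have h1 := harmonic_poisson_int angles_prob z1 mz bdens.
have h2 := harmonic_poisson_int angles_prob z1 mz bn.
have massN x : unit_ball R 4 x -> poisson_int angles_prob sphere (fun w => - angle_density w) x = - mass x.
  move=> x1; rewrite /mass /poisson_int -mulN1r -bounded_measurable_RintegralZ.
    by apply: eq_Rintegral => w _; rewrite mulN1r mulNr.
  by apply: bounded_measurableM => //; exact: bounded_measurable_poisson.
have sB z : enorm z <= enorm y -> unit_ball R 4 z.
  by move=> zy; exact: le_lt_trans y1.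
have cs z : enorm z = enorm y -> mass z = mass y.
  by move=> zy; rewrite (mass_axis y1) mass_axis ?zy//; apply: sB; rewrite zy.
have z0 : enorm (0 : 'rV[R]_4) <= enorm y.
  by rewrite [enorm 0]enormE dotv0l sqrtr0 enorm_ge0.
have le1 : mass 0 <= mass y.
  apply: (@maximum_principle R 4 isT _ _ (enorm y) (mass y) h1) => // z zy.
  by rewrite -/(mass z) cs.
have le2 : mass y <= mass 0.
  rewrite -lerN2 -massN; last exact: sB.
  apply: (@maximum_principle R 4 isT _ _ (enorm y) (- mass y) h2) => // z zy.
  by rewrite massN ?cs//; apply: sB; rewrite zy.
have -> : mass y = mass 0 by apply/eqP; rewrite eq_le le1 le2.
rewrite -Rintegral_angle_density1; apply: eq_Rintegral => w _.
by rewrite /poisson /sqdist !dotv0l mulr0 !subr0 addr0 invr1 expr1n !mulr1.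
Qed.

End Mass.

(** * Reduction to axial points *)

Section Frames.
Context {R : realType}.
Implicit Types (x y z l : 'rV[R]_4) (i j k : 'I_4) (p q : 'rV[R]_4 -> 'rV[R]_4).

(** An orthogonal map [p] and its transpose [q], encoded by dot products because the kernels see
    vectors only through these. *)
Definition adjoint_isometries p q :=
  [/\ forall y z, dotv (p y) z = dotv y (q z),
      forall y z, dotv (p y) (p z) = dotv y z &
      forall y z, dotv (q y) (q z) = dotv y z].

Lemma dotv_plane_rot2 i j t y z : i != j ->
  dotv (plane_rot i j t y) (plane_rot i j t z) = dotv y z.
Proof.
move=> ij; have /negPf ji : j != i by rewrite eq_sym.
rewrite dotv_plane_rot// (dotvC y) dotv_plane_rot// (dotvC z) !mxE !eqxx ji.
have := cos2Dsin2 t => /(canRL (addrK _)); set c := cos t; set s := sin t.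
move=> h; transitivity (dotv y z +
  (c ^+ 2 + s ^+ 2 - 1) * (y 0 i * z 0 i + y 0 j * z 0 j)); first by ring.
by rewrite h; ring.
Qed.

Lemma plane_rot_isometries i j t : i != j ->
  adjoint_isometries (plane_rot i j t) (plane_rot i j (- t)).
Proof.
move=> ij; split => y z; [|exact: dotv_plane_rot2..].
by rewrite dotv_plane_rot// [RHS]dotvC dotv_plane_rot// cosN sinN (dotvC z); ring.
Qed.

Lemma adjoint_isometries_comp p q p' q' : adjoint_isometries p q ->
  adjoint_isometries p' q' -> adjoint_isometries (p' \o p) (q \o q').
Proof.
move=> [h1 h2 h3] [g1 g2 g3].
by split => y z /=; [rewrite g1 h1|rewrite g2 h2|rewrite h3 g3].
Qed.

Lemma dotv_inj x y : (forall z, dotv x z = dotv y z) -> x = y.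
Proof. by move=> h; apply/rowP => i; rewrite -!dotv_delta h. Qed.

Lemma adjoint_isometriesK p q : adjoint_isometries p q -> cancel q p.
Proof. by move=> [h1 h2 h3] y; apply: dotv_inj => z; rewrite h1 h3. Qed.

Lemma plane_rot_align i j y : i != j -> exists p q, [/\ adjoint_isometries p q,
  0 <= p y 0 i, p y 0 j = 0, (forall k, k != i -> k != j -> p y 0 k = y 0 k) &
  forall z, z 0 i = 0 -> z 0 j = 0 -> p z = z].
Proof.
move=> ij; have [t [h1 h2]] := polar_angle (y 0 i) (y 0 j).
have /negPf ji : j != i by rewrite eq_sym.
exists (plane_rot i j t), (plane_rot i j (- t)); split.
- exact: plane_rot_isometries.
- by rewrite mxE eqxx h1 sqrtr_ge0.
- by rewrite mxE eqxx ji h2.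
- by move=> k /negPf ki /negPf kj; rewrite mxE ki kj.
- move=> z zi zj; apply/rowP => k; rewrite mxE zi zj !mulr0 subr0 addr0.
  by case: eqP => [->|_] //; case: eqP => [->|].
Qed.

Let e k : 'rV[R]_4 := delta_mx 0 (inord k).

(** Three rotations bring [x] onto the first axis. Two more, in the planes (2,3) and (1,2), fix that
    axis and bring the image of [l] into the span of the first two basis vectors. *)
Lemma adapted_frame x l : exists p q, [/\ adjoint_isometries p q,
  p x = enorm x *: e 0 & exists c s, p l = c *: e 0 + s *: e 1].
Proof.
have ne a b : (a < 4)%N -> (b < 4)%N -> a != b -> inord a != inord b :> 'I_4.
  by move=> a4 b4 ab; rewrite -val_eqE/= !inordK.
have n01 := ne 0%N 1%N isT isT isT; have n12 := ne 1%N 2%N isT isT isT.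
have n23 := ne 2%N 3%N isT isT isT; have n02 := ne 0%N 2%N isT isT isT.
have n03 := ne 0%N 3%N isT isT isT; have n13 := ne 1%N 3%N isT isT isT.
have rowE (y : 'rV[R]_4) : y 0 (inord 2) = 0 -> y 0 (inord 3) = 0 ->
    y = y 0 (inord 0) *: e 0 + y 0 (inord 1) *: e 1.
  move=> y2 y3; apply/rowP => k; rewrite !mxE eqxx/=.
  have : k \in [:: inord 0; inord 1; inord 2; inord 3 : 'I_4].
    by rewrite !inE -!val_eqE/= !inordK//; case: k => [[|[|[|[|//]]]] ].
  rewrite !inE => /or4P[]/eqP->; rewrite ?eqxx ?mulr1//.
  - by rewrite (negPf n01) mulr0 addr0.
  - by rewrite eq_sym (negPf n01) mulr0 add0r.
  - by rewrite y2 eq_sym (negPf n02) eq_sym (negPf n12) !mulr0 addr0.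
  - by rewrite y3 eq_sym (negPf n03) eq_sym (negPf n13) !mulr0 addr0.
have [p1 [q1 [a1 _ x13 e1 _]]] := plane_rot_align x n23.
have [p2 [q2 [a2 _ x22 e2 _]]] := plane_rot_align (p1 x) n12.
have [p3 [q3 [a3 x30 x31 e3 _]]] := plane_rot_align (p2 (p1 x)) n01.
pose p := p3 \o (p2 \o p1); pose q := (q1 \o q2) \o q3.
have a : adjoint_isometries p q.
  by apply: adjoint_isometries_comp => //; exact: adjoint_isometries_comp.
have px : p x = enorm x *: e 0.
  have z2 : p x 0 (inord 2) = 0 by rewrite /p/= e3// eq_sym.
  have z3 : p x 0 (inord 3) = 0 by rewrite /p/= e3 ?e2// eq_sym.
  have := rowE _ z2 z3; rewrite [X in _ + X *: _]x31 scale0r addr0.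
  have : 0 <= p x 0 (inord 0) by [].
  move: (p x 0 (inord 0)) => t t0 E; have [_ h _] := a.
  rewrite enormE -h E !(dotvZl, dotvZr) /e dotv_delta mxE !eqxx/= mulr1.
  by rewrite -expr2 sqrtr_sqr ger0_norm.
have [p4 [q4 [a4 _ l43 e4 f4]]] := plane_rot_align (p l) n23.
have [p5 [q5 [a5 _ l52 e5 f5]]] := plane_rot_align (p4 (p l)) n12.
exists (p5 \o (p4 \o p)), ((q \o q4) \o q5); split.
- by apply: adjoint_isometries_comp => //; exact: adjoint_isometries_comp.
- have z k : k != inord 0 -> (p x) 0 k = 0.
    by move=> k0; rewrite px !mxE (negPf k0) andbF mulr0.
  by rewrite /= f4 ?f5 ?z// eq_sym.
- exists (p5 (p4 (p l)) 0 (inord 0)), (p5 (p4 (p l)) 0 (inord 1)).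
  apply: rowE => //=; rewrite e5 ?l43//; rewrite eq_sym//.
Qed.

Definition axial_gradient_mass (r c s : R) : R :=
  gradient_mass angles_prob sphere angle_density (r *: e 0) (c *: e 0 + s *: e 1).

Section Transport.
Variables p q : 'rV[R]_4 -> 'rV[R]_4.
Hypothesis pq : adjoint_isometries p q.
Let zeta w := q (@sphere R w).

Lemma frame_sphere1 w : dotv (zeta w) (zeta w) = 1.
Proof. by have [_ _ h] := pq; rewrite h dotv_sphere_sphere. Qed.

Lemma measurable_frame_sphere i : measurable_fun setT (fun w => zeta w 0 i).
Proof.
have [h _ _] := pq.
rewrite (_ : (fun w => _) = fun w => dotv (p (delta_mx 0 i)) (sphere w)).
  have [] // := bounded_measurable_dotv (@dotv_sphere_sphere R) (@measurable_sphere R)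
    (p (delta_mx 0 i)).
by apply/funext => w; rewrite h dotvC dotv_delta.
Qed.

(** Rotating the parametrization by [q] amounts to moving the point by [p], since
    [dotv y (q z) = dotv (p y) z]. This replaces invariance of the surface measure under
    rotations. *)
Lemma frame_mass1 y : unit_ball R 4 y ->
  poisson_int angles_prob zeta angle_density y = 1.
Proof.
have [h1 h2 h3] := pq => y1; rewrite -(@poisson_mass R (p y)); last first.
  by apply/unit_ballE; rewrite h2; exact/unit_ballE.
by apply: eq_Rintegral => w _; rewrite /poisson /sqdist h2 h1.
Qed.

Lemma frame_gradient_mass y l : gradient_mass angles_prob zeta angle_density y l =
  gradient_mass angles_prob sphere angle_density (p y) (p l).
Proof.
have [h1 h2 h3] := pq.
by apply: eq_Rintegral => w _; rewrite /poisson1 /sqdist !h2 !h1.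
Qed.

End Transport.

Lemma bounded_harmonic_le_sup_norm u y : bounded_harmonic u -> unit_ball R 4 y ->
  `|u y| <= sup_norm (unit_ball R 4) u.
Proof.
move=> [_ [M [_ hM]]] y1; apply: ub_le_sup; last by exists y.
by exists (M + 1) => _ [z z1 <-]; apply: hM => //; rewrite ltrDl.
Qed.

(** The norm of the gradient is its component along its own unit direction [l], to which
    [gradient_dotv_le] applies in a frame adapted to [x] and [l]. *)
Lemma enorm_gradient_le x K u : unit_ball R 4 x -> bounded_harmonic u ->
  (forall c s, c ^+ 2 + s ^+ 2 = 1 -> axial_gradient_mass (enorm x) c s <= K) ->
  enorm (gradient u x) <= K * sup_norm (unit_ball R 4) u.
Proof.
move=> x1 uh hK; set g := gradient u x; set M := sup_norm _ _.
have M0 : 0 <= M.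
  by apply: le_trans (bounded_harmonic_le_sup_norm uh x1).
(* A zero gradient has no direction; there it suffices that K >= 0, which holds because [K] bounds
   an integral of a nonnegative function. *)
have [g0|g0] := eqVneq (enorm g) 0.
  rewrite g0 mulr_ge0//; apply: le_trans (hK 1 0 _); last by rewrite expr1n expr0n addr0.
  by apply: Rintegral_ge0 => w _; rewrite mulr_ge0// angle_density_ge0.
pose l := (enorm g)^-1 *: g.
have l1 : dotv l l = 1.
  by rewrite dotvZl dotvZr -enorm_sqr; field.
have [p [q [pq px [c [s pl]]]]] := adapted_frame x l.
have := @gradient_dotv_le _ _ _ angles_prob _ (frame_sphere1 pq)
  (measurable_frame_sphere pq) _ (@bounded_measurable_angle_density R)
  (@angle_density_ge0 R) (frame_mass1 pq) u M x l.
have [uharm _] := uh.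
move=> /(_ uharm (fun y => bounded_harmonic_le_sup_norm uh) x1).
rewrite (frame_gradient_mass pq) px pl -/(axial_gradient_mass (enorm x) c s).
have -> : dotv g l = enorm g by rewrite dotvZr -enorm_sqr; field.
move=> h; apply: le_trans h _; rewrite mulrC ler_wpM2r// hK//.
have [_ h2 _] := pq; rewrite -l1 -h2 pl.
have n10 : (inord 1 == inord 0 :> 'I_4) = false by rewrite -val_eqE/= !inordK.
have n01 : (inord 0 == inord 1 :> 'I_4) = false by rewrite eq_sym.
rewrite !(dotvDl, dotvDr, dotvZl, dotvZr) /e !dotv_delta !mxE !eqxx n10 n01/=; ring.
Qed.

(** The test function is the extremal one for the direction that the frame sends to the first axis,
    the radial one when [x] is not 0. *)
Lemma axial_gradient_mass_le x C : unit_ball R 4 x ->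
  (forall u, bounded_harmonic u ->
    enorm (gradient u x) <= C * sup_norm (unit_ball R 4) u) ->
  axial_gradient_mass (enorm x) 1 0 <= C.
Proof.
move=> x1 hC; have [p [q [pq px _]]] := adapted_frame x 0.
pose l := q (e 0).
have pl : p l = 1 *: e 0 + 0 *: e 1.
  by rewrite scale1r scale0r addr0 /l (adjoint_isometriesK pq).
have [u [uh u1 ul]] := exists_gradient_mass (frame_sphere1 pq)
  (measurable_frame_sphere pq) (@bounded_measurable_angle_density R)
  (@angle_density_ge0 R) (frame_mass1 pq) l x1.
have ub : bounded_harmonic u.
  split => //; exists 1; split; first exact: num_real.
  by move=> M M1 y /u1 h /=; rewrite (le_trans h)// ltW.
move: ul; rewrite (frame_gradient_mass pq) px pl -/(axial_gradient_mass (enorm x) 1 0).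
have l1 : enorm l = 1.
  have [_ _ h3] := pq.
  by rewrite enormE h3 /e dotv_delta mxE !eqxx sqrtr1.
move=> <-; have := dotv_le (gradient u x) l; rewrite l1 mulr1 => h.
apply: le_trans h _; apply: (le_trans (hC u ub)).
have S0 : 0 <= sup_norm (unit_ball R 4) u.
  exact: le_trans (bounded_harmonic_le_sup_norm ub x1).
have S1 : sup_norm (unit_ball R 4) u <= 1.
  by apply: ge_sup; [exists `|u x|; exists x|move=> _ [y y1 <-]; exact: u1].
(* The supremum of the test function is only known to be at most 1, so the sign of [C] matters. It
   is obtained from the function equal to 1 on the ball, written as a Poisson integral. *)
have C0 : 0 <= C.
  have cb : bounded_harmonic (poisson_int angles_prob (fun w => q (sphere w)) angle_density).
    split; first exact: (harmonic_poisson_int _ (frame_sphere1 pq)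
      (measurable_frame_sphere pq) (@bounded_measurable_angle_density R)).
    exists 1; split; first exact: num_real.
    by move=> M M1 y y1 /=; rewrite (frame_mass1 pq)// normr1 ltW.
  rewrite leNgt; apply/negP => C0; have := hC _ cb; apply/negP; rewrite -ltNge.
  apply: lt_le_trans (enorm_ge0 _); rewrite nmulr_rlt0//.
  apply: lt_le_trans (bounded_harmonic_le_sup_norm cb x1).
  by rewrite (frame_mass1 pq)// normr1.
by rewrite -[leRHS]mulr1 ler_wpM2l.
Qed.

End Frames.

(** * The radial direction *)

Section AbsoluteSquare.
Context {R : realType}.

(** A C^1 primitive of 2 |t|: integrals of absolute values of affine expressions are then computed
    without locating their zeros. *)
Lemma is_derive_absq (x : R) : is_derive x 1 (fun t : R => t * `|t|) (2 * `|x|).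
Proof.
have sq c : is_derive x 1 (fun t : R => c * t ^+ 2) (c * (2 * x)).
  apply: is_derive_cmul; apply: (is_derive_eq (is_derive_pow 1 (is_derive_id x 1))).
  by rewrite expr1 mulr1.
have [x0|x0|->] := ltgtP x 0.
- apply: (@near_eq_is_derive _ _ _ (fun t : R => -1 * t ^+ 2)).
    near=> t; have t0 : t < 0 by near: t; exact: lt_nbhsl.
    by rewrite ltr0_norm//; ring.
  by apply: (is_derive_eq (sq _)); rewrite ltr0_norm//; ring.
- apply: (@near_eq_is_derive _ _ _ (fun t : R => 1 * t ^+ 2)).
    near=> t; have t0 : 0 < t by near: t; exact: lt_nbhsr.
    by rewrite gtr0_norm//; ring.
  by apply: (is_derive_eq (sq _)); rewrite gtr0_norm//; ring.
- rewrite normr0 mulr0; apply: is_derive_lim.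
  apply: (@cvg_trans _ ((fun h : R => `|h|) @ 0^')).
    apply: near_eq_cvg; near=> h.
    have h0 : h != 0 by near: h; exact: nbhs_dnbhs_neq.
    by rewrite /= add0r mul0r subr0 /GRing.scale/= mulr1 mulKf.
  have : (fun h : R => `|h|) @ (0 : R) --> `|0 : R| by exact: norm_continuous.
  by rewrite normr0; exact: cvg_within_filter.
Unshelve. all: by end_near. Qed.

Lemma is_derive_comp (f g : R -> R) (x df dg : R) :
  is_derive (g x) 1 f df -> is_derive x 1 g dg ->
  is_derive x 1 (fun t => f (g t)) (df * dg).
Proof. by move=> fd gd; exact: (is_derive1_comp fd gd). Qed.

(** The factor [b] on the left avoids a division; b = 0 carries no information here and is the
    subject of the next lemma. *)
Lemma integral_abs_affine_cos (a b : R) :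
  b * \int[lebesgue_measure]_(t in `[0, pi]) (sin t * `|a + b * cos t|) =
  ((a + b) * `|a + b| - (a - b) * `|a - b|) / 2.
Proof.
have Fd (t : R) : is_derive t 1 (fun t => - (2^-1 * ((a + b * cos t) * `|a + b * cos t|)))
    (b * (sin t * `|a + b * cos t|)).
  have h := @is_derive_comp (fun u => u * `|u|) (fun t => a + b * cos t) t _ _
    (is_derive_absq (a + b * cos t)) (is_derive_add (is_derive_const a t 1) (is_derive_cmul b (is_derive_cos t))).
  by apply: (is_derive_eq (is_deriveN (is_derive_cmul 2^-1 h))); field.
have cabs : continuous (fun t : R => `|a + b * cos t|).
  move=> t; apply: cvg_norm; apply: cvgD; first exact: cvg_cst.
  by apply: cvgM; [exact: cvg_cst|exact: continuous_cos].
have cf : continuous (fun t : R => sin t * `|a + b * cos t|).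
  by move=> t; apply: cvgM; [exact: continuous_sin|exact: cabs].
rewrite -RintegralZl//; last first.
  apply: continuous_compact_integrable; first exact: segment_compact.
  exact: continuous_subspaceT.
rewrite (Rintegral_derive (pi_gt0 R) (fun t _ => Fd t)); last first.
  by apply: continuous_subspaceT => t; apply: cvgM; [exact: cvg_cst|exact: cf].
by rewrite cospi cos0 mulrN1 mulr1; field.
Qed.

Lemma integral_abs_cst_sin (a : R) :
  \int[lebesgue_measure]_(t in `[0, pi]) (sin t * `|a + 0 * cos t|) = 2 * `|a|.
Proof.
under eq_Rintegral do rewrite mul0r addr0 mulrC.
have Fd (t : R) : is_derive t 1 (fun t => - (`|a| * cos t)) (`|a| * sin t).
  by apply: (is_derive_eq (is_deriveN (is_derive_cmul _ (is_derive_cos t)))); ring.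
rewrite (Rintegral_derive (pi_gt0 R) (fun t _ => Fd t)); last first.
  by apply: continuous_subspaceT => t; apply: cvgM; [exact: cvg_cst|exact: continuous_sin].
by rewrite cospi cos0; ring.
Qed.

End AbsoluteSquare.

Section AxialIntegral.
Context {R : realType}.
Implicit Types r c s th : R.

Definition axial_sqdist r th : R := 1 + r ^+ 2 - 2 * r * cos th.

(* The radial derivative of the Poisson kernel at r e_0 changes sign where this vanishes. *)
Definition axial_height r th : R := cos th - r * (3 - r ^+ 2) / 2.

(** With u = cos t this is the integral of |a + b u| over [-1, 1]: the second angle enters the
    kernel derivative through its cosine, and sin t comes from the density. *)
Definition abs_mean (a b : R) : R :=
  \int[lebesgue_measure]_(t in `[0, pi]) (sin t * `|a + b * cos t|).

Lemma axial_sqdist_gt0 r th : 0 <= r -> r < 1 -> 0 < axial_sqdist r th.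
Proof.
move=> r0 r1; have := cos_le1 th; rewrite /axial_sqdist => c1.
have : 0 <= r * (1 - cos th) by rewrite mulr_ge0// subr_ge0.
have : 0 < (1 - r) ^+ 2 by rewrite exprn_gt0// subr_gt0.
nra.
Qed.

Lemma poisson1_axial r c s w : 0 <= r -> r < 1 ->
  poisson1 (c *: delta_mx 0 (inord 0) + s *: delta_mx 0 (inord 1) : 'rV[R]_4)
    (r *: delta_mx 0 (inord 0)) (sphere w) =
  4 * (axial_sqdist r w.1.1)^-1 ^+ 3 * (c * axial_height r w.1.1
    + s * (1 - r ^+ 2) * sin w.1.1 * cos w.1.2).
Proof.
move=> r0 r1; have A0 := axial_sqdist_gt0 w.1.1 r0 r1.
have n10 : (inord 1 == inord 0 :> 'I_4) = false by rewrite -val_eqE/= !inordK.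
have n01 : (inord 0 == inord 1 :> 'I_4) = false by rewrite eq_sym.
have [z0 z1 _ _] := sphereE w.
rewrite /poisson1 /sqdist !(dotvDl, dotvDr, dotvZl, dotvZr).
rewrite !(dotvC _ (sphere w)) !dotv_delta z0 z1 !mxE !eqxx ?n10 ?n01/= !mulr1 !mulr0 !addr0.
rewrite -expr2 mulrA -/(axial_sqdist r w.1.1).
move: A0; rewrite /axial_height; set A := axial_sqdist _ _ => A0.
have -> : - 2 * (r * c) * A^-1 ^+ 2 = - 2 * (r * c) * A * A^-1 ^+ 3.
  by field; rewrite gt_eqF.
by rewrite /A /axial_sqdist; field; rewrite -/(axial_sqdist r w.1.1) gt_eqF.
Qed.

Definition axial_integrand r c s th : R :=
  4 * sin th ^+ 2 * (axial_sqdist r th)^-1 ^+ 3 *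
  abs_mean (c * axial_height r th) (s * (1 - r ^+ 2) * sin th).

Lemma axial_gradient_massE r c s : 0 <= r -> r < 1 ->
  bounded_measurable (axial_integrand r c s : measurableTypeR R -> R) /\
  axial_gradient_mass r c s =
    pi^-1 * \int[lebesgue_measure]_(th in `[0, pi]) axial_integrand r c s th.
Proof.
move=> r0 r1; rewrite /axial_gradient_mass /gradient_mass.
set y := r *: _; set l := _ + _.
have y1 : unit_ball R 4 y.
  apply/unit_ballE; rewrite dotvZl dotvZr dotv_delta mxE !eqxx mulr1.
  by rewrite -expr2 expr_lt1.
have bP := bounded_measurable_poisson1 (@dotv_sphere_sphere R) (@measurable_sphere R) l y1.
have bn := bounded_measurable_norm bP.
rewrite Rintegral_angle_density//.
pose K w := pi * sin w.1.1 ^+ 2 * sin w.1.2 * `|poisson1 l y (@sphere R w)|.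
have bK : bounded_measurable K.
  have [_ bs0 _ bs1 _] := @bounded_measurable_angles R.
  apply: bounded_measurableM => //; apply: bounded_measurableM => //.
  by apply: bounded_measurableZ; exact: bounded_measurableX.
have p0 : pi != 0 :> R by rewrite gt_eqF// pi_gt0.
rewrite -/(\int[angles_prob]_w K w) Rintegral_angles//.
pose h := axial_integrand r c s.
have inner th ph : \int[uniform_prob (pi_gt0 R)]_ps K ((th, ps), ph) = h th.
  have bK2 := bounded_measurable_section1 (bounded_measurable_section2 bK ph) th.
  rewrite Rintegral_uniform// subr0.
  transitivity (pi^-1 * \int[lebesgue_measure]_(ps in `[0, pi])
    (pi * 4 * sin th ^+ 2 * (axial_sqdist r th)^-1 ^+ 3 *
     (sin ps * `|c * axial_height r th + s * (1 - r ^+ 2) * sin th * cos ps|))).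
    congr (_ * _); apply: eq_Rintegral => ps _.
    rewrite /K poisson1_axial//= normrM ger0_norm; first by ring.
    by rewrite mulr_ge0// exprn_ge0// invr_ge0 ltW// axial_sqdist_gt0.
  rewrite RintegralZl//; last first.
    apply: continuous_compact_integrable; first exact: segment_compact.
    apply: continuous_subspaceT => t; apply: cvgM; first exact: continuous_sin.
    apply: cvg_norm; apply: cvgD; first exact: cvg_cst.
    by apply: cvgM; [exact: cvg_cst|exact: continuous_cos].
  by rewrite /h /axial_integrand -/(abs_mean _ _) -!mulrA mulKf.
have bh : bounded_measurable (h : measurableTypeR R -> R).
  have := bounded_measurable_Rintegral1 (uniform_prob (pi_gt0 R))
    (uniform_prob (pi_gt0 R)) (bounded_measurable_section2 bK 0).
  by congr bounded_measurable; apply/funext => th; rewrite -(inner th 0).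
split=> //.
transitivity (\int[uniform_prob twopi_gt0]_ph \int[uniform_prob (pi_gt0 R)]_th h th).
  by apply: eq_Rintegral => ph _; apply: eq_Rintegral => th _; rewrite inner.
by rewrite Rintegral_probability_cst Rintegral_uniform// subr0.
Qed.

End AxialIntegral.

Section RadialValue.
Context {R : realType}.
Variable r : R.
Hypothesis r0 : 0 < r.
Hypothesis r1 : r < 1.
Implicit Types th : R.

Let A th := axial_sqdist r th.
Let w th := axial_height r th.
Let z0 := r * (3 - r ^+ 2) / 2.
Let S := Num.sqrt (4 - r ^+ 2).

Let r2 : r ^+ 2 < 1. Proof. by rewrite expr_lt1// ltW. Qed.

Let A0 th : 0 < A th. Proof. exact: axial_sqdist_gt0 (ltW r0) r1. Qed.

(** A combination of sin / A^2, sin / A and the angle atan (r sin th / (1 - r cos th)). The latter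
    is minus the argument of 1 - r e^(i th), smooth for all [th] because r < 1; it is the source of
    the arctangent in the constant. *)
Definition radial_primitive th : R :=
  (- r * (1 - r ^+ 2) ^+ 2 * (sin th * (A th)^-1 ^+ 2)
   + r * (3 + r ^+ 2) * (sin th * (A th)^-1)
   - 2 * atan (r * sin th * (1 - r * cos th)^-1)) / (8 * r ^+ 3).

Lemma is_derive_radial_primitive th : is_derive th 1 radial_primitive
  (sin th ^+ 2 * w th * (A th)^-1 ^+ 3).
Proof.
have hs := is_derive_sin th; have hc := is_derive_cos th.
have k c := is_derive_const (c : R) th 1.
have B0 : 0 < 1 - r * cos th.
  by rewrite subr_gt0 (le_lt_trans _ r1)// ler_piMr ?cos_le1// ltW.
have hA := is_derive_sub (k (1 + r ^+ 2)) (is_derive_cmul (2 * r) hc).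
have hI := @is_derive_inv R _ A th 1 _ (lt0r_neq0 (A0 th)) hA.
have hB := is_derive_sub (k 1) (is_derive_cmul r hc).
have hBI := @is_derive_inv R _ (fun th => 1 - r * cos th) th 1 _ (lt0r_neq0 B0) hB.
have hu := is_derive_mul (is_derive_cmul r hs) hBI.
have hT := @is_derive_comp R atan (fun th => r * sin th * (1 - r * cos th)^-1) th _ _
  (is_derive1_atan _) hu.
have h1 := is_derive_cmul (- r * (1 - r ^+ 2) ^+ 2) (is_derive_mul hs (is_derive_pow 1 hI)).
have h2 := is_derive_cmul (r * (3 + r ^+ 2)) (is_derive_mul hs hI).
have h3 := is_derive_sub (is_derive_add h1 h2) (is_derive_cmul 2 hT).
apply: (is_derive_eq (is_derive_mul h3 (k (8 * r ^+ 3)^-1))).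
have := A0 th; rewrite /w /axial_height /A /axial_sqdist.
have := cos2Dsin2 th; move: B0; set c := cos th; set s := sin th.
move=> B0 cs AA.
have s2 : s ^+ 2 = 1 - c ^+ 2 by lra.
have B0' : 1 - r * c != 0 by rewrite gt_eqF.
have A0' : 1 + r ^+ 2 - 2 * r * c != 0 by rewrite gt_eqF.
have rn : r != 0 by rewrite gt_eqF.
have -> : (1 + (r * s / (1 - r * c)) ^+ 2)^-1 = (1 - r * c) ^+ 2 / (1 + r ^+ 2 - 2 * r * c).
  have -> : 1 + (r * s / (1 - r * c)) ^+ 2 =
      (1 + r ^+ 2 - 2 * r * c) / (1 - r * c) ^+ 2.
    by rewrite !exprMn s2; field.
  by rewrite invf_div.
rewrite !(mulr0, subr0, addr0, mul0r, add0r, sub0r, expr1).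
transitivity ((- r * (1 - r ^+ 2) ^+ 2 * (c / (1 + r ^+ 2 - 2 * r * c) ^+ 2
    - 4 * r * s ^+ 2 / (1 + r ^+ 2 - 2 * r * c) ^+ 3)
  + r * (3 + r ^+ 2) * (c / (1 + r ^+ 2 - 2 * r * c)
    - 2 * r * s ^+ 2 / (1 + r ^+ 2 - 2 * r * c) ^+ 2)
  - 2 * ((r * c * (1 - r * c) - r ^+ 2 * s ^+ 2) / (1 + r ^+ 2 - 2 * r * c))) / (8 * r ^+ 3)).
  by field; rewrite ?rn ?A0' ?B0'.
by rewrite s2; field; rewrite ?rn ?A0' ?B0'.
Qed.

Let z0_lt1 : -1 < z0 < 1.
Proof.
(* 2 - 2 z0 = (1 - r)^2 (2 + r), whence z0 < 1. *)
have h1 : 0 < (1 - r) ^+ 2 * (2 + r) by apply: mulr_gt0; [apply: exprn_gt0; rewrite subr_gt0|rewrite ltr_wpDl// ltW].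
have h2 : 0 < r * (3 - r ^+ 2) by apply: mulr_gt0 => //; have := r2; lra.
have h3 : (1 - r) ^+ 2 * (2 + r) = 2 - r * (3 - r ^+ 2) by ring.
by rewrite /z0; apply/andP; split; move: h1 h2; rewrite ?h3; lra.
Qed.

Let th0 := acos z0.

Let th0_itv : 0 < th0 < pi.
Proof.
by rewrite acos_gt0 ?acos_ltpi//; have /andP[h1 h2] := z0_lt1; rewrite ?h1 ?h2 ?ltW.
Qed.

Let cos_th0 : cos th0 = z0.
Proof. by rewrite acosK// in_itv/=; have /andP[/ltW-> /ltW->] := z0_lt1. Qed.

Let S0 : 0 < S. Proof. by rewrite sqrtr_gt0; have := r2; lra. Qed.

Let S2 : S ^+ 2 = 4 - r ^+ 2. Proof. by rewrite sqr_sqrtr//; have := r2; lra. Qed.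

Let d0 : 0 < 1 - r ^+ 2. Proof. by rewrite subr_gt0. Qed.

(** 1 - z0^2 = (1 - r^2)^2 (4 - r^2) / 4, which is the origin of the root of 4 - r^2 in the
    constant. *)
Let sin_th0 : sin th0 = (1 - r ^+ 2) * S / 2.
Proof.
rewrite sin_acos; last by have /andP[/ltW-> /ltW->] := z0_lt1.
rewrite (_ : 1 - z0 ^+ 2 = ((1 - r ^+ 2) * S / 2) ^+ 2).
  by rewrite sqrtr_sqr ger0_norm// divr_ge0// mulr_ge0// ltW.
by rewrite !exprMn S2 /z0; field.
Qed.

Lemma continuous_axial_weight :
  continuous (fun th => sin th ^+ 2 * w th * (A th)^-1 ^+ 3).
Proof.
have cA : continuous (fun th => (A th)^-1).
  move=> x; apply: cvgV; first by rewrite gt_eqF.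
  apply: cvgB; first exact: cvg_cst.
  by apply: cvgM; [exact: cvg_cst|exact: continuous_cos].
move=> x; apply: cvgM; last by do 2 (apply: cvgM; first exact: cA); exact: cA.
apply: cvgM; first by apply: cvgM; exact: continuous_sin.
by apply: cvgB; [exact: continuous_cos|exact: cvg_cst].
Qed.

(** At the sign change [A] equals (1 - r^2)^2 and 1 - r cos th0 equals (1 - r^2) (2 - r^2) / 2. The
    formula has r^2 - 2 under the arctangent, hence the appeal to its oddness. *)
Lemma radial_primitive_th0 : 16 / pi * radial_primitive th0 = khavinson4_formula r.
Proof.
have rn : r != 0 by rewrite gt_eqF.
have dn : 1 - r ^+ 2 != 0 by rewrite gt_eqF.
have en : 2 - r ^+ 2 != 0 by rewrite gt_eqF//; have := r2; lra.
have An : A th0 = (1 - r ^+ 2) ^+ 2.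
  by rewrite /A /axial_sqdist cos_th0 /z0; field.
rewrite /radial_primitive An sin_th0 cos_th0 /khavinson4_formula -/S.
have -> : r * ((1 - r ^+ 2) * S / 2) * (1 - r * z0)^-1 = r * S / (2 - r ^+ 2).
  rewrite (_ : 1 - r * z0 = (1 - r ^+ 2) * (2 - r ^+ 2) / 2); last by rewrite /z0; field.
  by field; rewrite dn en.
have -> : r * S / (r ^+ 2 - 2) = - (r * S / (2 - r ^+ 2)).
  by rewrite -[r ^+ 2 - 2]opprB invrN mulrN.
rewrite atanN; move: (atan _) (pi) (pi_gt0 R) => T p /lt0r_neq0 p0.
by field; rewrite p0 dn rn.
Qed.

(** The integrand changes sign once, at [th0], and its primitive vanishes at 0 and pi, so the
    integral of its absolute value is twice the primitive at [th0]. With the factor 8 of the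
    integrand this gives 16 / pi. *)
Lemma axial_gradient_mass_radial : axial_gradient_mass r 1 0 = khavinson4_formula r.
Proof.
have [_ ->] := axial_gradient_massE 1 0 (ltW r0) r1; rewrite -radial_primitive_th0.
pose f th := sin th ^+ 2 * w th * (A th)^-1 ^+ 3.
have fc : continuous f := continuous_axial_weight.
have cn : continuous (fun th => `|f th|) by move=> x; apply: cvg_norm; exact: fc.
have iL (a b : R) : lebesgue_measure.-integrable `[a, b] (EFin \o (fun th => `|f th|)).
  apply: continuous_compact_integrable; first exact: segment_compact.
  exact: continuous_subspaceT.
have AI0 th : 0 < (A th)^-1 ^+ 3 by rewrite exprn_gt0// invr_gt0.
transitivity (pi^-1 * \int[lebesgue_measure]_(th in `[0, pi]) (8 * `|f th|)).
  congr (_ * _); apply: eq_Rintegral => th _.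
  rewrite /axial_integrand /abs_mean !mul0r mul1r integral_abs_cst_sin /f.
  rewrite normrM (gtr0_norm (AI0 th)) normrM (ger0_norm (sqr_ge0 _)).
  by rewrite -/(A th) -/(w th); ring.
have /andP[t0 tpi] := th0_itv.
rewrite RintegralZl//.
have -> : \int[lebesgue_measure]_(th in `[0, pi]) `|f th| =
    \int[lebesgue_measure]_(th in `[0, th0]) `|f th| +
    \int[lebesgue_measure]_(th in `[th0, pi]) `|f th|.
  have := @Rintegral_itvB R (fun th => `|f th|) (BLeft 0) (BRight pi) th0 (iL 0 pi).
  rewrite !bnd_simp => /(_ (ltW t0) (ltW tpi)).
  rewrite Rintegral_itv_obnd_cbnd; first by move=> <-; rewrite addrC subrK.
  by apply: integrableS (iL th0 pi) => //; exact: subset_itv_oc_cc.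
have cosle a b : 0 <= a -> a <= b -> b <= pi -> cos b <= cos a.
  move=> h0 h1 h2; rewrite leNgt ltr_cos ?in_itv/= ?h0 ?h2 ?(le_trans h0) ?(le_trans h1)//.
  by rewrite -leNgt.
have fp th : 0 <= th -> th <= th0 -> `|f th| = f th.
  move=> h0 h1; rewrite ger0_norm// mulr_ge0 ?(ltW (AI0 _))// mulr_ge0 ?sqr_ge0//.
  by rewrite subr_ge0 -/z0 -cos_th0 cosle// ltW.
have fn th : th0 <= th -> th <= pi -> `|f th| = - f th.
  move=> h0 h1; rewrite ler0_norm// mulr_le0_ge0 ?(ltW (AI0 _))// mulr_ge0_le0 ?sqr_ge0//.
  by rewrite subr_le0 -/z0 -cos_th0 cosle// ltW.
have -> : \int[lebesgue_measure]_(th in `[0, th0]) `|f th| =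
    \int[lebesgue_measure]_(th in `[0, th0]) f th.
  by apply: eq_Rintegral => th; rewrite inE/= in_itv/= => /andP[h0 h1]; exact: fp.
have -> : \int[lebesgue_measure]_(th in `[th0, pi]) `|f th| =
    \int[lebesgue_measure]_(th in `[th0, pi]) (- f th).
  by apply: eq_Rintegral => th; rewrite inE/= in_itv/= => /andP[h0 h1]; exact: fn.
rewrite (Rintegral_derive t0 (fun th _ => is_derive_radial_primitive th)); last first.
  exact: continuous_subspaceT.
have dN th : is_derive th 1 (fun th => - radial_primitive th) (- f th).
  exact: is_deriveN (is_derive_radial_primitive th).
rewrite (Rintegral_derive tpi (fun th _ => dN th)); last first.
  by apply: continuous_subspaceT => x; apply: cvgN; exact: fc.
have W0 : radial_primitive 0 = 0.
  by rewrite /radial_primitive sin0 !(mulr0, mul0r) atan0 mulr0 subr0 addr0 mul0r.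
have Wpi : radial_primitive pi = 0.
  by rewrite /radial_primitive sinpi !(mulr0, mul0r) atan0 mulr0 subr0 addr0 mul0r.
rewrite W0 Wpi; ring.
Qed.

End RadialValue.

(** * The other directions *)

Lemma is_derive_ge0_le (R : realType) (f df : R -> R) (a b : R) : a <= b ->
  (forall x : R, a <= x <= b -> is_derive x 1 f (df x)) ->
  (forall x, a <= x <= b -> 0 <= df x) -> f a <= f b.
Proof.
move=> ab fd df0.
have [||c + E] := @MVT_segment R f df a b ab.
- by move=> x; rewrite in_itv/= => /andP[h1 h2]; apply: fd; rewrite !ltW.
- apply: derivable_within_continuous => x; rewrite in_itv/= => h.
  by have [] := fd x h.
rewrite in_itv/= => cab; rewrite -subr_ge0 E mulr_ge0 ?subr_ge0// df0//.
Qed.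

(** * Growth of the moment of a slice *)

Section MomentMonotone.
Context {R : realType}.
Variable r : R.
Hypothesis r0 : 0 < r.
Hypothesis r1 : r < 1.
Implicit Types a : R.

Let m := 2 - r ^+ 2.
Let S a := Num.sqrt (a ^+ 2 + (4 - r ^+ 2)).

Let r2 : r ^+ 2 < 1. Proof. by rewrite expr_lt1// ltW. Qed.

Let m1 : 1 < m. Proof. by rewrite /m; have := r2; lra. Qed.

Let mE : 4 - r ^+ 2 = m + 2. Proof. by rewrite /m; ring. Qed.

Let S0 a : 0 < S a.
Proof. by rewrite sqrtr_gt0 ltr_wpDl ?sqr_ge0//; have := r2; lra. Qed.

Let S2 a : S a ^+ 2 = a ^+ 2 + (m + 2).
Proof. by rewrite sqr_sqrtr ?mE// addr_ge0 ?sqr_ge0//; have := m1; lra. Qed.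

(* For a = r cos b this is 4 r^3 times the integral of [polar_weight] over the slice
   at b of [polar_region]. *)
Definition ray_moment a : R := a ^+ 3 * S a - a * S a
  + (ln (1 + a ^+ 2 + a * S a) - ln (1 + a ^+ 2 - a * S a)) / 2.

(** The derivative of [ray_moment] is a^2 E a. The arguments of the two logarithms have product 1 -
    m a^2, so their derivatives merge into one rational term over [S]. *)
Let E a : R := (4 * a ^+ 2 + 3 * m + 4 + m * (m + 1) * (1 - m * a ^+ 2)^-1) * (S a)^-1.

(** The worst case is a = r, where 1 - m r^2 = (1 - r^2)^2. *)
Let q_gt0 a : 0 <= a <= r -> 0 < 1 - m * a ^+ 2.
Proof.
move=> /andP[a0 ar]; rewrite subr_gt0.
have a2 : a ^+ 2 <= r ^+ 2 by rewrite ler_pXn2r// nnegrE ltW.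
have m0 : 0 <= m by have := m1; lra.
apply: le_lt_trans (ler_wpM2l m0 a2) _; rewrite -subr_gt0.
have -> : 1 - m * r ^+ 2 = (1 - r ^+ 2) ^+ 2 by rewrite /m; ring.
by rewrite exprn_gt0// subr_gt0.
Qed.

Lemma ray_log_gt0 a : 0 <= a <= r ->
  0 < 1 + a ^+ 2 + a * S a /\ 0 < 1 + a ^+ 2 - a * S a.
Proof.
move=> ar; have q0 := q_gt0 ar; have /andP[a0 _] := ar.
have P0 : 0 < 1 + a ^+ 2 + a * S a.
  by rewrite ltr_wpDr ?mulr_ge0// ?(ltW (S0 a))// ltr_wpDr ?sqr_ge0.
split=> //; rewrite -(pmulr_rgt0 _ P0).
have -> : (1 + a ^+ 2 + a * S a) * (1 + a ^+ 2 - a * S a) =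
  (1 + a ^+ 2) ^+ 2 - a ^+ 2 * S a ^+ 2 by ring.
by rewrite S2; have -> : (1 + a ^+ 2) ^+ 2 - a ^+ 2 * (a ^+ 2 + (m + 2))
  = 1 - m * a ^+ 2 by ring.
Qed.

Let is_derive_S a : is_derive a 1 S (a * (S a)^-1).
Proof.
have h : 0 < a ^+ 2 + (4 - r ^+ 2) by have := S0 a; rewrite sqrtr_gt0.
have h1 := is_derive_add (is_derive_pow 1 (is_derive_id a 1)) (is_derive_const (4 - r ^+ 2) a 1).
have h2 := @is_derive_comp R Num.sqrt (fun a => a ^+ 2 + (4 - r ^+ 2)) a _ _
  (is_derive1_sqrt h) h1.
apply: (is_derive_eq h2); rewrite -/(S a) expr1 addr0 invfM.
by field; rewrite gt_eqF.
Qed.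

Lemma is_derive_ray_moment a : 0 <= a <= r -> is_derive a 1 ray_moment (a ^+ 2 * E a).
Proof.
move=> ar; have [P0 N0] := ray_log_gt0 ar; have q0 := q_gt0 ar.
have hid := is_derive_id a (1 : R); have hS := is_derive_S a.
have hQ := is_derive_mul hid hS.
have hP := is_derive_add (is_derive_const 1 a 1) (is_derive_pow 1 hid).
have l1 := @is_derive_comp R (@ln R) (fun a => 1 + a ^+ 2 + a * S a) a _ _
  (is_derive1_ln P0) (is_derive_add hP hQ).
have l2 := @is_derive_comp R (@ln R) (fun a => 1 + a ^+ 2 - a * S a) a _ _
  (is_derive1_ln N0) (is_derive_sub hP hQ).
have h := is_derive_add (is_derive_sub (is_derive_mul (is_derive_pow 2 hid) hS) hQ)
  (is_derive_mul (is_derive_sub l1 l2) (is_derive_const 2^-1 a 1)).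
apply: (is_derive_eq h); rewrite /E.
have := S2 a; move: P0 N0 q0; move: (S0 a); set s := S a => s0 P0 N0 q0 s2.
have sn : s != 0 by rewrite gt_eqF.
have qn : 1 - m * a ^+ 2 != 0 by rewrite gt_eqF.
have PN : (1 + a ^+ 2 + a * s) * (1 + a ^+ 2 - a * s) = 1 - m * a ^+ 2.
  transitivity ((1 + a ^+ 2) ^+ 2 - a ^+ 2 * s ^+ 2); first by ring.
  by rewrite s2; ring.
have -> : (1 + a ^+ 2 + a * s)^-1 = (1 + a ^+ 2 - a * s) * (1 - m * a ^+ 2)^-1.
  by rewrite -PN; field; rewrite !gt_eqF.
have -> : (1 + a ^+ 2 - a * s)^-1 = (1 + a ^+ 2 + a * s) * (1 - m * a ^+ 2)^-1.
  by rewrite -PN; field; rewrite !gt_eqF.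
transitivity ((3 * a ^+ 2 * s ^+ 2 + a ^+ 4 - s ^+ 2 - a ^+ 2
  + ((s ^+ 2 + a ^+ 2) * (1 + a ^+ 2) - 2 * a ^+ 2 * s ^+ 2) * (1 - m * a ^+ 2)^-1) * s^-1).
  by field; rewrite qn sn.
by rewrite s2; field; rewrite qn sn.
Qed.

Let dE a := a * (S a)^-1 ^+ 3 *
  (4 * a ^+ 2 + 5 * m + 12 + m * (m + 1) * (1 - m * a ^+ 2)^-1 *
    (2 * m * (a ^+ 2 + m + 2) * (1 - m * a ^+ 2)^-1 - 1)).

Let is_derive_E a : 0 <= a <= r -> is_derive a 1 E (dE a).
Proof.
move=> ar; have q0 := q_gt0 ar.
have sn : S a != 0 by rewrite gt_eqF.
have qn : 1 - m * a ^+ 2 != 0 by rewrite gt_eqF.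
have hid := is_derive_id a (1 : R); have h2 := is_derive_pow 1 hid.
have k c := is_derive_const (c : R) a 1.
have hq := @is_derive_inv R _ (fun a => 1 - m * a ^+ 2) a 1 _ qn
  (is_derive_sub (k 1) (is_derive_cmul m h2)).
have hSI := @is_derive_inv R _ S a 1 _ sn (is_derive_S a).
have h := is_derive_mul (is_derive_add (is_derive_add (is_derive_add
  (is_derive_cmul 4 h2) (k (3 * m))) (k 4)) (is_derive_cmul (m * (m + 1)) hq)) hSI.
apply: (is_derive_eq h); rewrite /dE; have := S2 a; move: sn; set s := S a => sn s2.
transitivity (a * s^-1 ^+ 3 * ((8 + 2 * m ^+ 2 * (m + 1) * (1 - m * a ^+ 2)^-1 ^+ 2) * s ^+ 2
  - (4 * a ^+ 2 + 3 * m + 4 + m * (m + 1) * (1 - m * a ^+ 2)^-1))).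
  by field; rewrite qn sn.
by rewrite s2; field; rewrite qn sn.
Qed.

(** The only negative contribution is the -1 of the last bracket; it is absorbed because (1 - m
    a^2)^-1 >= 1 and m > 1. *)
Let dE_ge0 a : 0 <= a <= r -> 0 <= dE a.
Proof.
move=> ar; have q0 := q_gt0 ar; have /andP[a0 _] := ar.
have m0 : 0 < m by have := m1; lra.
have q1 : 1 <= (1 - m * a ^+ 2)^-1.
  by rewrite invf_ge1// gerBl mulr_ge0// ?sqr_ge0// ltW.
have b0 := sqr_ge0 a.
apply: mulr_ge0; first by rewrite mulr_ge0// exprn_ge0// invr_ge0 ltW.
apply: addr_ge0; first by lra.
apply: mulr_ge0; first by rewrite mulr_ge0// ?invr_ge0 ?(ltW q0)// mulr_ge0//; lra.
have h : 1 <= 2 * m * (a ^+ 2 + m + 2) by have := m1; nra.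
by rewrite subr_ge0 (le_trans h)// ler_peMr// (le_trans ler01 h).
Qed.

(** The derivative of J / x^3, with J for [ray_moment], is (x^3 E - 3 J) / x^4. The numerator
    vanishes at 0 and has derivative x^3 E', the terms 3 x^2 E cancelling, so monotonicity of E
    suffices. *)
Lemma ray_moment_div_cube_le a b : 0 < a -> a <= b -> b <= r ->
  ray_moment a / a ^+ 3 <= ray_moment b / b ^+ 3.
Proof.
move=> a0 ab br.
have itv x : a <= x <= b -> 0 <= x <= r.
  by move=> /andP[ax xb]; rewrite (le_trans (ltW a0) ax) (le_trans xb br).
have gap x : 0 <= x <= r -> 0 <= x ^+ 3 * E x - 3 * ray_moment x.
  move=> /andP[x0 xr].
  have J0 : ray_moment 0 = 0.
    by rewrite /ray_moment expr0n/= !mul0r expr0n/= !addr0 !subr0 subrr mul0r addr0.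
  suff : 0 ^+ 3 * E 0 - 3 * ray_moment 0 <= x ^+ 3 * E x - 3 * ray_moment x.
    by rewrite J0 expr0n/= mul0r mulr0 subr0.
  have D (y : R) : 0 <= y <= x ->
      is_derive y 1 (fun y => y ^+ 3 * E y - 3 * ray_moment y) (y ^+ 3 * dE y).
    move=> /andP[y0 yx]; have yr : 0 <= y <= r by rewrite y0 (le_trans yx).
    have h := is_derive_sub (is_derive_mul (is_derive_pow 2 (is_derive_id y 1))
      (is_derive_E yr)) (is_derive_cmul 3 (is_derive_ray_moment yr)).
    by apply: (is_derive_eq h); move: (E y) (dE y) => e e'; ring.
  have P y : 0 <= y <= x -> 0 <= y ^+ 3 * dE y.
    move=> /andP[y0 yx]; apply: mulr_ge0; first exact: exprn_ge0.
    by apply: dE_ge0; rewrite y0 (le_trans yx).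
  exact: (is_derive_ge0_le x0 D P).
have D (x : R) : a <= x <= b -> is_derive x 1 (fun x => ray_moment x / x ^+ 3)
    (x^-1 ^+ 4 * (x ^+ 3 * E x - 3 * ray_moment x)).
  move=> xab; have xr := itv _ xab.
  have x0 : 0 < x by have /andP[h _] := xab; exact: lt_le_trans h.
  have xn : x != 0 by rewrite gt_eqF.
  have x3 : x ^+ 3 != 0 by rewrite gt_eqF// exprn_gt0.
  have h := is_derive_mul (is_derive_ray_moment xr)
    (@is_derive_inv R R (fun x => x ^+ 3) x 1 _ x3 (is_derive_pow 2 (is_derive_id x 1))).
  apply: (is_derive_eq h); move: (E x) (ray_moment x) => e j; field.
  by rewrite xn.
have P x : a <= x <= b -> 0 <= x^-1 ^+ 4 * (x ^+ 3 * E x - 3 * ray_moment x).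
  move=> xab; have xr := itv _ xab; have /andP[x0 _] := xr.
  apply: mulr_ge0; last exact: gap.
  by apply: exprn_ge0; rewrite invr_ge0.
exact: (is_derive_ge0_le ab D P).
Qed.

End MomentMonotone.

(** * The weight of a direction and its rearrangement *)

Section RayWeight.
Context {R : realType}.
Local Notation mu := (@lebesgue_measure R).

Lemma Rintegral_split (f : R -> R) (a b c : R) : a <= c -> c <= b -> continuous f ->
  \int[mu]_(x in `[a, b]) f x =
  \int[mu]_(x in `[a, c]) f x + \int[mu]_(x in `[c, b]) f x.
Proof.
move=> ac cb fc.
have iL (x y : R) : mu.-integrable `[x, y] (EFin \o f).
  apply: continuous_compact_integrable; first exact: segment_compact.
  exact: continuous_subspaceT.
have := @Rintegral_itvB R f (BLeft a) (BRight b) c (iL a b).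
rewrite !bnd_simp => /(_ ac cb).
rewrite Rintegral_itv_obnd_cbnd; first by move=> <-; rewrite addrC subrK.
by apply: integrableS (iL c b) => //; exact: subset_itv_oc_cc.
Qed.

Lemma Rintegral_derive_le (f F : R -> R) (a b : R) : a <= b ->
  (forall x : R, is_derive x 1 F (f x)) -> continuous f ->
  \int[mu]_(x in `[a, b]) f x = F b - F a.
Proof.
move=> + Fd fc; rewrite le_eqVlt => /predU1P[->|ab].
  by rewrite set_itv1 Rintegral_set1 subrr.
by apply: Rintegral_derive => //; exact: continuous_subspaceT.
Qed.

(** The mean of |c cos b + s sin b| over the angles b and -b, which arises from folding the
    symmetric range of the second angle onto b >= 0. *)
Definition ray_weight (c s b : R) : R :=
  (`|c * cos b + s * sin b| + `|c * cos b - s * sin b|) / 2.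

Lemma ray_weight_max c s b : 0 <= cos b -> 0 <= sin b ->
  ray_weight c s b = Num.max (`|c| * cos b) (`|s| * sin b).
Proof.
move=> c0 s0; rewrite /ray_weight.
have -> : `|c| * cos b = `|c * cos b| by rewrite normrM (ger0_norm c0).
have -> : `|s| * sin b = `|s * sin b| by rewrite normrM (ger0_norm s0).
move: (c * _) (s * _) => x y.
have [h|h] := leP `|x| `|y|; move: h.
  by case: (ger0P x) => hx; case: (ger0P y) => hy;
    case: (ger0P (x + y)) => hp; case: (ger0P (x - y)) => hm; lra.
by case: (ger0P x) => hx; case: (ger0P y) => hy;
    case: (ger0P (x + y)) => hp; case: (ger0P (x - y)) => hm; lra.
Qed.

Lemma ray_weight_ge0 c s b : 0 <= ray_weight c s b.
Proof. by rewrite divr_ge0// addr_ge0. Qed.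

Lemma continuous_ray_weight c s : continuous (ray_weight c s).
Proof.
have hc : continuous (fun b : R => c * cos b).
  by move=> x; apply: cvgM; [exact: cvg_cst|exact: continuous_cos].
have hs : continuous (fun b : R => s * sin b).
  by move=> x; apply: cvgM; [exact: cvg_cst|exact: continuous_sin].
move=> x; apply: cvgM; last exact: cvg_cst.
apply: cvgD; apply: cvg_norm; first exact: (cvgD (hc x) (hs x)).
exact: (cvgB (hc x) (hs x)).
Qed.

Let quarter (b : R) : 0 <= b <= pi / 2 -> 0 <= cos b /\ 0 <= sin b.
Proof.
move=> /andP[b0 bp]; have p0 := pi_gt0 R; split.
  by apply: cos_ge0_pihalf; rewrite bp andbT; lra.
by apply: sin_ge0_pi; rewrite b0/=; lra.
Qed.

Lemma integral_cos_quarter : \int[mu]_(b in `[0, pi / 2]) cos b = 1.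
Proof.
have p0 := pi_gt0 R.
rewrite (@Rintegral_derive_le _ sin); last exact: continuous_cos.
- by rewrite sin_pihalf sin0 subr0.
- by lra.
Qed.

Lemma integral_ray_weight c s : c ^+ 2 + s ^+ 2 = 1 ->
  \int[mu]_(b in `[0, pi / 2]) ray_weight c s b = 1.
Proof.
move=> cs; have p0 := pi_gt0 R.
have s1 : -1 <= `|s| <= 1.
  rewrite (le_trans (lerN10 _))//= -(@ler_pXn2r _ 2)// ?nnegrE//.
  by rewrite expr1n -normrX ger0_norm ?sqr_ge0// -cs lerDr sqr_ge0.
(* The two arguments of the maximum cross at [t], where cos t = |s| and sin t = |c|; the two pieces
   of the integral are c^2 and s^2. *)
pose t := acos `|s|.
have ct : cos t = `|s| by rewrite acosK// in_itv.
have st : sin t = `|c|.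
  rewrite sin_acos// -normrX ger0_norm ?sqr_ge0// -cs addrK; exact: sqrtr_sqr.
have t0 : 0 <= t by exact: acos_ge0.
have tp : t <= pi / 2.
  rewrite leNgt; apply/negP => h.
  have : cos t < cos (pi / 2).
    by rewrite ltr_cos// in_itv/= ?t0 ?acos_lepi//; apply/andP; split; lra.
  by rewrite ct cos_pihalf ltNge normr_ge0.
rewrite (Rintegral_split t0 tp (@continuous_ray_weight c s)).
have -> : \int[mu]_(b in `[0, t]) ray_weight c s b = \int[mu]_(b in `[0, t]) (`|c| * cos b).
  apply: eq_Rintegral => b; rewrite inE/= in_itv/= => /andP[b0 bt].
  have [cb sb] : 0 <= cos b /\ 0 <= sin b by apply: quarter; rewrite b0 (le_trans bt).
  rewrite ray_weight_max// max_l// -ct -st.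
  have : 0 <= sin (t - b) by apply: sin_ge0_pi; apply/andP; split; lra.
  by rewrite sinB subr_ge0.
have -> : \int[mu]_(b in `[t, pi / 2]) ray_weight c s b =
    \int[mu]_(b in `[t, pi / 2]) (`|s| * sin b).
  apply: eq_Rintegral => b; rewrite inE/= in_itv/= => /andP[tb bp].
  have [cb sb] : 0 <= cos b /\ 0 <= sin b by apply: quarter; rewrite bp (le_trans t0).
  rewrite ray_weight_max// max_r// -ct -st.
  have : 0 <= sin (b - t) by apply: sin_ge0_pi; apply/andP; split; lra.
  by rewrite sinB subr_ge0 [cos b * _]mulrC [sin b * _]mulrC.
rewrite (Rintegral_derive_le t0 (fun x => is_derive_cmul `|c| (is_derive_sin x))); last first.
  by move=> x; apply: cvgM; [exact: cvg_cst|exact: continuous_cos].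
have dc (x : R) : is_derive x 1 (fun x => `|s| * - cos x) (`|s| * sin x).
  by apply: (is_derive_eq (is_derive_cmul `|s| (is_deriveN (is_derive_cos x)))); rewrite opprK.
rewrite (Rintegral_derive_le tp dc); last first.
  by move=> x; apply: cvgM; [exact: cvg_cst|exact: continuous_sin].
rewrite sin0 cos_pihalf st ct oppr0 !mulr0 subr0 sub0r mulrN opprK -!expr2.
by rewrite -!normrX !ger0_norm ?sqr_ge0.
Qed.

Let D : set R := `]0, pi / 2[%classic.

Let openE (f : R -> R) : continuous f ->
  (\int[mu]_(b in D) (f b)%:E = (\int[mu]_(b in `[0%R, (pi / 2)%R]) f b)%R%:E)%E.
Proof.
move=> fc.
have mf (A : set R) : measurable_fun A (EFin \o f : measurableTypeR R -> _).
  apply/measurable_EFinP; apply: measurable_funTS.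
  exact: continuous_measurable_fun.
rewrite /D integral_itv_bndo_bndc// integral_itv_obnd_cbnd//.
rewrite fineK//; apply: integrable_fin_num => //.
apply: continuous_compact_integrable; first exact: segment_compact.
exact: continuous_subspaceT.
Qed.

(* Chebyshev-type rearrangement: the weights have the same integral, and their
   difference changes sign once, from negative to positive. *)
Lemma ray_weight_rearrangement c s (G : measurableTypeR R -> R) : c ^+ 2 + s ^+ 2 = 1 ->
  measurable_fun D G -> (forall b, D b -> 0 <= G b) ->
  (forall a b, D a -> D b -> a <= b -> G b <= G a) ->
  (\int[mu]_(b in D) (ray_weight c s b * G b)%:E <=
   \int[mu]_(b in D) (cos b * G b)%:E)%E.
Proof.
move=> cs mG G0 Gd; have p0 := pi_gt0 R.
have Dq b : D b -> 0 <= cos b /\ 0 <= sin b.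
  by rewrite /D/= in_itv/= => /andP[h1 h2]; apply: quarter; rewrite !ltW.
have [s0|s0] := eqVneq s 0.
  rewrite le_eqVlt; apply/orP; left; apply/eqP; apply: eq_integral => b; rewrite inE => Db.
  have [cb sb] := Dq b Db.
  have c1 : `|c| = 1.
    apply/eqP; rewrite -(@eqrXn2 _ 2)// expr1n -normrX ger0_norm ?sqr_ge0//.
    by rewrite -cs s0 expr0n addr0.
  by rewrite ray_weight_max// s0 normr0 mul0r c1 mul1r max_l.
have sp : 0 < `|s| by rewrite normr_gt0.
have c1 : `|c| <= 1.
  rewrite -(@ler_pXn2r _ 2)// ?nnegrE//.
  by rewrite expr1n -normrX ger0_norm ?sqr_ge0// -cs lerDl sqr_ge0.
(* At [t] one has |s| sin t = cos t: there the weight overtakes cos b. *)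
pose t := atan (`|s|^-1).
have t0 : 0 < t by rewrite -atan0 lt_atan// invr_gt0.
have tp : t < pi / 2 by exact: atan_ltpi2.
have Dt : D t by rewrite /D/= in_itv/= t0.
have ct : 0 < cos t by apply: cos_gt0_pihalf; rewrite tp andbT; lra.
have st : cos t = `|s| * sin t.
  have := atanK (`|s|^-1); rewrite -/t /tan => /(congr1 (fun x => x * cos t * `|s|)).
  by rewrite divfK ?gt_eqF// mulrAC mulVf ?gt_eqF// mul1r mulrC.
have st0 : 0 < sin t by move: ct; rewrite st pmulr_rgt0.
(* This is (weight - cos b) (G b - G t) <= 0 rearranged so that all terms are nonnegative: the
   integrals can then be added in the extended reals, where those involving [G] are not yet known to
   be finite. *)
have key b : D b -> ray_weight c s b * G b + G t * cos b <= cos b * G b + G t * ray_weight c s b.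
  move=> Db; have [cb sb] := Dq b Db.
  have bI : 0 < b < pi / 2 by move: Db; rewrite /D/= in_itv.
  have /andP[b0 bp] := bI.
  suff : (ray_weight c s b - cos b) * (G b - G t) <= 0 by nra.
  have [bt|tb] := leP b t.
    apply: mulr_le0_ge0; last by rewrite subr_ge0; exact: Gd.
    rewrite subr_le0 ray_weight_max// ge_max ler_piMl//=.
    have : 0 <= sin (t - b) by apply: sin_ge0_pi; apply/andP; split; lra.
    rewrite sinB st (_ : _ - _ = sin t * (cos b - `|s| * sin b)); last by ring.
    by rewrite pmulr_rge0// subr_ge0.
  apply: mulr_ge0_le0; last by rewrite subr_le0; apply: Gd => //; exact: ltW.
  rewrite subr_ge0 ray_weight_max// le_max; apply/orP; right.
  have : 0 <= sin (b - t) by apply: sin_ge0_pi; apply/andP; split; lra.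
  rewrite sinB st (_ : _ - _ = sin t * (`|s| * sin b - cos b)); last by ring.
  by rewrite pmulr_rge0// subr_ge0.
have mw : measurable_fun D (ray_weight c s : measurableTypeR R -> R).
  apply: measurable_funTS; apply: continuous_measurable_fun.
  exact: continuous_ray_weight.
have mc : measurable_fun D (cos : measurableTypeR R -> R).
  by apply: measurable_funTS; apply: continuous_measurable_fun; exact: continuous_cos.
have mD : measurable (D : set (measurableTypeR R)) by exact: measurable_itv.
have Gt0 := G0 _ Dt.
have I1 : (\int[mu]_(b in D) (G t * cos b)%:E = (G t)%:E)%E.
  under eq_integral do rewrite EFinM.
  rewrite ge0_integralZl//.
  - by rewrite openE ?integral_cos_quarter ?mule1//; exact: continuous_cos.
  - exact/measurable_EFinP.
  - by move=> b /Dq[cb _]; rewrite lee_fin.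
have I2 : (\int[mu]_(b in D) (G t * ray_weight c s b)%:E = (G t)%:E)%E.
  under eq_integral do rewrite EFinM.
  rewrite ge0_integralZl//.
  - by rewrite openE ?integral_ray_weight ?mule1//; exact: continuous_ray_weight.
  - exact/measurable_EFinP.
  - by move=> b _; rewrite lee_fin ray_weight_ge0.
(* Both weights have integral 1, so the same finite amount [G t] is added on each side. *)
rewrite -(@leeD2rE _ (G t)%:E)// -{1}I1 -I2.
have mprod (p q : measurableTypeR R -> R) : measurable_fun D p -> measurable_fun D q ->
    measurable_fun D (fun b => (p b * q b)%:E).
  by move=> mp mq; apply/measurable_EFinP; exact: measurable_funM.
have mcst (k : R) : measurable_fun D (fun=> k : measurableTypeR R) by exact: measurable_cst.
have nn1 b : D b -> (0 <= (ray_weight c s b * G b)%:E)%E.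
  by move=> Db; rewrite lee_fin mulr_ge0 ?ray_weight_ge0 ?G0.
have nn2 b : D b -> (0 <= (G t * cos b)%:E)%E.
  by move=> /Dq[cb _]; rewrite lee_fin mulr_ge0.
have nn3 b : D b -> (0 <= (cos b * G b)%:E)%E.
  by move=> Db; have [cb _] := Dq b Db; rewrite lee_fin mulr_ge0 ?G0.
have nn4 b : D b -> (0 <= (G t * ray_weight c s b)%:E)%E.
  by move=> Db; rewrite lee_fin mulr_ge0 ?ray_weight_ge0.
have m1 := mprod _ _ mw mG; have m2 := mprod _ _ (mcst (G t)) mc.
have m3 := mprod _ _ mc mG; have m4 := mprod _ _ (mcst (G t)) mw.
rewrite -(ge0_integralD mu mD nn1 m1 nn2 m2) -(ge0_integralD mu mD nn3 m3 nn4 m4).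
apply: ge0_le_integral => //.
- by move=> b Db; apply: adde_ge0; [exact: nn1|exact: nn2].
- exact: emeasurable_funD.
- exact: emeasurable_funD.
Qed.

End RayWeight.

(** * Slices of the polar region at a fixed auxiliary angle *)

Section PolarSlice.
Context {R : realType}.
Variable r : R.
Hypothesis r0 : 0 < r.
Hypothesis r1 : r < 1.
Local Notation mu := (@lebesgue_measure R).
Implicit Types th b : R.

Let A th := axial_sqdist r th.
Let w th := axial_height r th.
Let d := 1 - r ^+ 2.
Let z0 := r * (3 - r ^+ 2) / 2.

Let A0 th : 0 < A th. Proof. exact: axial_sqdist_gt0 (ltW r0) r1. Qed.

Let d0 : 0 < d. Proof. by rewrite subr_gt0 expr_lt1// ltW. Qed.

Definition polar_weight th : R := sin th * w th ^+ 2 * (A th)^-1 ^+ 3.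

(** The condition tan b < d sin th / |w th|, cleared of denominators so that it keeps its meaning
    where [w] vanishes. *)
Definition polar_region b th : bool := `|w th| * sin b < d * sin th * cos b.

(** Partial fractions in cos th, regrouped in powers of w / A because this quotient is simple at the
    endpoints of a slice. *)
Let slice_primitive th : R := - (w th / A th) ^+ 2 / (4 * r)
  + w th / A th / (4 * r ^+ 2) + ln (A th) / (8 * r ^+ 3).

Let is_derive_slice_primitive th : is_derive th 1 slice_primitive (polar_weight th).
Proof.
have k c := is_derive_const (c : R) th 1; have hc := is_derive_cos th.
have An : A th != 0 by rewrite gt_eqF.
have hA := is_derive_sub (k (1 + r ^+ 2)) (is_derive_cmul (2 * r) hc).
have hI := @is_derive_inv R _ A th 1 _ An hA.
have hv := is_derive_mul (is_derive_sub hc (k z0)) hI.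
have hl := @is_derive_comp R (@ln R) A th _ _ (is_derive1_ln (A0 th)) hA.
have h1 := is_derive_mul (is_deriveN (is_derive_pow 1 hv)) (k (4 * r)^-1).
have h := is_derive_add (is_derive_add h1 (is_derive_mul hv (k (4 * r ^+ 2)^-1)))
  (is_derive_mul hl (k (8 * r ^+ 3)^-1)).
apply: (is_derive_eq h); move: An; rewrite /polar_weight /w /axial_height -/z0 /A /axial_sqdist.
move: (cos th) (sin th) => x s An; have rn : r != 0 by rewrite gt_eqF.
by rewrite /z0; field; rewrite An rn.
Qed.

Lemma continuous_polar_weight : continuous polar_weight.
Proof.
have cA : continuous (fun th => (A th)^-1).
  move=> x; apply: cvgV; first by rewrite gt_eqF.
  apply: cvgB; first exact: cvg_cst.
  by apply: cvgM; [exact: cvg_cst|exact: continuous_cos].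
have cw : continuous w.
  by move=> x; apply: cvgB; [exact: continuous_cos|exact: cvg_cst].
move=> x; apply: cvgM; last by do 2 (apply: cvgM; first exact: cA); exact: cA.
by apply: cvgM; [exact: continuous_sin|apply: cvgM; exact: cw].
Qed.

Lemma polar_weight_ge0 th : 0 <= th <= pi -> 0 <= polar_weight th.
Proof.
move=> /sin_ge0_pi s0; rewrite mulr_ge0 ?exprn_ge0// ?invr_ge0 ?(ltW (A0 th))//.
by rewrite mulr_ge0 ?sqr_ge0.
Qed.

Lemma ltr_cos_itv (x y : R) : 0 <= x <= pi -> 0 <= y <= pi -> (cos x < cos y) = (y < x).
Proof. by move=> hx hy; rewrite ltr_cos// in_itv. Qed.

(* The slice at b is an interval whose endpoints have the roots of a quadratic
   polynomial as cosines. *)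
Lemma polar_slice b : 0 < b < pi / 2 -> exists th1 th2, [/\ 0 <= th1, th1 < th2, th2 <= pi,
  forall th, 0 < th < pi -> polar_region b th = (th1 < th < th2) &
  \int[mu]_(th in `[th1, th2]) polar_weight th = ray_moment r (r * cos b) / (4 * r ^+ 3)].
Proof.
move=> /andP[b0 bp].
have sb : 0 < sin b by apply: sin_gt0_pi; rewrite b0/=; lra.
have C0 : 0 < cos b by apply: cos_gt0_pihalf; rewrite bp andbT; lra.
have := sin2cos2 b; rewrite /polar_region; move: C0 sb; set C := cos b; set sn := sin b.
move=> C0 sb sC; pose a := r * C.
have C1 : C <= 1 by exact: cos_le1.
have ar : 0 <= a <= r by rewrite mulr_ge0 ?(ltW r0) ?(ltW C0)//= ler_piMr// ltW.
have [P0 M0] := ray_log_gt0 r0 r1 ar.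
pose S := Num.sqrt (a ^+ 2 + (4 - r ^+ 2)).
have r21 : r ^+ 2 < 1 by rewrite expr_lt1// ltW.
have h4 : 0 < a ^+ 2 + (4 - r ^+ 2) by rewrite ltr_wpDl ?sqr_ge0//; lra.
have S0 : 0 < S by rewrite sqrtr_gt0.
have S2 : S ^+ 2 = a ^+ 2 + (4 - r ^+ 2) by rewrite sqr_sqrtr// ltW.
pose P := 1 + a ^+ 2 + a * S; pose M := 1 + a ^+ 2 - a * S.
have {}P0 : 0 < P by []. have {}M0 : 0 < M by [].
(* [vp] and [vm] are the values of w / A at the endpoints, the roots of v^2 - r C^2 v - C^2 (4 -
   r^2) / 4. Solving (x - z0) / (1 + r^2 - 2 r x) = v for the cosine x gives np / P and nm / M,
   where P = 1 + 2 r vp and M = 1 + 2 r vm. *)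
pose vp := C * (a + S) / 2; pose vm := C * (a - S) / 2.
pose np := z0 + vp * (1 + r ^+ 2); pose nm := z0 + vm * (1 + r ^+ 2).
have PE : P = 1 + 2 * r * vp by rewrite /P /vp /a; field.
have ME : M = 1 + 2 * r * vm by rewrite /M /vm /a; field.
(* Written as a nonnegative quantity, this difference shows that np / P lies in [-1, 1] and so is a
   cosine; [hm] does the same for nm / M. *)
have hp : P ^+ 2 - np ^+ 2 = d ^+ 2 * (a + S) ^+ 2 * sn ^+ 2 / 4.
  have e1 : (a + S) ^+ 2 = 2 * a * (a + S) + (4 - r ^+ 2).
    by rewrite sqrrD S2 -mulr_natr; ring.
  have -> : P ^+ 2 - np ^+ 2 = d ^+ 2 * (1 - (vp - r / 2) ^+ 2).
    by rewrite PE /np /d /z0; field.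
  rewrite sC; have -> : (vp - r / 2) ^+ 2 = C ^+ 2 * (a + S) ^+ 2 / 4 - a * (a + S) / 2 + r ^+ 2 / 4.
    by rewrite /vp /a; field.
  by rewrite e1; field.
have hm : M ^+ 2 - nm ^+ 2 = d ^+ 2 * (a - S) ^+ 2 * sn ^+ 2 / 4.
  have e1 : (a - S) ^+ 2 = 2 * a * (a - S) + (4 - r ^+ 2).
    by rewrite sqrrB S2 -mulr_natr; ring.
  have -> : M ^+ 2 - nm ^+ 2 = d ^+ 2 * (1 - (vm - r / 2) ^+ 2).
    by rewrite ME /nm /d /z0; field.
  rewrite sC; have -> : (vm - r / 2) ^+ 2 = C ^+ 2 * (a - S) ^+ 2 / 4 - a * (a - S) / 2 + r ^+ 2 / 4.
    by rewrite /vm /a; field.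
  by rewrite e1; field.
have itv1 (p n : R) : 0 < p -> 0 <= p ^+ 2 - n ^+ 2 -> -1 <= n / p <= 1.
  move=> p0 h; rewrite -ler_norml normrM normfV (gtr0_norm p0) ler_pdivrMr// mul1r.
  by rewrite -(@ler_pXn2r _ 2)// ?nnegrE ?(ltW p0)// -normrX ger0_norm ?sqr_ge0// -subr_ge0.
have zp1 : -1 <= np / P <= 1.
  by apply: itv1 => //; rewrite hp divr_ge0// mulr_ge0 ?sqr_ge0// mulr_ge0 ?sqr_ge0.
have zm1 : -1 <= nm / M <= 1.
  by apply: itv1 => //; rewrite hm divr_ge0// mulr_ge0 ?sqr_ge0// mulr_ge0 ?sqr_ge0.
have zlt : nm / M < np / P.
  rewrite -subr_gt0 (_ : np / P - nm / M = (vp - vm) * d ^+ 2 / (P * M)).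
    rewrite divr_gt0 ?mulr_gt0// ?exprn_gt0//.
    by rewrite (_ : vp - vm = C * S) ?mulr_gt0// /vp /vm; field.
  rewrite PE in P0 *; rewrite ME in M0 *; rewrite /np /nm /d /z0.
  by field; rewrite !gt_eqF.
pose t1 := acos (np / P); pose t2 := acos (nm / M).
have c1 : cos t1 = np / P by rewrite acosK// in_itv.
have c2 : cos t2 = nm / M by rewrite acosK// in_itv.
have t1p : 0 <= t1 <= pi by rewrite acos_ge0// acos_lepi.
have t2p : 0 <= t2 <= pi by rewrite acos_ge0// acos_lepi.
have /andP[t10 _] := t1p; have /andP[_ t2pi] := t2p.
have t12 : t1 < t2 by rewrite -ltr_cos_itv// c1 c2.
exists t1, t2; split => //.
- move=> th /andP[th0 thp].
  have thi : 0 <= th <= pi by rewrite !ltW.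
  have sth : 0 < sin th by apply: sin_gt0_pi; rewrite th0.
  (* Both sides of the inequality defining the region are nonnegative and may be squared; the
     difference of squares factors in cos th with roots np / P and nm / M. *)
  have N : (d * sin th * C) ^+ 2 - (`|w th| * sn) ^+ 2 =
      (cos th * M - nm) * (np - cos th * P).
    rewrite !exprMn -normrX ger0_norm ?sqr_ge0// sC sin2cos2 /w /axial_height -/z0.
    move: (cos th) => x; rewrite PE ME /np /nm.
    have e1 : vp * vm = - C ^+ 2 * (4 - r ^+ 2) / 4.
      rewrite /vp /vm (_ : _ * _ = C ^+ 2 * (a ^+ 2 - S ^+ 2) / 4); last by field.
      by rewrite S2; ring.
    have e2 : vp + vm = r * C ^+ 2 by rewrite /vp /vm /a; field.
    transitivity (- (x - z0) ^+ 2 - (vp * vm) * (2 * r * x - (1 + r ^+ 2)) ^+ 2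
      - (vp + vm) * (x - z0) * (2 * r * x - (1 + r ^+ 2))); last by ring.
    by rewrite e1 e2 /d /z0; field.
  have q0 : 0 <= `|w th| * sn by rewrite mulr_ge0// ltW.
  have q1 : 0 <= d * sin th * C by rewrite !mulr_ge0// ltW.
  rewrite -(@ltr_pXn2r _ 2)// ?nnegrE// -subr_gt0 N.
  rewrite -(ltr_cos_itv thi t1p) -(ltr_cos_itv t2p thi) c1 c2.
  rewrite ltr_pdivlMr// ltr_pdivrMr// -[_ < np]subr_gt0 -[nm < _]subr_gt0.
  apply/idP/andP => [h|[h1 h2]]; last by rewrite mulr_gt0.
  have [u|u] := ltP 0 (cos th * M - nm); first by move: h; rewrite pmulr_rgt0.
  have [v|v] := ltP 0 (np - cos th * P); first by move: h; rewrite pmulr_lgt0// ltNge u.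
  exfalso; move: zlt; apply/negP; rewrite -leNgt.
  apply: (@le_trans _ _ (cos th)).
    by rewrite ler_pdivrMr// -subr_le0.
  by rewrite ler_pdivlMr// -subr_le0.
- rewrite (Rintegral_derive_le (ltW t12) is_derive_slice_primitive continuous_polar_weight).
  (* With A = d^2 / P or d^2 / M and w / A = vp or vm at the endpoints, the term ln (d^2) drops out
     of the difference of primitives. *)
  have A1 : A t1 = d ^+ 2 / P.
    by rewrite /A /axial_sqdist c1 /np PE /d /z0; field; rewrite -PE gt_eqF.
  have A2 : A t2 = d ^+ 2 / M.
    by rewrite /A /axial_sqdist c2 /nm ME /d /z0; field; rewrite -ME gt_eqF.
  have w1 : w t1 / A t1 = vp.
    rewrite A1 /w /axial_height c1 -/z0 /np PE /d /z0.
    by field; rewrite -PE -/d !gt_eqF.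
  have w2 : w t2 / A t2 = vm.
    rewrite A2 /w /axial_height c2 -/z0 /nm ME /d /z0.
    by field; rewrite -ME -/d !gt_eqF.
  rewrite /slice_primitive w1 w2 A1 A2 !ln_div ?posrE ?exprn_gt0//.
  rewrite /ray_moment -/a -/S -/P -/M; move: (ln P) (ln M) (ln _) => lP lM ld.
  have an : a != 0 by rewrite gt_eqF// mulr_gt0.
  have rn : r != 0 by rewrite gt_eqF.
  transitivity (((vp + vm) * (vp - vm)) / (4 * r) - (vp - vm) / (4 * r ^+ 2)
    + (lP - lM) / (8 * r ^+ 3)); first by field.
  have -> : vp + vm = C * a by rewrite /vp /vm; field.
  have -> : vp - vm = C * S by rewrite /vp /vm; field.
  by rewrite /a; field.
Qed.

End PolarSlice.

(** * The second spherical angle replaced by the auxiliary angle *)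

Section PolarFiber.
Context {R : realType}.
Local Notation mu := (@lebesgue_measure R).

Let abs_mean0 (a : R) : abs_mean a 0 = 2 * `|a|. Proof. exact: integral_abs_cst_sin. Qed.

Let abs_meanE (a b : R) : b != 0 ->
  abs_mean a b = ((a + b) * `|a + b| - (a - b) * `|a - b|) / (2 * b).
Proof.
move=> b0; apply: (mulfI b0); rewrite /abs_mean integral_abs_affine_cos.
by field.
Qed.

Lemma abs_meanN (a b : R) : abs_mean (- a) b = abs_mean a b.
Proof.
have [->|b0] := eqVneq b 0; first by rewrite !abs_mean0 normrN.
rewrite !abs_meanE//; congr (_ / _).
rewrite (_ : - a + b = - (a - b)); last by ring.
rewrite (_ : - a - b = - (a + b)); last by ring.
by rewrite !normrN; ring.
Qed.

Lemma abs_meanZ (k a b : R) : 0 < k -> abs_mean (k * a) (k * b) = k * abs_mean a b.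
Proof.
move=> k0; have kn : k != 0 by rewrite gt_eqF.
have [->|b0] := eqVneq b 0.
  by rewrite mulr0 !abs_mean0 normrM (gtr0_norm k0); ring.
rewrite !abs_meanE ?mulf_neq0// -mulrDr -mulrBr !normrM (gtr0_norm k0).
by field; rewrite b0 kn.
Qed.

Let cos_gt0_atan (k b : R) : b \in `[0, atan k] -> 0 < cos b.
Proof.
rewrite in_itv/= => /andP[b0 bB]; apply: cos_gt0_pihalf.
by rewrite (le_lt_trans bB (atan_ltpi2 k)) andbT; have := pi_gt0 R; lra.
Qed.

Lemma continuous_ray_weight_div_cube (c s k : R) :
  {within `[0, atan k], continuous (fun b => ray_weight c s b * (cos b)^-1 ^+ 3)}.
Proof.
apply: continuous_in_subspaceT => b; rewrite inE/= => /cos_gt0_atan b0.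
have cV : {for b, continuous (fun b : R => (cos b)^-1)}.
  by apply: cvgV; [rewrite gt_eqF|exact: continuous_cos].
apply: cvgM; first exact: continuous_ray_weight.
by do 2 (apply: cvgM; first exact: cV); exact: cV.
Qed.

(** The substitution v = tan b turns the left side into half the integral of |c + s v| over [-k, k],
    and v = k u leads to [abs_mean]. The proof exhibits the primitive in tan b directly. *)
Lemma integral_ray_weight_div_cube (c s k : R) : 0 < k ->
  \int[mu]_(b in `[0, atan k]) (ray_weight c s b * (cos b)^-1 ^+ 3) =
  k / 2 * abs_mean c (s * k).
Proof.
move=> k0; have kn : k != 0 by rewrite gt_eqF.
have B0 : 0 < atan k by rewrite -atan0 lt_atan.
have cp (b : R) : b \in `[0, atan k] -> 0 < cos b by exact: cos_gt0_atan.
have cont := @continuous_ray_weight_div_cube c s k.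
have absE (b z : R) : 0 < cos b -> `|c + z * tan b| = `|c * cos b + z * sin b| / cos b.
  move=> b0; rewrite -{2}(gtr0_norm b0) -normf_div; congr `|_|.
  by rewrite /tan; field; rewrite gt_eqF.
move: cont; have [->|s0] := eqVneq s 0 => cont.
  have dF (b : R) : b \in `[0, atan k] ->
      is_derive b 1 (fun b => `|c| * tan b) (ray_weight c 0 b * (cos b)^-1 ^+ 3).
    move=> /cp b0; have bn : cos b != 0 by rewrite gt_eqF.
    apply: (is_derive_eq (is_derive_cmul `|c| (is_derive_tan bn))).
    rewrite /ray_weight !mul0r subr0 addr0 normrM (gtr0_norm b0).
    by move: `|c| => x; field.
  by rewrite (Rintegral_derive B0 dF cont) atanK tan0 mul0r abs_mean0; field.
have dF (b : R) : b \in `[0, atan k] -> is_derive b 1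
    (fun b => (4 * s)^-1 * ((c + s * tan b) * `|c + s * tan b| - (c - s * tan b) * `|c - s * tan b|))
    (ray_weight c s b * (cos b)^-1 ^+ 3).
  move=> /cp b0; have bn : cos b != 0 by rewrite gt_eqF.
  have hs z := is_derive_add (is_derive_const c b 1) (is_derive_cmul z (is_derive_tan bn)).
  have hq z := @is_derive_comp R (fun t => t * `|t|) (fun b => c + z * tan b) b _ _
    (is_derive_absq (c + z * tan b)) (hs z).
  have h := is_derive_cmul (4 * s)^-1 (is_derive_sub (hq s) (hq (- s))).
  rewrite (_ : (fun _ => _) = (fun b => (4 * s)^-1 * ((c + s * tan b) * `|c + s * tan b| - (c + - s * tan b) * `|c + - s * tan b|))); last by apply/funext => t; rewrite mulNr.
  apply: (is_derive_eq h); rewrite !absE// /ray_weight !mulNr.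
  move: `|_| `|_| => x y; field; first by rewrite bn s0.
rewrite (Rintegral_derive B0 dF cont) atanK tan0 mulr0 addr0 subr0 subrr mulr0 subr0.
by rewrite abs_meanE ?mulf_neq0//; field; rewrite kn s0.
Qed.

Variable r : R.
Hypothesis r0 : 0 < r.
Hypothesis r1 : r < 1.

Let d := 1 - r ^+ 2.

Let d0 : 0 < d. Proof. by rewrite subr_gt0 expr_lt1// ltW. Qed.

(** The tangent of the upper end of the fibre over [th]. Where the height vanishes the division
    returns 0 instead of an infinite slope, so that single angle is set apart. *)
Definition polar_slope th : R := d * sin th / `|axial_height r th|.

Let slope_gt0 th : 0 < th < pi -> axial_height r th != 0 -> 0 < polar_slope th.
Proof. by move=> /sin_gt0_pi s0 w0; rewrite divr_gt0 ?normr_gt0// mulr_gt0. Qed.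

(** With k the slope, k cos b - sin b is a positive multiple of sin (atan k - b), whose sign
    compares the two angles. *)
Lemma polar_region_atan th b : 0 < th < pi -> axial_height r th != 0 -> 0 < b < pi / 2 ->
  polar_region r b th = (b < atan (polar_slope th)).
Proof.
move=> thp w0 /andP[b0 bp]; have k0 := slope_gt0 thp w0.
have p0 := pi_gt0 R.
have B0 : 0 < atan (polar_slope th) by rewrite -atan0 lt_atan.
have Bp := atan_ltpi2 (polar_slope th).
have cB : 0 < cos (atan (polar_slope th)) by apply: cos_gt0_pihalf; rewrite Bp andbT; lra.
have sB : sin (atan (polar_slope th)) = polar_slope th * cos (atan (polar_slope th)).
  by rewrite -{2}(atanK (polar_slope th)) /tan divfK// gt_eqF.
have -> : polar_region r b th = (0 < sin (atan (polar_slope th) - b)).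
  rewrite sinB sB (_ : _ - _ = cos (atan (polar_slope th)) * (polar_slope th * cos b - sin b)); last by ring.
  rewrite pmulr_rgt0// subr_gt0 /polar_region /polar_slope -/d.
  by rewrite [_ / _ * cos b]mulrAC ltr_pdivlMr ?normr_gt0// [sin b * _]mulrC.
have [h|h] := ltP b (atan (polar_slope th)).
  by apply: sin_gt0_pi; apply/andP; split; lra.
apply/negbTE; rewrite -leNgt -oppr_ge0 -sinN opprB.
by apply: sin_ge0_pi; apply/andP; split; lra.
Qed.

(** [abs_mean] is homogeneous and even in its first argument, so |w| factors out and leaves
    [abs_mean c (s * polar_slope th)], in which direction and angle are separated by the preceding
    integral. *)
Lemma axial_integrand_fiber c s th : 0 < th < pi -> axial_height r th != 0 ->
  axial_integrand r c s th = 8 / d * (polar_weight r th *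
    \int[mu]_(b in `[0, atan (polar_slope th)]) (ray_weight c s b * (cos b)^-1 ^+ 3)).
Proof.
move=> thp w0; rewrite integral_ray_weight_div_cube ?slope_gt0//.
have wp : 0 < `|axial_height r th| by rewrite normr_gt0.
have E : abs_mean (c * axial_height r th) (s * (1 - r ^+ 2) * sin th) =
    `|axial_height r th| * abs_mean c (s * polar_slope th).
  transitivity (abs_mean (`|axial_height r th| * c) (`|axial_height r th| * (s * polar_slope th))); last exact: abs_meanZ.
  have -> : `|axial_height r th| * (s * polar_slope th) = s * (1 - r ^+ 2) * sin th.
    by rewrite /polar_slope -/d; field; rewrite gt_eqF.
  case: (ger0P (axial_height r th)) => _; first by rewrite mulrC.
  by rewrite mulNr abs_meanN mulrC.
rewrite /axial_integrand E /polar_weight.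
have -> : axial_height r th ^+ 2 = `|axial_height r th| ^+ 2 by rewrite real_normK// num_real.
move: (abs_mean _ _) => m; rewrite /polar_slope.
have A0 := axial_sqdist_gt0 th (ltW r0) r1.
by field; rewrite !gt_eqF.
Qed.

End PolarFiber.

(** * Exchange of the integrations and comparison with the radial direction *)

Section RadialDomination.
Context {R : realType}.
Local Notation mu := (@lebesgue_measure R).
Local Notation RR := (measurableTypeR R).

Lemma integral_if_itv (h : R -> R) (a b : R) : {within `[a, b], continuous h} ->
  (\int[mu]_x (if a < x < b then h x else 0)%:E = (\int[mu]_(x in `[a, b]) h x)%:E)%E.
Proof.
move=> hc.
have hi : mu.-integrable `[a, b] (EFin \o h).
  by apply: continuous_compact_integrable => //; exact: segment_compact.
rewrite fineK; last exact: integrable_fin_num.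
rewrite integral_itv_bndoo; last first.
  apply: measurable_funS (measurable_int _ hi) => //.
  by apply: subset_itvW.
rewrite [RHS]integral_mkcond; apply: eq_integral => x _.
by rewrite patchE mem_setE in_itv/=; case: ifP.
Qed.

Variable r : R.
Hypothesis r0 : 0 < r.
Hypothesis r1 : r < 1.
Implicit Types c s th b : R.

Let d := 1 - r ^+ 2.

Let d0 : 0 < d. Proof. by rewrite subr_gt0 expr_lt1// ltW. Qed.

(** The restriction to the open rectangle is built into the integrand, so that Tonelli applies on
    the whole plane. *)
Let inside (p : RR * RR) : bool :=
  [&& 0 < p.1, p.1 < pi, 0 < p.2, p.2 < pi / 2 & polar_region r p.2 p.1].

(* [cos b `^ (-1)] is [(cos b)^-1] on the region, and is measurable in [b]. *)
Let polar_integrand c s (p : RR * RR) : R :=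
  if inside p then polar_weight r p.1 * (ray_weight c s p.2 * (cos p.2 `^ (-1)) ^+ 3) else 0.

Let measurable1 (f : R -> R) : continuous f ->
  measurable_fun [set: RR * RR] (fun p : RR * RR => f p.1).
Proof.
move=> fc; apply: measurableT_comp (measurable_fst) => //.
exact: continuous_measurable_fun.
Qed.

Let measurable2 (f : R -> R) : continuous f ->
  measurable_fun [set: RR * RR] (fun p : RR * RR => f p.2).
Proof.
move=> fc; apply: measurableT_comp (measurable_snd) => //.
exact: continuous_measurable_fun.
Qed.

Let measurable_inside : measurable_fun setT inside.
Proof.
have cid : continuous (id : R -> R) by move=> x; exact: cvg_id.
have mc (k : R) : measurable_fun [set: RR * RR] (fun=> k : RR) by exact: measurable_cst.
have m1 := measurable1 cid; have m2 := measurable2 cid.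
apply: measurable_and; first exact: measurable_fun_ltr.
apply: measurable_and; first exact: measurable_fun_ltr.
apply: measurable_and; first exact: measurable_fun_ltr.
apply: measurable_and; first exact: measurable_fun_ltr.
have cw : continuous (fun th : R => `|axial_height r th|).
  move=> x; apply: cvg_norm; apply: cvgB; first exact: continuous_cos.
  exact: cvg_cst.
apply: (measurable_fun_ltr (f := fun p : RR * RR => `|axial_height r p.1| * sin p.2)
  (g := fun p : RR * RR => d * sin p.1 * cos p.2)).
  exact: (measurable_funM (measurable1 cw) (measurable2 (@continuous_sin R))).
apply: measurable_funM; last exact: (measurable2 (@continuous_cos R)).
exact: (measurable_funM (mc d) (measurable1 (@continuous_sin R))).
Qed.

Let measurable_polar_integrand c s : measurable_fun setT (EFin \o polar_integrand c s).
Proof.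
apply/measurable_EFinP; apply: measurable_fun_ifT => //.
apply: measurable_funM.
  exact: (measurable1 (continuous_polar_weight r0 r1)).
apply: measurable_funM; first exact: (measurable2 (@continuous_ray_weight _ c s)).
apply: measurable_funX; apply: (measurableT_comp (measurable_powR (-1))).
exact: (measurable2 (@continuous_cos R)).
Qed.

Let polar_integrand_ge0 c s p : (0 <= (EFin \o polar_integrand c s) p)%E.
Proof.
rewrite /= lee_fin /polar_integrand; case: ifP => // /and5P[h1 h2 _ _ _].
rewrite mulr_ge0//; first by rewrite (polar_weight_ge0 r0 r1)// !ltW.
by rewrite mulr_ge0 ?ray_weight_ge0// exprn_ge0// powR_ge0.
Qed.

Let cos_gt0 b : 0 < b < pi / 2 -> 0 < cos b.
Proof. by move=> /andP[h k]; apply: cos_gt0_pihalf; rewrite k andbT; have := pi_gt0 R; lra. Qed.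

Let polar_integrandE c s th b : 0 < th < pi -> 0 < b < pi / 2 ->
  polar_integrand c s (th, b) = if polar_region r b th then
    polar_weight r th * (ray_weight c s b * (cos b)^-1 ^+ 3) else 0.
Proof.
move=> /andP[t0 tp] bI; have [b0 bp] := andP bI.
by rewrite /polar_integrand /inside/= t0 tp b0 bp/= powR_inv1// ltW// cos_gt0.
Qed.

Let polar_integrand_out c s th b : ~~ ((0 < th < pi) && (0 < b < pi / 2)) ->
  polar_integrand c s (th, b) = 0.
Proof.
by rewrite /polar_integrand /inside /= -!andbA; case: ifP => // /and5P[-> -> -> -> _].
Qed.

Let inner_b c s th : 0 < th < pi -> axial_height r th != 0 ->
  (\int[mu]_b (polar_integrand c s (th, b))%:E = (d / 8 * axial_integrand r c s th)%:E)%E.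
Proof.
move=> thp w0; rewrite axial_integrand_fiber// -/d.
set B := atan _; have Bp : B < pi / 2 by exact: atan_ltpi2.
pose g b := ray_weight c s b * (cos b)^-1 ^+ 3.
have gc : {within `[0, B], continuous g} by exact: continuous_ray_weight_div_cube.
transitivity (\int[mu]_b (if (0 < b < B)%R then (polar_weight r th * g b)%R else 0%R)%:E)%E.
  apply: eq_integral => b _; congr EFin.
  have [bI|bI] := boolP (0 < b < pi / 2).
    rewrite polar_integrandE// polar_region_atan// -/B.
    by case/andP: bI => ->.
  rewrite polar_integrand_out ?(negbTE bI) ?andbF//.
  case: ifP => // /andP[b0 bB]; move: bI.
  by rewrite b0 (lt_trans bB).
rewrite (integral_if_itv (h := fun b => polar_weight r th * g b)).
  rewrite RintegralZl//; last first.
    by apply: continuous_compact_integrable => //; exact: segment_compact.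
  congr EFin; rewrite mulrA; set I := \int[_]_(_ in _) _.
  by rewrite (_ : d / 8 * (8 / d) = 1) ?mul1r//; field; rewrite gt_eqF.
by move=> x; apply: cvgM; [exact: cvg_cst|exact: gc].
Qed.

(** One quarter of [ray_moment r a / a ^+ 3] at a = r cos b: it decreases in [b] because that
    quotient increases in a. It does not involve the direction. *)
Let G b : R := ray_moment r (r * cos b) / (4 * r ^+ 3) * (cos b)^-1 ^+ 3.

Let inner_th c s b : 0 < b < pi / 2 ->
  (\int[mu]_th (polar_integrand c s (th, b))%:E = (ray_weight c s b * G b)%:E)%E.
Proof.
move=> bI; have [t1 [t2 [h1 h2 h3 h4 h5]]] := polar_slice r0 r1 bI.
pose k := ray_weight c s b * (cos b)^-1 ^+ 3.
transitivity (\int[mu]_th (if (t1 < th < t2)%R then (k * polar_weight r th)%R else 0%R)%:E)%E.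
  apply: eq_integral => th _; congr EFin.
  have [tI|tI] := boolP (0 < th < pi).
    by rewrite polar_integrandE// h4// [k * _]mulrC.
  rewrite polar_integrand_out ?(negbTE tI)//.
  case: ifP => // /andP[u v]; move: tI.
  by rewrite (le_lt_trans h1 u) (lt_le_trans v h3).
have pc : continuous (fun th => k * polar_weight r th).
  move=> x; apply: cvgM; first exact: cvg_cst.
  exact: continuous_polar_weight.
rewrite (integral_if_itv (h := fun th => k * polar_weight r th)); last first.
  exact: continuous_subspaceT.
rewrite RintegralZl//; last first.
  apply: continuous_compact_integrable; first exact: segment_compact.
  by apply: continuous_subspaceT; exact: (continuous_polar_weight r0 r1).
by rewrite h5 /G /k; congr EFin; ring.
Qed.

(** Tonelli for the nonnegative [polar_integrand]: its integral in [b] is [axial_integrand] up to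
    the factor d / 8, and its integral in [th] is the weight times [G]. The angle [th0] at which the
    height vanishes is removed as a null set and put back. *)
Let integral_axial_integrand c s :
  (\int[mu]_(th in `[0%R, pi]) (axial_integrand r c s th)%:E =
   (8 / d)%:E * \int[mu]_(b in `]0%R, (pi / 2)%R[) (ray_weight c s b * G b)%:E)%E.
Proof.
have [[mh _] _] := axial_gradient_massE c s (ltW r0) r1.
have {}mh (A : set R) : measurable_fun A (EFin \o axial_integrand r c s : RR -> _).
  by apply/measurable_EFinP; apply: measurable_funTS.
pose th0 : R := acos (r * (3 - r ^+ 2) / 2).
pose D : set R := `]0, pi[%classic `\ th0.
have mD : measurable (D : set RR).
  by apply: measurableD => //; exact: measurable_itv.
pose F th := (\int[mu]_b (polar_integrand c s (th, b))%:E)%E.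
have mF (A : set R) : measurable_fun A (F : RR -> _).
  apply: measurable_funTS.
  exact: (measurable_fun_fubini_tonelli_F _ (measurable_polar_integrand c s) (polar_integrand_ge0 c s)).
have F0 th : (0 <= F th)%E.
  by apply: integral_ge0 => b _; exact: (polar_integrand_ge0 c s (th, b)).
rewrite integral_itv_bndoo; last exact: mh.
rewrite -(integral_setD1 mD (mh D)).
transitivity (\int[mu]_(th in D) ((8 / d)%:E * F th))%E.
  apply: eq_integral => th; rewrite inE => -[/=]; rewrite in_itv/= => thI nth.
  have w0 : axial_height r th != 0.
    apply: contra_notN nth => /eqP h; rewrite /th0.
    have -> : r * (3 - r ^+ 2) / 2 = cos th by apply/eqP; rewrite eq_sym -subr_eq0; apply/eqP.
    by rewrite cosK// in_itv/=; case/andP: thI => /ltW-> /ltW->.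
  rewrite /F inner_b// -EFinM mulrA; congr EFin.
  by rewrite (_ : 8 / d * (d / 8) = 1) ?mul1r//; field; rewrite gt_eqF.
rewrite (ge0_integralZl mu mD (mF D))//; last by rewrite lee_fin divr_ge0// ltW.
congr (_ * _)%E.
rewrite (integral_setD1 mD (mF D)).
transitivity (\int[mu]_th F th)%E.
  rewrite integral_mkcond; apply: eq_integral => th _.
  rewrite patchE mem_setE in_itv/=; case: ifPn => // thI.
  rewrite /F integral0_eq// => b _; rewrite polar_integrand_out// negb_and thI//.
rewrite /F (fubini_tonelli (EFin \o polar_integrand c s))//.
rewrite [RHS]integral_mkcond; apply: eq_integral => b _.
rewrite patchE mem_setE in_itv/=; case: ifPn => [/(inner_th c s)//|bI].
by rewrite integral0_eq// => th _ /=; rewrite polar_integrand_out// negb_and bI orbT.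
Qed.

Let GE b : 0 < b < pi / 2 -> G b = ray_moment r (r * cos b) / (r * cos b) ^+ 3 / 4.
Proof.
move=> /cos_gt0 c0; rewrite /G; move: (ray_moment _ _) => m.
by field; rewrite !gt_eqF.
Qed.

Let measurable_G : measurable_fun (`]0, pi / 2[%classic : set RR) (G : RR -> RR).
Proof.
apply: open_continuous_measurable_fun; first exact: interval_open.
move=> b; rewrite inE/= in_itv/= => bI; have c0 := cos_gt0 bI.
have ab : 0 <= r * cos b <= r.
  by rewrite mulr_ge0 ?(ltW r0) ?(ltW c0)//= ler_piMr ?cos_le1// ltW.
have h := @is_derive_comp R (ray_moment r) (fun b => r * cos b) b _ _
  (is_derive_ray_moment r0 r1 ab) (is_derive_cmul r (is_derive_cos b)).
have cm : {for b, continuous (fun b => ray_moment r (r * cos b))}.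
  by apply: differentiable_continuous; apply/derivable1_diffP; case: h.
have cV : {for b, continuous (fun b : R => (cos b)^-1)}.
  by apply: cvgV; [rewrite gt_eqF|exact: continuous_cos].
apply: cvgM; first by apply: cvgM; [exact: cm|exact: cvg_cst].
by do 2 (apply: cvgM; first exact: cV); exact: cV.
Qed.

Let G_ge0 b : 0 < b < pi / 2 -> 0 <= G b.
Proof.
move=> bI; have [t1 [t2 [h1 h2 h3 h4 h5]]] := polar_slice r0 r1 bI.
rewrite /G -h5 mulr_ge0//; last by rewrite exprn_ge0// invr_ge0 ltW// cos_gt0.
apply: Rintegral_ge0 => th /=; rewrite in_itv/= => /andP[u v].
by apply: (polar_weight_ge0 r0 r1); rewrite (le_trans h1 u) (le_trans v h3).
Qed.

Let G_antitone a b : 0 < a < pi / 2 -> 0 < b < pi / 2 -> a <= b -> G b <= G a.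
Proof.
move=> aI bI ab; have ca := cos_gt0 aI; have cb := cos_gt0 bI.
rewrite !GE// ler_pM2r ?invr_gt0//; apply: ray_moment_div_cube_le => //.
- exact: mulr_gt0.
- rewrite ler_pM2l//; have [->//|/eqP nab] := eqVneq a b.
  apply/ltW; rewrite ltr_cos_itv; first by rewrite lt_neqAle ab andbT; apply/eqP.
    by case/andP: bI => /ltW-> h/=; have := pi_gt0 R; lra.
  by case/andP: aI => /ltW-> h/=; have := pi_gt0 R; lra.
- by rewrite ler_piMr ?cos_le1// ltW.
Qed.

Lemma axial_gradient_mass_le_radial c s : c ^+ 2 + s ^+ 2 = 1 ->
  axial_gradient_mass r c s <= axial_gradient_mass r 1 0.
Proof.
move=> cs.
have [b1 ->] := axial_gradient_massE c s (ltW r0) r1.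
have [b2 ->] := axial_gradient_massE 1 0 (ltW r0) r1.
rewrite ler_pM2l ?invr_gt0 ?pi_gt0// /Rintegral.
have fn c' s' : bounded_measurable (axial_integrand r c' s' : RR -> R) ->
    (\int[mu]_(th in `[0%R, pi]) (axial_integrand r c' s' th)%:E)%E \is a fin_num.
  move=> [mh [M hM]]; apply: integrable_fin_num => //.
  apply: measurable_bounded_integrable => //.
  - by apply: compact_finite_measure; exact: segment_compact.
  - exact: measurable_funTS.
  - by exists M; split; [exact: num_real|move=> x Mx t _; apply: (le_trans (hM t)); exact: ltW].
(* The comparison takes place in the extended reals, where Tonelli and the rearrangement are stated;
   boundedness of [axial_integrand] makes both sides finite. *)
apply: fine_le; [exact: fn|exact: fn|].
rewrite !integral_axial_integrand lee_pmul2l ?lte_fin ?divr_gt0//.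
apply: (le_trans (ray_weight_rearrangement cs measurable_G _ _)).
- by move=> b /=; rewrite in_itv/=; exact: G_ge0.
- by move=> a b /=; rewrite !in_itv/=; exact: G_antitone.
rewrite le_eqVlt; apply/orP; left; apply/eqP; apply: eq_integral => b.
rewrite inE/= in_itv/= => bI; rewrite /ray_weight mul0r mul1r subr0 addr0.
by rewrite (gtr0_norm (cos_gt0 bI)); congr EFin; field.
Qed.

End RadialDomination.

(** * The center of the ball *)

Section RadialLimit.
Context {R : realType}.
Implicit Types r c s : R.

Lemma unif_cont_at_norm (V : topologicalType) T (x : V) (K : V -> T -> R) :
  unif_cont_at x K -> unif_cont_at x (fun y w => `|K y w|).
Proof.
move=> [[M KM] cK]; split; first by exists M => w; rewrite normr_id.
move=> e /cK; apply: filterS => y h w.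
exact: (le_trans (ler_dist_dist _ _)).
Qed.

(** The mass depends continuously on the point, because the kernel derivative does so uniformly over
    the sphere. This settles both the value of the constant at the centre and the inequality
    there. *)
Lemma axial_gradient_mass_cvg0 c s :
  axial_gradient_mass r c s @[r --> 0^'+] --> axial_gradient_mass 0 c s.
Proof.
apply: cvg_at_right_filter.
pose l : 'rV[R]_4 := c *: delta_mx 0 (inord 0) + s *: delta_mx 0 (inord 1).
pose e0 : 'rV[R]_4 := delta_mx 0 (inord 0).
have z1 : unit_ball R 4 0 by apply/unit_ballE; rewrite dotv0l.
have udens : unif_cont_at (0 : 'rV[R]_4) (fun=> @angle_density R).
  by apply: unif_cont_at_cst; have [] := @bounded_measurable_angle_density R.
pose gm y := gradient_mass angles_prob sphere angle_density y l.
have h : {for (0 : R) *: e0, continuous gm}.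
  rewrite scale0r; apply: continuous_Rintegral_param.
    apply: unif_cont_atM; last first.
      apply: unif_cont_at_norm.
      exact: (unif_cont_at_poisson1 (@dotv_sphere_sphere R) (@measurable_sphere R) l z1).
    exact: udens.
  apply: filterS (near_unit_ball z1) => y y1.
  apply: bounded_measurableM; first exact: bounded_measurable_angle_density.
  apply: bounded_measurable_norm.
  exact: (bounded_measurable_poisson1 (@dotv_sphere_sphere R) (@measurable_sphere R)).
have hs : {for 0, continuous (fun r : R => r *: e0)} by exact: scalel_continuous.
exact: (continuous_comp hs h).
Qed.

Lemma khavinson4E r : 0 <= r -> r < 1 -> khavinson4 r = axial_gradient_mass r 1 0.
Proof.
move=> r0 r1; rewrite /khavinson4; have [->|rn] := eqVneq r 0; last first.
  by rewrite axial_gradient_mass_radial// lt_neqAle eq_sym rn.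
(* For small t > 0 the formula is the radial mass, whose limit at 0 is its value there; no expansion
   of the 0/0 expression is involved. *)
apply: cvg_lim => //.
apply: cvg_trans; last exact: (axial_gradient_mass_cvg0 (c := 1) (s := 0)).
apply: near_eq_cvg; near=> t; have t0 : 0 < t by near: t; exact: nbhs_right_gt.
have t1 : t < 1 by near: t; exact: nbhs_right_lt.
by rewrite axial_gradient_mass_radial.
Unshelve. all: by end_near. Qed.

Lemma axial_gradient_mass_le_khavinson4 r c s : 0 <= r -> r < 1 -> c ^+ 2 + s ^+ 2 = 1 ->
  axial_gradient_mass r c s <= khavinson4 r.
Proof.
move=> r0 r1 cs; rewrite (khavinson4E r0 r1).
move: r0; rewrite le_eqVlt => /predU1P[<-|r0]; last exact: axial_gradient_mass_le_radial.
apply: (ler_cvg_to (axial_gradient_mass_cvg0 (c := c) (s := s)) (axial_gradient_mass_cvg0 (c := 1) (s := 0))).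
near=> t; have t0 : 0 < t by near: t; exact: nbhs_right_gt.
have t1 : t < 1 by near: t; exact: nbhs_right_lt.
exact: axial_gradient_mass_le_radial.
Unshelve. all: by end_near. Qed.

End RadialLimit.

Theorem theorem1p3 (R : realType) (x : 'rV[R]_4) (hx : unit_ball R 4 x) :
  (forall u : 'rV[R]_4 -> R, bounded_harmonic u ->
     enorm (gradient u x) <=
       khavinson4 (enorm x) * sup_norm (unit_ball R 4) u) /\
  (forall C : R,
     (forall u : 'rV[R]_4 -> R, bounded_harmonic u ->
        enorm (gradient u x) <= C * sup_norm (unit_ball R 4) u) ->
     khavinson4 (enorm x) <= C).
Proof.
have x0 : 0 <= enorm x by exact: sqrtr_ge0.
split=> [u uh|C hC].
  by apply: enorm_gradient_le => // c s; exact: axial_gradient_mass_le_khavinson4.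
by rewrite khavinson4E//; exact: axial_gradient_mass_le.
Qed.
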